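(* Let $0<s<1$ and $1<p<\infty$ be such that $sp<n$. Suppose that $G\neq\emptyset$ is a bounded open set in $\mathbb{R}^n$. Then the following conditions (A) and (B) are equivalent. (A) $G$ admits an $(s,p)$-Hardy inequality. (B) The capacity $\mathrm{cap}_{s,p}(\cdot,G)$ is weakly $\mathcal{W}(G)$-quasiadditive, and there exists a constant $c>0$ such that $$\ell(Q)^{n-sp}\le c\,\mathrm{cap}_{s,p}(Q,G)$$ for every $Q\in\mathcal{W}(G)$.
   Context: $C_c(G)$ denotes the continuous functions $f:G\to\mathbb{R}$ with compact support in $G$. For a measurable function $u$ on $G$ that is finite almost everywhere, $$\lvert u\rvert_{W^{s,p}(G)}=\bigg(\int_G\int_G\frac{\lvert u(x)-u(y)\rvert^p}{\lvert x-y\rvert^{n+sp}}\,dy\,dx\bigg)^{1/p}.$$ An open set $\emptyset\neq G\subsetneq\mathbb{R}^n$ admits an $(s,p)$-Hardy inequality if there is a constant $C>0$ such that $$\int_G\frac{\lvert f(x)\rvert^p}{\operatorname{dist}(x,\partial G)^{sp}}\,dx\le C\int_G\int_G\frac{\lvert f(x)-f(y)\rvert^p}{\lvert x-y\rvert^{n+sp}}\,dy\,dx$$ holds for all $f\in C_c(G)$. For a compact set $K\subset G$, the $(s,p)$-capacity is $$\mathrm{cap}_{s,p}(K,G)=\inf_u \lvert u\rvert_{W^{s,p}(G)}^p,$$ where the infimum is taken over all real-valued $u\in C_c(G)$ such that $u(x)\ge 1$ for every $x\in K$. $\mathcal{W}(G)$ denotes the (standard, as in Stein's book ''Singular integrals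 and differentiability properties of functions'', VI.1) Whitney decomposition of $G$: a family of closed dyadic cubes with pairwise disjoint interiors, whose union is $G$, and which satisfy $\mathrm{diam}(Q)\le\operatorname{dist}(Q,\partial G)\le 4\,\mathrm{diam}(Q)$ for every $Q\in\mathcal{W}(G)$. The side length of a cube $Q$ is $\ell(Q)$. The capacity $\mathrm{cap}_{s,p}(\cdot,G)$ is weakly $\mathcal{W}(G)$-quasiadditive if there exists a constant $N>0$ such that $$\sum_{Q\in\mathcal{W}(G)}\mathrm{cap}_{s,p}(K\cap Q,G)\le N\,\mathrm{cap}_{s,p}(K,G)$$ whenever $K=\bigcup_{Q\in\mathcal{E}}Q$ and $\mathcal{E}\subset\mathcal{W}(G)$ is a finite family of Whitney cubes. *)

(* Defs.v *)
From HB Require Import structures.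
From mathcomp Require Import all_boot all_order all_algebra.
From mathcomp Require Import all_classical all_reals all_analysis.
Set Implicit Arguments.
Unset Strict Implicit.
Unset Printing Implicit Defensive.
Import Order.TTheory GRing.Theory Num.Theory.
Import numFieldNormedType.Exports.
Local Open Scope classical_set_scope.
Local Open Scope ring_scope.

(* R^n is 'rV[R]_n: its topology is the library's, the sigma-algebra below is
   the product of the Borel sigma-algebras, i.e. the Borel sigma-algebra. *)

Definition measure_rV_display : measure_display -> measure_display.
Proof. exact. Qed.

Section measurable_rV.
Context {d} {T : sigmaRingType d} (n : nat).

Let coords (i : 'I_n) (x : 'rV[T]_n) : T := x ord0 i.

Let rV_set0 : g_sigma_preimage coords set0.
Proof. exact: sigma_algebra0. Qed.

Let rV_setC A : g_sigma_preimage coords A -> g_sigma_preimage coords (~` A).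
Proof. exact: sigma_algebraC. Qed.

Let rV_bigcup (F : (set 'rV[T]_n)^nat) :
  (forall i, g_sigma_preimage coords (F i)) ->
  g_sigma_preimage coords (\bigcup_i (F i)).
Proof. exact: sigma_algebra_bigcup. Qed.

HB.instance Definition _ := @isMeasurable.Build (measure_rV_display d)
  'rV[T]_n (g_sigma_preimage coords) rV_set0 rV_setC rV_bigcup.

End measurable_rV.

Lemma measurable_rV_coord d (T : measurableType d) n (i : 'I_n) :
  measurable_fun [set: 'rV[T]_n] (fun x => x ord0 i).
Proof.
move=> _ Y mY; rewrite setTI; apply: sub_sigma_algebra => /=.
rewrite -bigcup_seq/=; exists i => /=; first by rewrite mem_index_enum.
by exists Y => //; rewrite setTI.
Qed.

Lemma measurable_fun_rV d1 d2 (T1 : measurableType d1) (T2 : measurableType d2)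
    n (f : T1 -> 'rV[T2]_n) :
  (forall i, measurable_fun [set: T1] (fun x => f x ord0 i)) ->
  measurable_fun [set: T1] f.
Proof.
move=> mf _ A mA; rewrite setTI.
suff: image_set_system setT f measurable A by rewrite /image_set_system/= setTI.
apply: (smallest_sub _ _ mA) => [|B].
  exact/sigma_algebra_image/sigma_algebra_measurable.
rewrite /= -bigcup_seq/= => -[i _ [Y mY <-]].
by rewrite /image_set_system /= !setTI -[_ @^-1` _]setTI; exact: mf.
Qed.

Section lebesgue_rV.
Context {R : realType}.

Section step.
Context (n : nat).

Definition cons_rV (z : measurableTypeR R * 'rV[R]_n) : 'rV[R]_n.+1 :=
  row_mx z.1%:M z.2 : 'rV_(1 + n).

Definition uncons_rV (x : 'rV[R]_n.+1) : measurableTypeR R * 'rV[R]_n :=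
  (x ord0 ord0, rsubmx (x : 'rV_(1 + n))).

Lemma cons_rVK : cancel cons_rV uncons_rV.
Proof.
case=> a v; rewrite /uncons_rV /cons_rV /= row_mxKr; congr (_, _).
rewrite (_ : ord0 = lshift n (ord0 : 'I_1) :> 'I_(1 + n)); last exact/val_inj.
by rewrite (row_mxEl a%:M v) mxE eqxx mulr1n.
Qed.

Lemma measurable_cons_rV : measurable_fun setT cons_rV.
Proof.
apply: measurable_fun_rV => i; rewrite /cons_rV.
have [j ij|j ij] := split_ordP (i : 'I_(1 + n)).
  rewrite [X in measurable_fun _ X](_ : _ = fst); first exact: measurable_fst.
  by apply/funext => z; rewrite ij (row_mxEl z.1%:M z.2) mxE (ord1 j) eqxx mulr1n.
rewrite [X in measurable_fun _ X](_ : _ = (fun x : 'rV[R]_n => x ord0 j) \o snd).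
  exact: measurableT_comp (measurable_rV_coord j) measurable_snd.
by apply/funext => z; rewrite ij (row_mxEr z.1%:M z.2).
Qed.

Lemma measurable_uncons_rV : measurable_fun setT uncons_rV.
Proof.
apply/measurable_fun_pairP; split; first exact: measurable_rV_coord.
apply: measurable_fun_rV => i.
rewrite [X in measurable_fun _ X](_ : _ = fun x : 'rV[R]_n.+1 => x ord0 (rshift 1 i)).
  exact: measurable_rV_coord.
by apply/funext => x /=; rewrite !mxE.
Qed.

Context (mu : {sigma_finite_measure set 'rV[R]_n -> \bar R}).

Definition lebesgue_cons : set 'rV[R]_n.+1 -> \bar R :=
  pushforward (@lebesgue_measure R \x mu)%E cons_rV.

HB.instance Definition _ := Measure.copy lebesgue_cons
  (measure_function_pushforward__canonical__measure_function_Measure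
    (product_measure1 (@lebesgue_measure R) mu : set _ -> \bar R)
    measurable_cons_rV).

Lemma lebesgue_cons_sigma_finite : sigma_finite setT lebesgue_cons.
Proof.
have /sigma_finiteP[F [TF ndF Foo]] := sigma_finiteT (@lebesgue_measure R).
have /sigma_finiteP[G [TG ndG Goo]] := sigma_finiteT mu.
exists (fun i => uncons_rV @^-1` (F i `*` G i)).
  apply/seteqP; split=> // x _.
  have [i _ Fi] : (\bigcup_i F i) (uncons_rV x).1 by rewrite -TF.
  have [j _ Gj] : (\bigcup_i G i) (uncons_rV x).2 by rewrite -TG.
  exists (maxn i j) => //; split => /=.
  - by move: Fi; apply/subsetPset/ndF/leq_maxl.
  - by move: Gj; apply/subsetPset/ndG/leq_maxr.
move=> i; have [mF Fioo] := Foo i; have [mG Gioo] := Goo i; split.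
  rewrite -[X in measurable X]setTI; apply: measurable_uncons_rV => //.
  exact: measurableX.
rewrite /lebesgue_cons /pushforward -comp_preimage.
rewrite [X in X @^-1` _](_ : _ = id); last first.
  by apply/funext => z; exact: cons_rVK.
by rewrite preimage_id product_measure1E// lte_mul_pinfty// ge0_fin_numE.
Qed.

HB.instance Definition _ := @Measure_isSigmaFinite.Build _ _ _ lebesgue_cons
  lebesgue_cons_sigma_finite.

End step.

(* Lebesgue measure on R^n: R^0 is a single point of mass 1, and R^(n+1) carries
   the product measure of R and R^n. *)
Fixpoint lebesgue_rV (n : nat) : {sigma_finite_measure set 'rV[R]_n -> \bar R} :=
  match n with
  | 0 => \d_(0 : 'rV[R]_0)
  | m.+1 => lebesgue_cons (lebesgue_rV m)
  end.

End lebesgue_rV.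

Lemma lebesgue_rV_box (R : realType) n (A : 'I_n -> set R) :
  (forall i, measurable (A i)) ->
  lebesgue_rV n [set x | forall i, A i (x ord0 i)] =
  (\prod_(i < n) lebesgue_measure (A i))%E.
Proof.
elim: n A => [|n IH] A mA.
  by rewrite big_ord0 /= diracE mem_set// => -[].
rewrite big_ord_recl -(IH (fun i => A (lift ord0 i)))//=.
rewrite /lebesgue_cons /pushforward.
have mB : measurable [set x : 'rV[R]_n | forall i, A (lift ord0 i) (x ord0 i)].
  rewrite (_ : [set x | _] = \bigcap_(i in [set: 'I_n])
     ((fun x : 'rV[R]_n => x ord0 i) @^-1` A (lift ord0 i))).
    apply: fin_bigcap_measurable => // i _.
    by rewrite -[X in measurable X]setTI; exact: measurable_rV_coord.
  by apply/seteqP; split => x /= + i; [move=> + _|move=> /(_ i I)]; exact.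
have mA0 : measurable (A ord0 : set (measurableTypeR R)) by exact: mA.
rewrite -(product_measure1E _ _ mA0 mB).
congr (product_measure1 _ _ _).
have E (z : measurableTypeR R * 'rV[R]_n) : cons_rV z ord0 ord0 = z.1.
  by have := cons_rVK z; case: z => a b [].
apply/seteqP; split => -[a b] /=.
  move=> H; split; first by have := H ord0; rewrite E.
  move=> i; have := H (lift ord0 i).
  rewrite (_ : lift ord0 i = rshift 1 i); last exact/val_inj.
  by rewrite /cons_rV (row_mxEr a%:M b).
move=> [Aa Ab] i; have [->|] := eqVneq i ord0; first by rewrite E.
case: (unliftP ord0 i) => [j ->|->]; last by rewrite eqxx.
move=> _; have := Ab j.
rewrite (_ : lift ord0 j = rshift 1 j); last exact/val_inj.
by rewrite /cons_rV (row_mxEr a%:M b).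
Qed.

Section whitney_hardy.
Context {R : realType} {n : nat}.
Implicit Types (x y : 'rV[R]_n) (A B G K : set 'rV[R]_n) (s p : R).

(* The library norm of 'rV[R]_n is the sup norm, hence this one. *)
Definition eucl_norm x : R := Num.sqrt (\sum_(i < n) x ord0 i ^+ 2).

Definition set_dist A B : R :=
  inf [set eucl_norm (z.1 - z.2) | z in A `*` B].

Definition diam A : R := sup [set eucl_norm (z.1 - z.2) | z in A `*` A].

Definition boundary A : set 'rV[R]_n := closure A `\` interior A.

(* C_c(G): a function on G is represented by its extension by zero to R^n; it is
   continuous with compact support in G iff the extension satisfies this. *)
Definition Cc G : set ('rV[R]_n -> R) :=
  [set u | [/\ continuous u, compact (closure [set x | u x != 0])
             & closure [set x | u x != 0] `<=` G]].

Definition gagliardo_energy s p G (u : 'rV[R]_n -> R) : \bar R :=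
  (\int[lebesgue_rV n]_(x in G) \int[lebesgue_rV n]_(y in G)
    (`|u x - u y| `^ p / eucl_norm (x - y) `^ (n%:R + s * p))%:E)%E.

Definition gagliardo_seminorm s p G (u : 'rV[R]_n -> R) : \bar R :=
  (gagliardo_energy s p G u `^ p^-1)%E.

Definition admits_hardy s p G : Prop :=
  exists C : R, 0 < C /\ forall f, Cc G f ->
    (\int[lebesgue_rV n]_(x in G)
       (`|f x| `^ p / set_dist [set x] (boundary G) `^ (s * p))%:E
     <= C%:E * gagliardo_energy s p G f)%E.

Definition capacity s p K G : \bar R :=
  ereal_inf [set (gagliardo_seminorm s p G u `^ p)%E | u in
              [set u | Cc G u /\ forall x, K x -> 1 <= u x]].

(* (k, m) encodes the closed dyadic cube 2^k (m + [0, 1]^n), k in Z, m in Z^n;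
   for n > 0 this encoding is injective. *)
Definition dyadic : Type := (int * 'rV[int]_n)%type.

Definition side (Q : dyadic) : R := 2 ^ Q.1.

Definition cube (Q : dyadic) : set 'rV[R]_n :=
  [set x | forall i, side Q * (Q.2 ord0 i)%:~R <= x ord0 i
                     <= side Q * (Q.2 ord0 i + 1)%:~R].

Definition whitney_decomposition G (W : set dyadic) : Prop :=
  [/\ \bigcup_(Q in W) cube Q = G,
      forall P Q, W P -> W Q -> P <> Q ->
        interior (cube P) `&` interior (cube Q) = set0
    & forall Q, W Q ->
        diam (cube Q) <= set_dist (cube Q) (boundary G) <= 4 * diam (cube Q)].

Definition weakly_quasiadditive s p G (W : set dyadic) : Prop :=
  exists N : R, 0 < N /\ forall E : set dyadic, finite_set E -> E `<=` W ->
    let K := \bigcup_(Q in E) cube Q in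
    (\esum_(Q in W) capacity s p (K `&` cube Q) G <= N%:E * capacity s p K G)%E.

End whitney_hardy.

Arguments dyadic n : clear implicits.

(* Main.v *)
Require Import Defs.
From mathcomp Require Import all_boot all_order all_algebra.
From mathcomp Require Import all_classical all_reals all_analysis.
From mathcomp Require Import measurable_realfun ring lra.
Set Implicit Arguments.
Unset Strict Implicit.
Unset Printing Implicit Defensive.
Import Order.TTheory GRing.Theory Num.Theory.
Import numFieldNormedType.Exports.
Local Open Scope classical_set_scope.
Local Open Scope ring_scope.

(** Write [w Q = side Q ^ (n - s p)] for a Whitney cube [Q] and [d] for the
    distance to the boundary. Since [d] is comparable to [side Q] on [Q], the
    weight [w Q] is comparable to the integral of [d ^ (- s p)] over [Q]. Both
    directions compare energies with sums of such weights.

    The Hardy inequality implies quasiadditivity. A competitor for the capacity of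
    a union [K] of finitely many Whitney cubes is at least [1] on [K], so the
    Hardy inequality bounds the sum of the weights of these cubes by a multiple
    of the capacity of [K] ([sum_weight_le_capacity]); a single cube gives the
    lower capacity bound. Conversely the capacity of a Whitney cube [Q] is at
    most a multiple of [w Q], as the energy of a Lipschitz bump shows
    ([capacity_cube_le]). A Whitney cube meeting [K] touches one of the cubes of
    [K], and counting volumes shows that the weights of all cubes touching a
    given [P] add up to at most a multiple of [w P] ([sum_touching_le]). These
    three facts give quasiadditivity.

    Quasiadditivity and the lower capacity bound imply the Hardy inequality. It is
    enough to treat a nonnegative [F]. Let [g x] be the average of [F] over the
    shifts [x + (d x / n) z], with [z] in a box of volume [1] ([mollify]). On a
    cube [Q], the Hardy integral of [F] is bounded by a part of the energy of [F],
    from the oscillation of [F] around an average, plus [w Q * m ^ p], where [m]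
    is the minimum of [g] on [Q] ([whitney_cube_estimate]). The sum of the latter
    terms is bounded by the energy of [g] with Maz'ya's truncation
    ([sum_weight_powR_le_energy]): at each dyadic level the hypotheses are applied
    to the cubes on which [g] exceeds the level, with the slice of [g] just below
    that level as a competitor, and the energies of the slices add up.

    It remains to bound the energy of [g] by that of [F] ([energy_mollify]).
    Jensen's inequality reduces this to a single shift, which is a bi-Lipschitz map
    because [d] is [1]-Lipschitz. Its change of variables only uses that a map
    which does not contract distances too much pulls open sets back to sets of
    comparable volume ([lebesgue_preimage_open]); by the layer-cake formula this
    passes to functions with open superlevel sets, such as the difference quotient
    in one of its variables. *)

(** * The Euclidean norm and the distance to a set *)

Section euclidean.
Context {R : realType} {n : nat}.
Implicit Types x y z : 'rV[R]_n.
Local Notation N := (@eucl_norm R n).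

Lemma eucl_norm_ge0 x : 0 <= N x.
Proof. exact: sqrtr_ge0. Qed.

Lemma eucl_norm_sqr x : N x ^+ 2 = \sum_(i < n) x ord0 i ^+ 2.
Proof. by rewrite sqr_sqrtr// sumr_ge0// => i _; exact: sqr_ge0. Qed.

Lemma eucl_normZ (r : R) x : N (r *: x) = `|r| * N x.
Proof.
rewrite /eucl_norm (eq_bigr (fun i => r ^+ 2 * x ord0 i ^+ 2)); last first.
  by move=> i _; rewrite mxE exprMn.
by rewrite -mulr_sumr sqrtrM ?sqr_ge0// sqrtr_sqr.
Qed.

Lemma eucl_normN x : N (- x) = N x.
Proof. by rewrite -scaleN1r eucl_normZ normrN1 mul1r. Qed.

Lemma eucl_normB x y : N (x - y) = N (y - x).
Proof. by rewrite -eucl_normN opprB. Qed.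

Lemma eucl_norm0 : N 0 = 0.
Proof. by rewrite -(scale0r 0) eucl_normZ normr0 mul0r. Qed.

Lemma coord_le_eucl_norm x i : `|x ord0 i| <= N x.
Proof.
rewrite -sqrtr_sqr ler_wsqrtr// (bigD1 i)//= lerDl sumr_ge0// => j _.
exact: sqr_ge0.
Qed.

Lemma eucl_norm_eq0 x : N x = 0 -> x = 0.
Proof.
move=> x0; apply/rowP => i; rewrite mxE; apply/eqP; rewrite -normr_le0.
by rewrite -x0 coord_le_eucl_norm.
Qed.

Lemma eucl_norm_gt0 x : (0 < N x) = (x != 0).
Proof.
rewrite lt_neqAle eucl_norm_ge0 andbT eq_sym; congr (~~ _).
by apply/eqP/eqP => [/eucl_norm_eq0//|->]; exact: eucl_norm0.
Qed.

Lemma cauchy_schwarz x y : \sum_(i < n) x ord0 i * y ord0 i <= N x * N y.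
Proof.
have [->|x0] := eqVneq x 0.
  by rewrite eucl_norm0 mul0r big1// => i _; rewrite mxE mul0r.
have [->|y0] := eqVneq y 0.
  by rewrite eucl_norm0 mulr0 big1// => i _; rewrite mxE mulr0.
have Nx : 0 < N x by rewrite eucl_norm_gt0.
have Ny : 0 < N y by rewrite eucl_norm_gt0.
rewrite -[leRHS]mulr1 -ler_pdivrMl ?mulr_gt0// mulr_sumr.
(* the arithmetic-geometric mean for the two normalized vectors *)
have H i : (N x * N y)^-1 * (x ord0 i * y ord0 i) <=
    2^-1 * ((N x)^-2 * x ord0 i ^+ 2 + (N y)^-2 * y ord0 i ^+ 2).
  rewrite invfM -subr_ge0.
  rewrite (_ : _ - _ = 2^-1 * ((N x)^-1 * x ord0 i - (N y)^-1 * y ord0 i) ^+ 2).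
    by rewrite mulr_ge0// sqr_ge0.
  by rewrite -!exprVn; field; rewrite !gt_eqF.
apply: le_trans; first by apply: ler_sum => i _; exact: H.
rewrite -mulr_sumr big_split/= -!mulr_sumr -!eucl_norm_sqr.
by rewrite !mulVf ?sqrf_eq0 ?gt_eqF// mulVf.
Qed.

Lemma eucl_normD x y : N (x + y) <= N x + N y.
Proof.
rewrite -(@ler_pXn2r _ 2)// ?nnegrE ?addr_ge0 ?eucl_norm_ge0//.
rewrite sqrrD !eucl_norm_sqr.
rewrite (eq_bigr (fun i => x ord0 i ^+ 2 + (x ord0 i * y ord0 i + x ord0 i * y ord0 i) +
   y ord0 i ^+ 2)); last by move=> i _; rewrite mxE sqrrD mulr2n.
by rewrite !big_split/= lerD2r lerD2l mulr2n lerD ?cauchy_schwarz.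
Qed.

Lemma eucl_distD y x z : N (x - z) <= N (x - y) + N (y - z).
Proof. by rewrite -[x - z](subrKA y); exact: eucl_normD. Qed.

Lemma eucl_norm_le_coord x (r : R) : 0 <= r ->
  (forall i, `|x ord0 i| <= r) -> N x <= n%:R * r.
Proof.
move=> r0 xr; rewrite -(@ler_pXn2r _ 2)// ?nnegrE ?mulr_ge0 ?eucl_norm_ge0//.
rewrite eucl_norm_sqr exprMn.
apply: (@le_trans _ _ (n%:R * r ^+ 2)).
  rewrite mulr_natl.
  rewrite -[X in _ *+ X]card_ord -sumr_const ler_sum// => i _.
  by rewrite -real_normK ?num_real// ler_pXn2r// nnegrE.
rewrite ler_wpM2r ?sqr_ge0// -natrX ler_nat.
by rewrite -mulnn; case: (n) => // k; rewrite leq_pmulr.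
Qed.

Lemma nbhs_rVP x (A : set 'rV[R]_n) : nbhs x A <->
  exists2 e : R, 0 < e & forall y, (forall i, `|x ord0 i - y ord0 i| < e) -> A y.
Proof.
split=> [/nbhs_ballP[e /= e0 xeA]|[e e0 H]].
  by exists e => // y xy; apply: xeA; split=> // i j; rewrite (ord1 i); exact: xy.
by apply/nbhs_ballP; exists e => //= y [_ xy]; apply: H => i; exact: xy.
Qed.

Lemma lipschitz_continuous (f : 'rV[R]_n -> R) (L : R) :
  (forall x y, `|f x - f y| <= L * N (x - y)) -> continuous f.
Proof.
move=> fL x.
apply/(@cvgrPdist_lt _ _ _ (nbhs x) (nbhs_filter x)) => e e0; apply/nbhs_rVP.
have D : 0 < `|L| * (n%:R) + 1 by rewrite ltr_wpDl// mulr_ge0.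
exists (e / (`|L| * (n%:R) + 1)); first by rewrite divr_gt0.
move=> y xy; set q := e / _ in xy *.
have q0 : 0 <= q by rewrite divr_ge0 ?ltW.
apply: (le_lt_trans (fL x y)).
have H : N (x - y) <= n%:R * q.
  by apply: eucl_norm_le_coord => // i; rewrite !mxE ltW.
apply: (@le_lt_trans _ _ (`|L| * (n%:R * q))).
  apply: (@le_trans _ _ (`|L| * N (x - y))).
    by rewrite ler_wpM2r ?eucl_norm_ge0 ?ler_norm.
  by rewrite ler_wpM2l.
rewrite mulrA /q mulrCA gtr_pMr// ltr_pdivrMr// mul1r.
by rewrite ltrDl.
Qed.

Lemma eucl_norm_continuous : continuous N.
Proof.
apply: (@lipschitz_continuous _ 1) => x y; rewrite mul1r ler_norml.
have := eucl_normD (x - y) y; have := eucl_normD (y - x) x.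
rewrite !subrK (eucl_normB y) => H1 H2; apply/andP; split; lra.
Qed.

End euclidean.

Section distance.
Context {R : realType} {n : nat}.
Implicit Types (x y z : 'rV[R]_n) (A B : set 'rV[R]_n).
Local Notation N := (@eucl_norm R n).
Local Notation dist x A := (set_dist [set x] A).

Let has_lb A B : has_lbound [set N (z.1 - z.2) | z in A `*` B].
Proof. by exists 0 => _ [z _ <-]; exact: eucl_norm_ge0. Qed.

Lemma set_dist_le A B x y : A x -> B y -> set_dist A B <= N (x - y).
Proof. by move=> Ax By; apply: ge_inf => //; exists (x, y). Qed.

Lemma set_dist_ge A B (r : R) : A !=set0 -> B !=set0 ->
  (forall x y, A x -> B y -> r <= N (x - y)) -> r <= set_dist A B.
Proof.
move=> [a Aa] [b Bb] H; apply: lb_le_inf.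
  by exists (N (a - b)); exists (a, b).
by move=> _ [[x y] [/= Ax By] <-]; exact: H.
Qed.

Lemma dist_le A x y : A y -> dist x A <= N (x - y).
Proof. by move=> Ay; exact: set_dist_le. Qed.

Lemma dist_ge A x (r : R) : A !=set0 ->
  (forall y, A y -> r <= N (x - y)) -> r <= dist x A.
Proof.
move=> A0 H; apply: set_dist_ge => //; first by exists x.
by move=> _ y -> /H.
Qed.

Lemma dist_ge0 A x : A !=set0 -> 0 <= dist x A.
Proof. by move=> A0; apply: dist_ge => // y _; exact: eucl_norm_ge0. Qed.

Lemma dist_lt A x (r : R) : A !=set0 -> dist x A < r ->
  exists2 y, A y & N (x - y) < r.
Proof.
move=> A0; apply: contraPP => /forall2NP H.
apply/negP; rewrite -leNgt; apply: dist_ge => // y Ay.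
by have [//|/negP] := H y; rewrite -leNgt.
Qed.

Lemma dist_eq0 A x : A x -> dist x A = 0.
Proof.
move=> Ax; apply/eqP; rewrite eq_le dist_ge0 ?andbT; last by exists x.
by rewrite (le_trans (dist_le x Ax))// subrr eucl_norm0.
Qed.

Lemma dist_lipschitz A x y : A !=set0 -> dist x A <= N (x - y) + dist y A.
Proof.
move=> A0; rewrite -lerBlDl; apply: dist_ge => // z Az.
by rewrite lerBlDl (le_trans (dist_le x Az))// eucl_distD.
Qed.

Lemma dist_lipschitz_norm A x y : A !=set0 ->
  `|dist x A - dist y A| <= N (x - y).
Proof.
move=> A0; rewrite ler_norml; have H1 := dist_lipschitz x y A0.
have := dist_lipschitz y x A0; rewrite (eucl_normB y) => H2.
by apply/andP; split; lra.
Qed.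

Lemma dist_continuous A : A !=set0 -> continuous (fun x => dist x A).
Proof.
move=> A0; apply: (@lipschitz_continuous _ _ _ 1) => x y.
by rewrite mul1r dist_lipschitz_norm.
Qed.

End distance.

(** * Segments, balls and compact supports in an open set *)

Section open_set.
Context {R : realType} {n : nat} (G : set 'rV[R]_n).
Hypothesis oG : open G.
Implicit Types (x y z : 'rV[R]_n).
Local Notation N := (@eucl_norm R n).
Local Notation d x := (set_dist [set x] (boundary G)).

Lemma closure_boundary x : closure G x -> ~ G x -> boundary G x.
Proof. by move=> cx nGx; split=> // /interior_subset. Qed.

(** A segment that starts in [G] and misses the boundary stays in [G], because
    its intersection with [G] is then relatively open and closed. *)
Lemma segment_subset x y : G x ->
  (forall t : R, 0 <= t <= 1 -> ~ boundary G (x + t *: (y - x))) -> G y.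
Proof.
move=> Gx H; pose f (t : R) := x + t *: (y - x).
have cf : continuous f.
  by move=> t; apply: cvgD; [exact: cvg_cst|apply: cvgZr_tmp; exact: cvg_id].
have K := @segment_connected R 0 1 (`[0, 1] `&` f @^-1` G).
suff : (`[0, 1] `&` f @^-1` G) 1 by move=> [_]; rewrite /f /= scale1r addrC subrK.
rewrite K.
- by rewrite /= in_itv /= ler01 lexx.
- exists 0; split; first by rewrite /= in_itv /= ler01 lexx.
  by rewrite /f /= scale0r addr0.
- by exists (f @^-1` G) => //; apply: open_comp.
- exists (f @^-1` (closure G)).
    by apply: closed_comp => [t _|]; [exact: cf|exact: closed_closure].
  apply/seteqP; split=> t [/= t01 Gt]; split=> //; first exact: subset_closure.
  apply: contrapT => nG; apply: (H t); first by rewrite in_itv in t01.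
  exact: closure_boundary.
Qed.

(** The boundary keeps its distance from the whole segment when [y] is close to
    either endpoint at the scale of the distance of that endpoint. *)
Lemma ball_subset x y : G x -> N (x - y) < Num.max (d x) (d y) -> G y.
Proof.
move=> Gx xy; apply: (segment_subset Gx) => t /andP[t0 t1] b.
have [] := ltP (d x) (d y) => dd; move: xy; rewrite /Num.max.
  rewrite dd => xy; have := dist_le y b; apply/negP; rewrite -ltNge.
  apply: le_lt_trans xy.
  rewrite (_ : y - _ = (1 - t) *: (y - x)); last first.
    by rewrite scalerBl scale1r opprD addrA.
  by rewrite eucl_normZ eucl_normB ger0_norm ?subr_ge0// ler_piMl ?eucl_norm_ge0// lerBlDr lerDl.
rewrite (ltNge (d x)) dd /= => xy; have := dist_le x b; apply/negP; rewrite -ltNge.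
apply: le_lt_trans xy.
rewrite opprD addrA subrr add0r eucl_normN eucl_normZ eucl_normB ger0_norm//.
by rewrite ler_piMl ?eucl_norm_ge0.
Qed.

Hypothesis bG : bounded_set G.

Lemma compact_closureG : compact (closure G).
Proof.
have [M [_ HM]] := bG.
pose B := [set v : 'rV[R]_n | forall i, `[- (M + 1), M + 1]%classic (v ord0 i)].
have cB : compact B by apply: (@rV_compact R n (fun=> `[- (M + 1), M + 1]%classic)) => i;
  exact: segment_compact.
apply: (subclosed_compact _ cB); first exact: closed_closure.
have /closure_id -> : closed B.
  by apply: compact_closed => //; exact: norm_hausdorff.
apply: closure_subset => x Gx i /=; rewrite in_itv/= -ler_norml.
apply: le_trans (HM (M + 1) _ x Gx); last by rewrite ltrDl.
rewrite [leRHS]mx_normrE.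
exact: (le_bigmax _ (fun ij : 'I_1 * 'I_n => `|x ij.1 ij.2|) (ord0, i)).
Qed.

Hypothesis b0 : boundary G !=set0.

(** For a bounded [G], staying at a positive distance from the boundary is all
    that compactness of the support requires. *)
Lemma Cc_of_dist_ge (u : 'rV[R]_n -> R) (c : R) : continuous u -> 0 < c ->
  (forall x, u x != 0 -> G x /\ c <= d x) -> Cc G u.
Proof.
move=> cu c0 H.
have cd : closed [set x | c <= d x].
  rewrite [X in closed X](_ : _ = (fun x => d x) @^-1` [set t | c <= t])//.
  by apply: closed_comp => [x _|]; [exact: dist_continuous|exact: closed_ge].
have sub : closure [set x | u x != 0] `<=` closure G `&` [set x | c <= d x].
  have /closure_id -> : closed (closure G `&` [set x | c <= d x]).
    by apply: closedI => //; exact: closed_closure.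
  apply: closure_subset => x /H[Gx dx]; split => //; exact: subset_closure.
split=> //.
  apply: subclosed_compact compact_closureG _; first exact: closed_closure.
  by move=> x /sub[].
move=> x /sub[clx /= dx]; apply: contrapT => nGx.
have /dist_eq0 b := closure_boundary clx nGx.
by move: dx; rewrite b leNgt c0.
Qed.

Hypothesis d_gt0 : forall x, G x -> 0 < d x.

Lemma Cc_dist_ge (u : 'rV[R]_n -> R) : Cc G u ->
  exists2 c : R, 0 < c & forall x, u x != 0 -> G x /\ c <= d x.
Proof.
move=> [cu comp sub].
have [[x0 x0u]|/set0P/negP/negPn/eqP u0] :=
    pselect (closure [set x | u x != 0] !=set0); last first.
  exists 1 => // x ux; suff : closure [set x | u x != 0] x by rewrite u0.
  exact: subset_closure.
have [x /set_mem ux xmin] : exists2 c, c \in closure [set x | u x != 0] &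
    forall t, t \in closure [set x | u x != 0] -> d c <= d t.
  apply: compact_EVT_min => //; first by exists x0.
  by apply: continuous_subspaceT => z; exact: dist_continuous.
exists (d x); first by apply/d_gt0/sub.
move=> z uz; have Cz : closure [set x | u x != 0] z by exact: subset_closure.
by split; [exact: sub|apply: xmin; exact: mem_set].
Qed.

End open_set.

(** * Geometry of Whitney cubes *)

Section whitney.
Context {R : realType} {n : nat}.
Implicit Types (x y z : 'rV[R]_n) (Q : dyadic n).
Local Notation N := (@eucl_norm R n).
Local Notation side := (@side R n).
Local Notation cube := (@cube R n).
Hypothesis n_gt0 : (0 < n)%N.

Lemma side_gt0 Q : 0 < side Q.
Proof. by rewrite /Defs.side exprz_gt0. Qed.

Lemma cube_coord Q x y i : cube Q x -> cube Q y ->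
  `|x ord0 i - y ord0 i| <= side Q.
Proof.
move=> /(_ i)/andP[x1 x2] /(_ i)/andP[y1 y2].
move: x2 y2; rewrite !intrD !mulrDr !mulr1 => x2 y2.
by rewrite ler_norml; apply/andP; split; lra.
Qed.

Lemma cube_eucl Q x y : cube Q x -> cube Q y -> N (x - y) <= n%:R * side Q.
Proof.
move=> Qx Qy; apply: eucl_norm_le_coord; first exact/ltW/side_gt0.
by move=> i; rewrite !mxE; exact: cube_coord.
Qed.

Definition corner Q (t : R) : 'rV[R]_n :=
  \row_i (side Q * (Q.2 ord0 i)%:~R + t * side Q).

Lemma cube_corner Q (t : R) : 0 <= t <= 1 -> cube Q (corner Q t).
Proof.
move=> /andP[t0 t1] i; rewrite mxE; have s0 := side_gt0 Q.
rewrite intrD mulrDr mulr1 lerDl lerD2l mulr_ge0 ?(ltW s0)//=.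
by rewrite ler_piMl ?(ltW s0).
Qed.

Lemma cube_neq0 Q : cube Q !=set0.
Proof. by exists (corner Q 0); apply: cube_corner; rewrite lexx ler01. Qed.

Let has_ub Q : has_ubound [set N (z.1 - z.2) | z in cube Q `*` cube Q].
Proof.
by exists (n%:R * side Q) => _ [[x y] [/= Qx Qy] <-]; exact: cube_eucl.
Qed.

Lemma eucl_le_diam Q x y : cube Q x -> cube Q y -> N (x - y) <= diam (cube Q).
Proof. by move=> Qx Qy; apply: ub_le_sup => //; exists (x, y). Qed.

Lemma diam_le Q : diam (cube Q) <= n%:R * side Q.
Proof.
have [x Qx] := cube_neq0 Q.
apply: ge_sup; first by exists (N (x - x)); exists (x, x).
by move=> _ [[y z] [/= Qy Qz] <-]; exact: cube_eucl.
Qed.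

Lemma side_le_diam Q : side Q <= diam (cube Q).
Proof.
have Q0 : cube Q (corner Q 0) by apply: cube_corner; rewrite lexx ler01.
have Q1 : cube Q (corner Q 1) by apply: cube_corner; rewrite lexx ler01.
apply: le_trans (eucl_le_diam Q1 Q0).
apply: le_trans (coord_le_eucl_norm _ (Ordinal n_gt0)).
by rewrite !mxE mul1r mul0r addr0 addrC addKr ger0_norm// ltW// side_gt0.
Qed.

Context (G : set 'rV[R]_n) (W : set (dyadic n)).
Hypothesis wG : whitney_decomposition G W.
Hypothesis G0 : G !=set0.
Local Notation d x := (set_dist [set x] (boundary G)).

Lemma whitney_cover x : G x -> exists2 Q, W Q & cube Q x.
Proof. by case: wG => <- _ _ [Q WQ Qx]; exists Q. Qed.

Lemma whitney_sub Q : W Q -> cube Q `<=` G.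
Proof. by case: wG => <- _ _ WQ x Qx; exists Q. Qed.

(** The distance to an empty boundary would be the infimum of the empty set,
    which is [0] and smaller than the diameter of a cube. *)
Lemma whitney_boundary : boundary G !=set0.
Proof.
have [x /whitney_cover[Q WQ Qx]] := G0; case: wG => _ _ /(_ Q WQ)/andP[+ _].
apply: contraPP => /set0P/negP/negPn/eqP ->; apply/negP; rewrite -ltNge.
rewrite /set_dist setX0 image_set0 inf0.
by rewrite (lt_le_trans (side_gt0 Q))// side_le_diam.
Qed.

(** The next two bounds replace the diameters of the decomposition by sides, and
    the distance of the cube by that of each of its points. *)
Lemma whitney_dist_ge Q x : W Q -> cube Q x -> side Q <= d x.
Proof.
move=> WQ Qx; case: wG => _ _ /(_ Q WQ)/andP[+ _].
move=> /(le_trans (side_le_diam Q))/le_trans; apply.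
apply: dist_ge; first exact: whitney_boundary.
by move=> y by_; exact: set_dist_le.
Qed.

Lemma whitney_dist_le Q x : W Q -> cube Q x -> d x <= 5 * n%:R * side Q.
Proof.
move=> WQ Qx; case: wG => _ _ /(_ Q WQ)/andP[_ H].
have D := diam_le Q; suff : d x - diam (cube Q) <= set_dist (cube Q) (boundary G).
  by move=> ?; rewrite -mulrA; lra.
apply: set_dist_ge; [exact: cube_neq0|exact: whitney_boundary|].
move=> z b Qz bb; rewrite lerBlDl (le_trans (dist_le x bb))//.
by rewrite (le_trans (eucl_distD z _ _))// lerD2r eucl_le_diam.
Qed.

Lemma whitney_dist_gt0 x : G x -> 0 < d x.
Proof.
move=> /whitney_cover[Q WQ Qx]; apply: lt_le_trans (whitney_dist_ge WQ Qx).
exact: side_gt0.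
Qed.

Lemma whitney_side_le P Q : W P -> W Q -> cube P `&` cube Q !=set0 ->
  side P <= 5 * n%:R * side Q.
Proof.
move=> WP WQ [x [Px Qx]].
exact: le_trans (whitney_dist_ge WP Px) (whitney_dist_le WQ Qx).
Qed.

End whitney.

(** * Comparing integrals through superlevel sets *)

Section layer_cake.
Context d (T : measurableType d) (R : realType).
Variable mu : {sigma_finite_measure set T -> \bar R}.
Local Open Scope ereal_scope.

Let level (f : T -> R) (z : T * measurableTypeR R) : \bar R :=
  (\1_[set z : T * measurableTypeR R | (0 <= z.2 < f z.1)%R] z)%:E.

Let measurable_level (f : T -> R) : measurable_fun setT f ->
  measurable_fun setT (level f).
Proof.
move=> mf; apply/measurable_EFinP/measurable_indic => /=.
pose g1 (z : T * measurableTypeR R) := (0 <= z.2)%R.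
pose g2 (z : T * measurableTypeR R) := (z.2 < f z.1)%R.
rewrite [X in measurable X](_ : _ =
    g1 @^-1` [set true] `&` g2 @^-1` [set true]); last first.
  by apply/seteqP; split => z /= /andP.
apply: measurableI.
- have : measurable_fun setT g1.
    by apply: measurable_fun_ler => //; exact: measurable_snd.
  by move=> /(_ measurableT [set true]); rewrite setTI; exact.
- have : measurable_fun setT g2.
    by apply: measurable_fun_ltr; [exact: measurable_snd|exact: measurableT_comp].
  by move=> /(_ measurableT [set true]); rewrite setTI; exact.
Qed.

Let level_section (f : T -> R) (t : R) : measurable_fun setT f ->
  \int[mu]_x level f (x, t) = mu [set x | (0 <= t < f x)%R].
Proof.
move=> mf; have mA : measurable [set x | (0 <= t < f x)%R].
  have [t0|t0] := leP 0%R t; last first.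
    by rewrite [X in measurable X](_ : _ = set0)//; apply/seteqP; split.
  have : measurable_fun setT (fun x => (t < f x)%R) by exact: measurable_fun_ltr.
  by move=> /(_ measurableT [set true]); rewrite setTI; exact.
by rewrite -[X in _ = mu X]setIT -integral_indic.
Qed.

Lemma layer_cake (f : T -> R) : measurable_fun setT f -> (forall x, 0 <= f x)%R ->
  \int[mu]_x (f x)%:E =
  \int[@lebesgue_measure R]_t mu [set x | (0 <= t < f x)%R].
Proof.
move=> mf f0.
under [RHS]eq_integral do rewrite -level_section//.
rewrite -(fubini_tonelli (level f)); last 2 first.
- exact: measurable_level.
- by move=> z; rewrite lee_fin.
apply: eq_integral => x _.
transitivity (\int[@lebesgue_measure R]_t (\1_`[0%R, f x[ t)%:E).
  transitivity (lebesgue_measure (`[0%R, f x[%classic : set R)); last first.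
    by rewrite integral_indic// setIT.
  rewrite lebesgue_measure_itv/= lte_fin.
  case: ltP => [_|fx]; first by rewrite sube0.
  by congr (_%:E); apply/eqP; rewrite eq_le f0 fx.
apply: eq_integral => t _; rewrite /level !indicE.
by congr ((nat_of_bool _)%:R%:E); apply/idP/idP; rewrite !inE /= in_itv.
Qed.

(** By the layer-cake formula, integrals compare as soon as the measures of
    the superlevel sets do. *)
Lemma le_integral_superlevel (f g : T -> R) (c : R) :
  measurable_fun setT f -> measurable_fun setT g ->
  (forall x, 0 <= f x)%R -> (forall x, 0 <= g x)%R -> (0 <= c)%R ->
  (forall t : R, (0 <= t)%R ->
     mu [set x | (t < f x)%R] <= c%:E * mu [set x | (t < g x)%R]) ->
  \int[mu]_x (f x)%:E <= c%:E * \int[mu]_x (g x)%:E.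
Proof.
move=> mf mg f0 g0 c0 H; rewrite !layer_cake//.
have msec (h : T -> R) : measurable_fun setT h ->
    measurable_fun setT (fun t : measurableTypeR R => mu [set x | (0 <= t < h x)%R]).
  move=> mh; rewrite [X in measurable_fun _ X](_ : _ = fubini_G mu (level h)).
    apply: measurable_fun_fubini_tonelli_G; first exact: measurable_level.
    by move=> z; rewrite lee_fin.
  by apply/funext => t; rewrite -level_section.
rewrite -ge0_integralZl_EFin//; last exact: msec.
apply: ge0_le_integral => //.
- exact: msec.
- by apply: measurable_funeM; exact: msec.
- move=> t _; have [t0|t0] /= := leP 0%R t; first exact: H.
  by rewrite [X in mu X](_ : _ = set0) ?measure0 ?mule_ge0//; apply/seteqP; split.
Qed.

End layer_cake.

(** * Dyadic grids and preimages under non-contracting maps *)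

Section grid.
Context {R : realType} {n : nat}.
Implicit Types (x y z : 'rV[R]_n) (U : set 'rV[R]_n).
Local Notation N := (@eucl_norm R n).
Local Notation lambda := (@lebesgue_rV R n).

Lemma measurable_rV_box (A : 'I_n -> set R) : (forall i, measurable (A i)) ->
  measurable [set x : 'rV[R]_n | forall i, A i (x ord0 i)].
Proof.
move=> mA; rewrite (_ : [set x | _] = \bigcap_(i in [set: 'I_n])
   ((fun x : 'rV[R]_n => x ord0 i) @^-1` A i)).
  apply: fin_bigcap_measurable => // i _.
  by rewrite -[X in measurable X]setTI; exact: measurable_rV_coord.
by apply/seteqP; split => x /= + i; [move=> + _|move=> /(_ i I)]; exact.
Qed.

Definition closed_box x (r : R) : set 'rV[R]_n :=
  [set y | forall i, `[x ord0 i - r, x ord0 i + r]%classic (y ord0 i)].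

Lemma closed_boxE x (r : R) y : closed_box x r y <-> forall i, `|x ord0 i - y ord0 i| <= r.
Proof.
by split=> H i; have := H i; rewrite /= in_itv/= ler_distlC.
Qed.

Lemma measurable_closed_box x (r : R) : measurable (closed_box x r).
Proof.
exact: (measurable_rV_box (fun i => measurable_itv `[x ord0 i - r, x ord0 i + r])).
Qed.

Lemma lebesgue_closed_box x (r : R) : 0 <= r ->
  lambda (closed_box x r) = ((2 * r) ^+ n)%:E.
Proof.
move=> r0.
rewrite (lebesgue_rV_box (A := fun i => `[x ord0 i - r, x ord0 i + r]%classic))//.
rewrite (eq_bigr (fun=> (2 * r)%:E)) => [|i _].
  by rewrite prodEFin prodr_const card_ord.
rewrite lebesgue_measure_itv/= lte_fin; case: ltP => [_|H].
  by rewrite -EFinB; congr (_%:E); ring.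
by congr (_%:E); lra.
Qed.

Definition grid_cell (k : nat) (m : 'rV[int]_n) : set 'rV[R]_n :=
  [set x | forall i, `[(m ord0 i)%:~R / 2 ^+ k, (m ord0 i + 1)%:~R / 2 ^+ k[%classic
                       (x ord0 i)].

Definition grid_index (k : nat) x : 'rV[int]_n :=
  \row_i Num.floor (x ord0 i * 2 ^+ k).

Lemma grid_cellP k m x : grid_cell k m x <-> grid_index k x = m.
Proof.
have P (i : 'I_n) : ((x ord0 i) \in `[(m ord0 i)%:~R / 2 ^+ k,
    (m ord0 i + 1)%:~R / 2 ^+ k[) = (grid_index k x ord0 i == m ord0 i).
  by rewrite mxE in_itv/= ler_pdivrMr ?exprn_gt0// ltr_pdivlMr ?exprn_gt0// floor_eq.
split=> [H|xm i]; last by rewrite /= P xm.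
by apply/rowP => i; apply/eqP; rewrite -P; exact: H.
Qed.

Lemma measurable_grid_cell k m : measurable (grid_cell k m).
Proof.
exact: (measurable_rV_box (fun i => measurable_itv `[(m ord0 i)%:~R / 2 ^+ k,
  (m ord0 i + 1)%:~R / 2 ^+ k[)).
Qed.

Lemma lebesgue_grid_cell k m : lambda (grid_cell k m) = ((2 ^- k) ^+ n)%:E.
Proof.
rewrite (lebesgue_rV_box (A := fun i => `[(m ord0 i)%:~R / 2 ^+ k,
  (m ord0 i + 1)%:~R / 2 ^+ k[%classic))//.
rewrite (eq_bigr (fun=> (2 ^- k)%:E)) => [|i _].
  by rewrite prodEFin prodr_const card_ord.
rewrite lebesgue_measure_itv/= lte_fin ltr_pM2r ?invr_gt0 ?exprn_gt0//.
by rewrite ltr_int ltrDl ltr01 -EFinB -mulrBl intrD addrAC subrr add0r mul1r.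
Qed.

Lemma grid_cell_dist k m x y i : grid_cell k m x -> grid_cell k m y ->
  `|x ord0 i - y ord0 i| <= 2 ^- k.
Proof.
move=> /(_ i) /= + /(_ i) /=; rewrite !in_itv/= intrD mulrDl mul1r.
move=> /andP[x1 x2] /andP[y1 y2].
by rewrite ler_norml; apply/andP; split; lra.
Qed.

(** Phrased through the cell of [x], so that monotonicity in [k] and exhaustion of
    an open [U] are statements about one point. *)
Definition grid_inner U (k : nat) : set 'rV[R]_n :=
  [set x | grid_cell k (grid_index k x) `<=` U].

(** Countably many pairwise disjoint cells, indexed through a numbering of the
    integer vectors: the form that countable additivity applies to. *)
Let piece U k (j : nat) : set 'rV[R]_n :=
  if pickle_inv j is Some m then
    if `[< grid_cell k m `<=` U >] then grid_cell k m else set0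
  else set0.

Let grid_innerE U k : grid_inner U k = \bigcup_j piece U k j.
Proof.
apply/seteqP; split=> x /=.
  move=> xU; exists (pickle (grid_index k x)) => //.
  rewrite /piece pickleK_inv; case: asboolP => // _; exact/grid_cellP.
move=> [j _]; rewrite /piece; case: pickle_inv => // m; case: asboolP => // mU.
by move=> /grid_cellP xm; rewrite /grid_inner /= xm.
Qed.

Let measurable_piece U k j : measurable (piece U k j).
Proof.
rewrite /piece; case: pickle_inv => [m|]; last exact: measurable0.
by case: asboolP => _; [exact: measurable_grid_cell|exact: measurable0].
Qed.

Let trivIset_piece U k : trivIset setT (piece U k).
Proof.
move=> i j _ _ [x []]; rewrite /piece.
case mi : (pickle_inv i) => [m|//]; case mj : (pickle_inv j) => [m'|//].
case: asboolP => // _ /grid_cellP xm; case: asboolP => // _ /grid_cellP xm'.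
have := @pickle_invK 'rV[int]_n i; have := @pickle_invK 'rV[int]_n j.
by rewrite /ocancel mi mj /= -xm -xm' => <- <-.
Qed.

Lemma measurable_grid_inner U k : measurable (grid_inner U k).
Proof. by rewrite grid_innerE; exact: bigcupT_measurable. Qed.

Lemma grid_inner_sub U k : grid_inner U k `<=` U.
Proof. by move=> x; apply; exact/grid_cellP. Qed.

Lemma grid_inner_homo U : {homo grid_inner U : i j / (i <= j)%N >-> (i <= j)%O}.
Proof.
move=> i j ij; apply/subsetPset => x xU y yx; apply: xU; apply/grid_cellP/rowP => l.
move/grid_cellP : yx => /rowP /(_ l); rewrite !mxE => yx.
pose q : int := 2 ^+ (j - i).
have q2 : q%:~R = 2 ^+ (j - i) :> R by rewrite rmorphXn.
have q0 : 0 < q%:~R :> R by rewrite q2 exprn_gt0.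
have E (z : R) : Num.floor (z * 2 ^+ i) =
    Num.floor ((Num.floor (z * 2 ^+ j))%:~R / q%:~R : R).
  apply/eqP; rewrite eq_sym floor_eq ler_pdivlMr// ltr_pdivrMr//.
  have zj : z * 2 ^+ j = z * 2 ^+ i * q%:~R.
    by rewrite q2 -mulrA -exprD subnKC.
  have /andP[z1 z2] := floor_itv (z * 2 ^+ i).
  rewrite -intrM ler_int floor_ge_int intrM zj ler_pM2r// z1/=.
  by apply: le_lt_trans (floor_le _) _; rewrite ltr_pM2r.
by rewrite E yx -E.
Qed.

Lemma grid_inner_bigcup U : open U -> \bigcup_k grid_inner U k = U.
Proof.
move=> oU; apply/seteqP; split=> [x [k _ /grid_inner_sub]//|x Ux].
have /nbhs_rVP[e e0 xU] : nbhs x U by exact: open_nbhs_nbhs.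
have [k ke] : exists k, 2 ^- k < e.
  have : (fun k => 2^-1 ^+ k : R) @ \oo --> 0.
    by apply: cvg_expr; rewrite ger0_norm ?invr_ge0// invf_lt1 ?ltr1n.
  move=> /cvgrPdist_lt /(_ e e0)[k _ /(_ k (leqnn k))] /=.
  by rewrite sub0r normrN ger0_norm ?exprn_ge0 ?invr_ge0// exprVn => ?; exists k.
exists k => // y yx; apply: xU => i; apply: le_lt_trans ke.
by apply: grid_cell_dist yx; exact/grid_cellP.
Qed.

Lemma open_measurable_rV U : open U -> measurable U.
Proof.
move=> oU; rewrite -(grid_inner_bigcup oU); apply: bigcupT_measurable => k.
exact: measurable_grid_inner.
Qed.

Lemma continuous_measurable_rV (f : 'rV[R]_n -> R) :
  continuous f -> measurable_fun setT f.
Proof.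
move=> cf; apply: (measurability _ (RGenOInfty.measurableE R)).
move=> _ [_ [r ->] <-]; rewrite setTI; apply: open_measurable_rV.
by apply: open_comp => [x _|]; [exact: cf|exact: rray_open].
Qed.

(** A map that does not contract distances by more than [L] pulls a grid cell
    back into a box of comparable volume; an open set is exhausted by disjoint
    cells. *)
Lemma lebesgue_preimage_open (T : 'rV[R]_n -> 'rV[R]_n) (L : R) U :
  measurable_fun setT T -> 0 <= L ->
  (forall x y, N (x - y) <= L * N (T x - T y)) -> open U ->
  (lambda (T @^-1` U) <= ((2 * n%:R * L) ^+ n)%:E * lambda U)%E.
Proof.
move=> mT L0 TL oU; set C := _ ^+ n.
have C0 : 0 <= C by rewrite exprn_ge0// !mulr_ge0.
have mpre A : measurable A -> measurable (T @^-1` A).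
  by move=> mA; rewrite -[X in measurable X]setTI; exact: mT.
have cell k m : (lambda (T @^-1` grid_cell k m) <= C%:E * lambda (grid_cell k m))%E.
  have [->|/set0P[x0 x0m]] := eqVneq (T @^-1` grid_cell k m) set0.
    by rewrite measure0 mule_ge0.
  pose r : R := n%:R * L * 2 ^- k.
  have r0 : 0 <= r by rewrite !mulr_ge0// invr_ge0 exprn_ge0.
  have sub : T @^-1` grid_cell k m `<=` closed_box x0 r.
    move=> y ym; apply/closed_boxE => i.
    have := coord_le_eucl_norm (x0 - y) i; rewrite !mxE => /le_trans; apply.
    apply: le_trans (TL _ _) _; rewrite /r [leRHS]mulrAC [leRHS]mulrC ler_wpM2l//.
    apply: eucl_norm_le_coord; first by rewrite invr_ge0 exprn_ge0.
    by move=> l; rewrite !mxE; exact: grid_cell_dist x0m ym.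
  apply: (@le_trans _ _ (lambda (closed_box x0 r))).
    apply: le_measure => //; rewrite ?inE; last exact: measurable_closed_box.
    by apply: mpre; exact: measurable_grid_cell.
  rewrite lebesgue_closed_box// lebesgue_grid_cell -EFinM lee_fin -exprMn.
  by rewrite /r !mulrA.
have step k : (lambda (T @^-1` grid_inner U k) <= C%:E * lambda (grid_inner U k))%E.
  rewrite grid_innerE preimage_bigcup !measure_bigcup//; last 2 first.
  - by move=> j _; exact: mpre.
  - move=> i j _ _ [y [yi yj]].
    exact: (@trivIset_piece U k i j I I (ex_intro _ (T y) (conj yi yj))).
  rewrite -nneseriesZl//; apply: lee_nneseries => // j _.
  rewrite /piece; case: pickle_inv => [m|]; last by rewrite preimage_set0 !measure0 mule0.
  case: asboolP => _; first exact: cell.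
  by rewrite preimage_set0 !measure0 mule0.
have cvg : lambda (T @^-1` grid_inner U k) @[k --> \oo] --> lambda (T @^-1` U).
  rewrite (_ : T @^-1` U = \bigcup_k (T @^-1` grid_inner U k)); last first.
    by rewrite -preimage_bigcup grid_inner_bigcup.
  apply: nondecreasing_cvg_mu.
  - by move=> k; apply: mpre; exact: measurable_grid_inner.
  - by apply: bigcupT_measurable => k; apply: mpre; exact: measurable_grid_inner.
  - move=> i j ij; apply/subsetPset => x.
    by have /subsetPset := grid_inner_homo U ij; exact.
rewrite -(cvg_lim _ cvg)//; apply: lime_le; first by apply/cvg_ex; eexists; exact: cvg.
near=> k; apply: le_trans (step k) _; rewrite lee_wpmul2l//.
apply: le_measure; rewrite ?inE.
- exact: measurable_grid_inner.
- exact: open_measurable_rV.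
- exact: grid_inner_sub.
Unshelve. all: by end_near. Qed.

End grid.

(** * Iterated integrals and Jensen's inequality *)

Section integral_tools.
Local Open Scope ereal_scope.

Section iterated.
Context d1 d2 (T1 : measurableType d1) (T2 : measurableType d2) (R : realType).
Variable m1 : {sigma_finite_measure set T1 -> \bar R}.
Variable m2 : {sigma_finite_measure set T2 -> \bar R}.
Variables (A : set T1) (B : set T2) (f : T1 * T2 -> \bar R).
Hypotheses (mA : measurable A) (mB : measurable B).
Hypotheses (mf : measurable_fun setT f) (f0 : forall z, 0 <= f z).

Let g : T1 * T2 -> \bar R := f \_ (A `*` B).

Let mg : measurable_fun setT g.
Proof.
have mAB : measurable (A `*` B) by exact: measurableX.
by apply/(measurable_restrictT _ mAB); exact: measurable_funTS.
Qed.

Let g0 z : 0 <= g z.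
Proof. by apply: erestrict_ge0 => *; exact: f0. Qed.

Let gE1 x : \int[m2]_y g (x, y) = ((fun x => \int[m2]_(y in B) f (x, y)) \_ A) x.
Proof.
rewrite patchE; case: ifPn => xA; last first.
  apply: integral0_eq => y _; rewrite /g patchE ifF//.
  by apply/negP; rewrite inE => -[/= /mem_set]; rewrite (negPf xA).
rewrite [RHS]integral_mkcond; apply: eq_integral => y _; rewrite /g !patchE.
by congr (if _ then _ else _); apply/idP/idP; rewrite !inE /=;
  [case|move=> ?; split=> //; rewrite inE in xA].
Qed.

Let gE2 y : \int[m1]_x g (x, y) = ((fun y => \int[m1]_(x in A) f (x, y)) \_ B) y.
Proof.
rewrite patchE; case: ifPn => yB; last first.
  apply: integral0_eq => x _; rewrite /g patchE ifF//.
  by apply/negP; rewrite inE => -[/= _ /mem_set]; rewrite (negPf yB).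
rewrite [RHS]integral_mkcond; apply: eq_integral => x _; rewrite /g !patchE.
by congr (if _ then _ else _); apply/idP/idP; rewrite !inE /=;
  [case|move=> ?; split=> //; rewrite inE in yB].
Qed.

Lemma integral_swap :
  \int[m1]_(x in A) \int[m2]_(y in B) f (x, y) =
  \int[m2]_(y in B) \int[m1]_(x in A) f (x, y).
Proof.
rewrite [LHS]integral_mkcond [RHS]integral_mkcond.
under [LHS]eq_integral do rewrite -gE1.
under [RHS]eq_integral do rewrite -gE2.
exact: fubini_tonelli.
Qed.

End iterated.

Lemma measurable_integral_section d1 d2 (T1 : measurableType d1)
    (T2 : measurableType d2) (R : realType)
    (m2 : {sigma_finite_measure set T2 -> \bar R}) (B : set T2)
    (f : T1 * T2 -> \bar R) :
  measurable B -> measurable_fun setT f -> (forall z, 0 <= f z) ->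
  measurable_fun setT (fun x => \int[m2]_(y in B) f (x, y)).
Proof.
move=> mB mf f0; pose g : T1 * T2 -> \bar R := f \_ (setT `*` B).
have mg : measurable_fun setT g.
  have mTB : measurable ([set: T1] `*` B) by exact: measurableX.
  by apply/(measurable_restrictT _ mTB); exact: measurable_funTS.
rewrite [X in measurable_fun _ X](_ : _ = fubini_F m2 g).
  apply: measurable_fun_fubini_tonelli_F => // z.
  by apply: erestrict_ge0 => *; exact: f0.
apply/funext => x; rewrite /fubini_F [LHS]integral_mkcond; apply: eq_integral => y _.
rewrite /g !patchE; congr (if _ then _ else _).
by apply/idP/idP; rewrite !inE /=; [split|case].
Qed.

Lemma measurable_fix_fst d1 d2 (T1 : measurableType d1) (T2 : measurableType d2)
    (R : realType) (f : T1 * T2 -> \bar R) x :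
  measurable_fun setT f -> measurable_fun setT (fun y => f (x, y)).
Proof. by move=> mf; apply: measurableT_comp mf _; exact: pair1_measurable. Qed.

Section iterated_le.
Context d1 d2 (T1 : measurableType d1) (T2 : measurableType d2) (R : realType).
Variable m1 : {sigma_finite_measure set T1 -> \bar R}.
Variable m2 : {sigma_finite_measure set T2 -> \bar R}.
Variables (A : set T1) (B : set T2).
Hypotheses (mA : measurable A) (mB : measurable B).
Variable f : T1 * T2 -> \bar R.
Hypotheses (mf : measurable_fun setT f) (f0 : forall z, 0 <= f z).

Let mfA : measurable_fun A (fun x => \int[m2]_(y in B) f (x, y)).
Proof. by apply: measurable_funTS; exact: measurable_integral_section. Qed.

Let f0A x : A x -> 0 <= \int[m2]_(y in B) f (x, y).
Proof. by move=> _; exact: integral_ge0. Qed.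

Lemma le_integral2 (g : T1 * T2 -> \bar R) : measurable_fun setT g ->
  (forall z, 0 <= g z) ->
  (forall x y, A x -> B y -> f (x, y) <= g (x, y)) ->
  \int[m1]_(x in A) \int[m2]_(y in B) f (x, y) <=
  \int[m1]_(x in A) \int[m2]_(y in B) g (x, y).
Proof.
move=> mg g0 fg; apply: ge0_le_integral => //.
  by apply: measurable_funTS; exact: measurable_integral_section.
move=> x Ax; apply: ge0_le_integral => //.
- by apply: measurable_funTS; exact: measurable_fix_fst.
- by apply: measurable_funTS; exact: measurable_fix_fst.
- by move=> y By; exact: fg.
Qed.

Lemma integral2Zl (c : R) : (0 <= c)%R ->
  \int[m1]_(x in A) \int[m2]_(y in B) (c%:E * f (x, y)) =
  c%:E * \int[m1]_(x in A) \int[m2]_(y in B) f (x, y).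
Proof.
move=> c0; rewrite -ge0_integralZl_EFin//; apply: eq_integral => x _.
rewrite ge0_integralZl_EFin//.
by apply: measurable_funTS; exact: measurable_fix_fst.
Qed.

Lemma le_integral_section (h : T1 -> \bar R) (c : R) : (0 <= c)%R ->
  measurable_fun setT h -> (forall x, 0 <= h x) ->
  (forall x, A x -> h x <= c%:E * \int[m2]_(y in B) f (x, y)) ->
  \int[m1]_(x in A) h x <=
  c%:E * \int[m1]_(x in A) \int[m2]_(y in B) f (x, y).
Proof.
move=> c0 mh h0 hf; rewrite -ge0_integralZl_EFin//.
apply: ge0_le_integral => //; first exact: measurable_funTS.
exact: measurable_funeM.
Qed.

Lemma integral2_sum (I : Type) (r : seq I) (h : I -> T1 * T2 -> \bar R) :
  (forall i, measurable_fun setT (h i)) -> (forall i z, 0 <= h i z) ->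
  \sum_(i <- r) \int[m1]_(x in A) \int[m2]_(y in B) h i (x, y) =
  \int[m1]_(x in A) \int[m2]_(y in B) \sum_(i <- r) h i (x, y).
Proof.
move=> mh h0; rewrite -ge0_integral_sum//; last first.
- by move=> i x _; apply: integral_ge0 => y _; exact: h0.
- by move=> i; apply: measurable_funTS; exact: measurable_integral_section.
apply: eq_integral => x _; rewrite ge0_integral_sum// => i.
by apply: measurable_funTS; exact: measurable_fix_fst.
Qed.

End iterated_le.

Section jensen.
Context d (T : measurableType d) (R : realType) (mu : measure T R) (Z : set T).
Hypotheses (mZ : measurable Z) (Z1 : mu Z = 1).
Variable p : R.
Hypothesis p1 : (1 < p)%R.

(** Jensen's inequality for [t ^ p]: Young's inequality is the tangent line of
    the convex function at the mean. *)
Lemma jensen_powR (v : T -> R) : measurable_fun setT v -> (forall z, 0 <= v z)%R ->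
  mu.-integrable Z (EFin \o v) ->
  ((\int[mu]_(z in Z) v z)%R `^ p)%:E <= \int[mu]_(z in Z) (v z `^ p)%:E.
Proof.
move=> mv v0 iv; set m := (\int[mu]_(z in Z) v z)%R.
have m0 : (0 <= m)%R by apply: Rintegral_ge0.
have p0 : (0 < p)%R by exact: lt_trans p1.
have vE : \int[mu]_(z in Z) (v z)%:E = m%:E.
  by rewrite /m /Rintegral fineK//; exact: integrable_fin_num.
have mvp : measurable_fun Z (fun z => (v z `^ p)%:E).
  apply/measurable_EFinP/measurable_funTS.
  exact: measurableT_comp (measurable_powR p) mv.
have vp0 z : Z z -> 0 <= (v z `^ p)%:E by rewrite lee_fin powR_ge0.
have young z : (p * m `^ (p - 1) * v z <= v z `^ p + (p - 1) * m `^ p)%R.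
  have q0 : (0 < p / (p - 1))%R by rewrite divr_gt0 ?subr_gt0.
  have pq : (p^-1 + (p / (p - 1))^-1 = 1)%R.
    by rewrite invf_div; field; rewrite gt_eqF.
  have H := conjugate_powR (v0 z) (powR_ge0 m (p - 1)) p0 q0 pq.
  have pE : ((p - 1) * (p / (p - 1)) = p)%R.
    by rewrite mulrCA divff ?mulr1// gt_eqF// subr_gt0.
  rewrite -powRrM pE in H.
  have {H} := ler_wpM2l (ltW p0) H.
  rewrite [X in (_ <= X)%R -> _](_ : _ = v z `^ p + (p - 1) * m `^ p)%R.
    by rewrite (mulrC (v z)) mulrA.
  by field; rewrite !gt_eqF// subr_gt0.
have := @ge0_le_integral _ _ _ mu Z mZ
  (fun z => (p * m `^ (p - 1) * v z)%:E) (fun z => (v z `^ p + (p - 1) * m `^ p)%:E).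
have c0 : (0 <= p * m `^ (p - 1))%R by rewrite mulr_ge0 ?powR_ge0 ?ltW.
have c1 : (0 <= (p - 1) * m `^ p)%R by rewrite mulr_ge0 ?powR_ge0 ?subr_ge0 ?ltW.
have mvZ : measurable_fun Z (fun z => (v z)%:E).
  by apply/measurable_EFinP/measurable_funTS.
move=> H; have {H} : \int[mu]_(z in Z) (p * m `^ (p - 1) * v z)%:E <=
    \int[mu]_(z in Z) (v z `^ p + (p - 1) * m `^ p)%:E.
  apply: H.
  - by move=> z _; rewrite lee_fin mulr_ge0.
  - by under eq_fun do rewrite EFinM; exact: measurable_funeM.
  - under eq_fun do rewrite EFinD; apply: emeasurable_funD => //.
  - by move=> z _; rewrite lee_fin.
under eq_integral do rewrite EFinM.
rewrite ge0_integralZl_EFin//; last by move=> z _; rewrite lee_fin.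
under [X in _ <= X -> _]eq_integral do rewrite EFinD.
rewrite ge0_integralD//.
rewrite integral_cst// Z1 mule1 vE -EFinM -mulrA [(m `^ _ * m)%R]mulrC mulr_powRB1//.
have : 0 <= \int[mu]_(z in Z) (v z `^ p)%:E by exact: integral_ge0.
case: (\int[mu]_(z in Z) (v z `^ p)%:E) => [r| |]; rewrite ?leey//.
by move=> _; rewrite -EFinD !lee_fin; lra.
Qed.

Lemma bounded_integrable (v : T -> R) (M : R) : measurable_fun setT v ->
  (forall z, `|v z| <= M)%R -> mu.-integrable Z (EFin \o v).
Proof.
move=> mv vM; apply: measurable_bounded_integrable => //.
- by rewrite Z1 ltry.
- exact: measurable_funTS.
- exists M; split; first exact: num_real.
  by move=> x Mx z _ /=; rewrite (le_trans (vM z))// ltW.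
Qed.

Lemma jensen_dist (u v : T -> R) (M : R) :
  measurable_fun setT u -> measurable_fun setT v ->
  (forall z, `|u z| <= M)%R -> (forall z, `|v z| <= M)%R ->
  ((`|\int[mu]_(z in Z) u z - \int[mu]_(z in Z) v z|%R) `^ p)%:E <=
  \int[mu]_(z in Z) (`|u z - v z| `^ p)%:E.
Proof.
move=> mu_ mv uM vM.
have iu := bounded_integrable mu_ uM; have iv := bounded_integrable mv vM.
have muv : measurable_fun setT (fun z => u z - v z)%R by exact: measurable_funB.
have uvM z : (`|u z - v z| <= M + M)%R.
  by rewrite (le_trans (ler_normB _ _))// lerD.
have mn : measurable_fun setT (fun z => `|u z - v z|)%R.
  by apply: measurableT_comp muv; exact: normr_measurable.
rewrite -RintegralB//.
apply: le_trans (jensen_powR mn _ _) => //.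
  rewrite lee_fin ge0_ler_powR ?nnegrE//; first by rewrite ltW ?(lt_trans ltr01).
    by apply: Rintegral_ge0.
  by apply: le_normr_Rintegral => //; exact: bounded_integrable muv uvM.
by apply: (bounded_integrable (M := (M + M)%R) mn) => z; rewrite normr_id.
Qed.

End jensen.

End integral_tools.

(** * Bi-Lipschitz changes of variables in the energy *)

Section change_of_variables.
Context {R : realType} {n : nat}.
Implicit Types (u : 'rV[R]_n -> R).
Local Notation N := (@eucl_norm R n).
Local Notation lambda := (@lebesgue_rV R n).

Lemma measurable_lsc (h : 'rV[R]_n -> R) : (forall x, 0 <= h x) ->
  (forall t : R, 0 <= t -> open [set x | t < h x]) -> measurable_fun setT h.
Proof.
move=> h0 hopen; apply: (measurability _ (RGenOInfty.measurableE R)).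
move=> _ [_ [r ->] <-]; rewrite setTI.
rewrite (_ : h @^-1` _ = [set x | r < h x]); last first.
  by apply/seteqP; split=> x; rewrite /= in_itv/= andbT.
have [r0|r0] := leP 0 r; first by apply: open_measurable_rV; exact: hopen.
rewrite (_ : [set x | _] = setT); first exact: measurableT.
by apply/seteqP; split=> // x _ /=; exact: lt_le_trans (h0 x).
Qed.

(** The volume bound for preimages of open sets controls every superlevel set of
    a lower semicontinuous [h], hence its integral. *)
Lemma integral_comp_le (T : 'rV[R]_n -> 'rV[R]_n) (L : R) (h : 'rV[R]_n -> R) :
  measurable_fun setT T -> 0 <= L ->
  (forall x y, N (x - y) <= L * N (T x - T y)) ->
  (forall x, 0 <= h x) -> (forall t : R, 0 <= t -> open [set x | t < h x]) ->
  (\int[lambda]_x (h (T x))%:E <=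
   ((2 * n%:R * L) ^+ n)%:E * \int[lambda]_x (h x)%:E)%E.
Proof.
move=> mT L0 TL h0 hopen; have mh := measurable_lsc h0 hopen.
apply: le_integral_superlevel => //.
- exact: measurableT_comp mh mT.
- by rewrite exprn_ge0// !mulr_ge0.
- by move=> t t0; exact: (lebesgue_preimage_open mT L0 TL (hopen t t0)).
Qed.

Lemma measurable_powR_dist (u : 'rV[R]_n -> R) (A : set 'rV[R]_n) (p q : R) :
  measurable_fun setT u -> A !=set0 ->
  measurable_fun setT (fun x => (u x `^ p / set_dist [set x] A `^ q)%:E).
Proof.
move=> mu A0; apply/measurable_EFinP; apply: measurable_funM.
  exact: measurableT_comp (measurable_powR p) mu.
under eq_fun do rewrite -powRN; apply: measurableT_comp (measurable_powR _) _.
by apply: continuous_measurable_rV => x; exact: dist_continuous.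
Qed.

Lemma powR_continuous_pos (a x : R) : 0 < x -> {for x, continuous (fun y => y `^ a)}.
Proof.
move=> x0; apply/differentiable_continuous/derivable1_diffP.
by apply: derivable_powR; rewrite in_itv/= x0.
Qed.

Variables (s p : R) (G : set 'rV[R]_n).
Hypotheses (oG : open G) (p_gt0 : 0 < p) (s_gt0 : 0 < s).
Local Notation a := (n%:R + s * p).

Let a_gt0 : 0 < a.
Proof. by rewrite ltr_wpDl// mulr_gt0. Qed.

Lemma cvg_powR_div (X : Type) (F : set_system X) (f g : X -> R) (A B : R) :
  Filter F -> 0 < A -> 0 < B -> f x @[x --> F] --> A -> g x @[x --> F] --> B ->
  f x `^ p / g x `^ a @[x --> F] --> A `^ p / B `^ a.
Proof.
move=> FF A0 B0 fA gB; apply: cvgM; last apply: cvgV.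
- exact: cvg_comp fA (powR_continuous_pos (a := p) A0).
- by rewrite gt_eqF// powR_gt0.
- exact: cvg_comp gB (powR_continuous_pos (a := a) B0).
Qed.

Definition frac_quotient u (x y : 'rV[R]_n) : R :=
  `|u x - u y| `^ p / N (x - y) `^ a.

Lemma frac_quotient_ge0 u x y : 0 <= frac_quotient u x y.
Proof. by rewrite divr_ge0 ?powR_ge0. Qed.

Lemma frac_quotientC u x y : frac_quotient u x y = frac_quotient u y x.
Proof. by rewrite /frac_quotient distrC eucl_normB. Qed.

Lemma measurable_eucl_norm : measurable_fun setT N.
Proof. by apply: continuous_measurable_rV; exact: eucl_norm_continuous. Qed.

Lemma measurable_rV_sub d (X : measurableType d) (f g : X -> 'rV[R]_n) :
  measurable_fun setT f -> measurable_fun setT g ->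
  measurable_fun setT (fun x => f x - g x).
Proof.
move=> mf mg; apply: measurable_fun_rV => i.
rewrite [X in measurable_fun _ X](_ : _ =
    (fun x => f x ord0 i - g x ord0 i)); last first.
  by apply/funext => x; rewrite !mxE.
apply: measurable_funB.
- exact: measurableT_comp (measurable_rV_coord i) mf.
- exact: measurableT_comp (measurable_rV_coord i) mg.
Qed.

Lemma measurable_powR_div d (X : measurableType d) (f g : X -> R) :
  measurable_fun setT f -> measurable_fun setT g ->
  measurable_fun setT (fun x => f x `^ p / g x `^ a).
Proof.
move=> mf mg; apply: measurable_funM; first exact: measurableT_comp (measurable_powR p) mf.
under eq_fun do rewrite -powRN.
exact: measurableT_comp (measurable_powR _) mg.
Qed.

Lemma measurable_frac_quotient d (X : measurableType d) u (f g : X -> 'rV[R]_n) :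
  measurable_fun setT u -> measurable_fun setT f -> measurable_fun setT g ->
  measurable_fun setT (fun x => frac_quotient u (f x) (g x)).
Proof.
move=> mu mf mg; apply: measurable_powR_div.
  by apply: measurableT_comp => //; apply: measurable_funB; exact: measurableT_comp.
apply: measurableT_comp measurable_eucl_norm _; exact: measurable_rV_sub.
Qed.

Lemma frac_quotient_lsc u (x : 'rV[R]_n) (t : R) : continuous u -> 0 <= t ->
  open [set y | t < \1_G y * frac_quotient u x y].
Proof.
move=> cu t0; rewrite openE => y /= ty.
have Gy : G y.
  move: ty; rewrite indicE; case: (boolP (y \in G)) => [/set_mem//|_].
  by rewrite mul0r ltNge t0.
have A0 : 0 < `|u x - u y|.
  rewrite lt_neqAle normr_ge0 andbT; apply: contraTneq ty => A0.
  by rewrite /frac_quotient -A0 powR0 ?mul0r ?mulr0 ?gt_eqF// -leNgt.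
have N0 : 0 < N (x - y).
  rewrite eucl_norm_gt0; apply: contraTneq A0 => /subr0_eq ->.
  by rewrite subrr normr0 ltxx.
rewrite indicE mem_set// mul1r in ty.
have cq : frac_quotient u x z @[z --> y] --> frac_quotient u x y.
  apply: (cvg_powR_div (nbhs_filter y)) => //.
    apply: (cvg_norm (F := nbhs y)); apply: (cvgB (F := nbhs y)).
      exact: cvg_cst.
    exact: cu.
  apply: (@cvg_comp _ _ _ (fun z => x - z) N (nbhs y) (nbhs (x - y))); last first.
    exact: eucl_norm_continuous.
  by apply: (cvgB (F := nbhs y)); [exact: cvg_cst|exact: cvg_id].
have nG : \forall z \near y, G z by exact: open_nbhs_nbhs.
have nq : \forall z \near y, t < frac_quotient u x z.
  by apply: (cvgr_gt _ cq).
rewrite /interior; apply: filterS2 nG nq => z Gz /=.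
by rewrite indicE mem_set// mul1r.
Qed.

Lemma integral_indicE d (X : measurableType d) (mu : measure X R) (D : set X)
    (f : X -> R) :
  (\int[mu]_(x in D) (f x)%:E = \int[mu]_x (\1_D x * f x)%:E)%E.
Proof.
rewrite integral_mkcond; apply: eq_integral => x _; rewrite patchE indicE.
by case: ifP => _; rewrite ?mul1r ?mul0r.
Qed.

(** One-variable change of variables for the difference quotient, which is lower
    semicontinuous: it is continuous away from the diagonal and vanishes on it. *)
Lemma integral_frac_quotient_comp (T : 'rV[R]_n -> 'rV[R]_n) (L : R)
    (D : set 'rV[R]_n) u (x : 'rV[R]_n) :
  measurable_fun setT T -> 0 <= L ->
  (forall y z, N (y - z) <= L * N (T y - T z)) -> continuous u ->
  measurable D -> (forall y, D y -> G (T y)) ->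
  (\int[lambda]_(y in D) (frac_quotient u x (T y))%:E <=
   ((2 * n%:R * L) ^+ n)%:E * \int[lambda]_(y in G) (frac_quotient u x y)%:E)%E.
Proof.
move=> mT L0 TL cu mD DG; rewrite [X in (_ <= _ * X)%E]integral_indicE.
have h0 (y : 'rV[R]_n) : 0 <= \1_G y * frac_quotient u x y.
  by rewrite mulr_ge0 ?frac_quotient_ge0.
have hopen (t : R) : 0 <= t -> open [set y | t < \1_G y * frac_quotient u x y].
  exact: frac_quotient_lsc.
apply: le_trans (integral_comp_le mT L0 TL h0 hopen).
rewrite integral_indicE; apply: ge0_le_integral => //.
- by move=> y _; rewrite lee_fin mulr_ge0 ?frac_quotient_ge0.
- apply/measurable_EFinP/measurable_funM; first exact: measurable_indic.
  apply: measurable_frac_quotient => //; exact: continuous_measurable_rV.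
- apply/measurable_EFinP.
  exact: (measurableT_comp (f := fun y => \1_G y * frac_quotient u x y)
    (measurable_lsc h0 hopen) mT).
- move=> y _; rewrite lee_fin !indicE.
  have [/= /set_mem/DG GTy|_] := boolP (y \in D); first by rewrite mem_set.
  by rewrite mul0r mulr_ge0 ?frac_quotient_ge0.
Qed.

Let mG : measurable G.
Proof. exact: open_measurable_rV. Qed.

Lemma measurable_frac_quotient2 u : measurable_fun setT u -> measurable_fun setT
  (fun z : 'rV[R]_n * 'rV[R]_n => (frac_quotient u z.1 z.2)%:E).
Proof.
by move=> mu; apply/measurable_EFinP; apply: measurable_frac_quotient.
Qed.

Lemma gagliardo_energy_ge0 u : (0 <= gagliardo_energy s p G u)%E.
Proof.
apply: integral_ge0 => x _; apply: integral_ge0 => y _.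
by rewrite lee_fin frac_quotient_ge0.
Qed.

(** The kernel costs the Lipschitz constant [M] of [T]; each of the two integrals is
    then a one-variable change of variables, after exchanging the order of
    integration for the outer one. *)
Lemma energy_comp_le (T : 'rV[R]_n -> 'rV[R]_n) (L M : R) u :
  measurable_fun setT T -> 0 <= L -> 0 <= M ->
  (forall x y, N (x - y) <= L * N (T x - T y)) ->
  (forall x y, N (T x - T y) <= M * N (x - y)) ->
  continuous u -> (forall x, G x -> G (T x)) ->
  (\int[lambda]_(x in G) \int[lambda]_(y in G)
      (`|u (T x) - u (T y)| `^ p / N (x - y) `^ a)%:E <=
   (M `^ a * ((2 * n%:R * L) ^+ n) ^+ 2)%:E * gagliardo_energy s p G u)%E.
Proof.
move=> mT L0 M0 TL TM cu TG; set C := (_ * _) ^+ n.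
have C0 : 0 <= C by rewrite exprn_ge0// !mulr_ge0.
have mu : measurable_fun setT u by exact: continuous_measurable_rV.
pose X := ('rV[R]_n * 'rV[R]_n)%type.
have mT1 : measurable_fun setT (fun z : X => T z.1).
  exact: measurableT_comp mT measurable_fst.
have mq1 : measurable_fun setT (fun z : X => (frac_quotient u (T z.1) (T z.2))%:E).
  apply/measurable_EFinP; apply: measurable_frac_quotient => //.
  exact: measurableT_comp mT measurable_snd.
have mq2 : measurable_fun setT (fun z : X => (frac_quotient u (T z.1) z.2)%:E).
  by apply/measurable_EFinP; apply: measurable_frac_quotient.
have mq3 := measurable_frac_quotient2 mu.
have mq0 : measurable_fun setT
    (fun z : X => (`|u (T z.1) - u (T z.2)| `^ p / N (z.1 - z.2) `^ a)%:E).
  by apply: (measurable_frac_quotient2 (u := u \o T)); exact: measurableT_comp mT.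
have q0 := frac_quotient_ge0.
have sym (y : 'rV[R]_n) : (fun x => (frac_quotient u (T x) y)%:E) =
    (fun x => (frac_quotient u y (T x))%:E).
  by apply/funext => x; rewrite frac_quotientC.
have step (x y : 'rV[R]_n) : `|u (T x) - u (T y)| `^ p / N (x - y) `^ a <=
    M `^ a * frac_quotient u (T x) (T y).
  have [->|xy] := eqVneq x y.
    by rewrite !subrr normr0 powR0 ?gt_eqF// mul0r mulr_ge0 ?powR_ge0.
  have xy0 : 0 < N (x - y) by rewrite eucl_norm_gt0 subr_eq0.
  have Txy0 : 0 < N (T x - T y).
    rewrite lt_neqAle eucl_norm_ge0 andbT; apply/eqP => E.
    by have := TL x y; rewrite -E mulr0 leNgt xy0.
  rewrite /frac_quotient mulrCA ler_wpM2l ?powR_ge0//.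
  rewrite ler_pdivlMr ?powR_gt0// mulrC ler_pdivrMr ?powR_gt0//.
  rewrite -powRM ?eucl_norm_ge0//; apply: ge0_ler_powR => //; first exact: ltW.
    by rewrite nnegrE eucl_norm_ge0.
  by rewrite nnegrE mulr_ge0 ?eucl_norm_ge0.
apply: (@le_trans _ _ ((M `^ a)%:E * \int[lambda]_(x in G) \int[lambda]_(y in G)
    (frac_quotient u (T x) (T y))%:E)%E).
  rewrite -(integral2Zl lambda lambda mG mG mq1) ?powR_ge0//; last first.
    by move=> z; rewrite lee_fin.
  apply: (le_integral2 lambda lambda mG mG mq0 _ (g := fun z =>
    ((M `^ a)%:E * (frac_quotient u (T z.1) (T z.2))%:E)%E)).
  - by move=> z; rewrite lee_fin divr_ge0 ?powR_ge0.
  - exact: (measurable_funeM _ mq1).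
  - by move=> z; rewrite mule_ge0 ?lee_fin ?powR_ge0.
  - by move=> x y _ _; rewrite -EFinM lee_fin.
rewrite EFinM -muleA lee_wpmul2l ?lee_fin ?powR_ge0// expr2 EFinM -muleA.
apply: (@le_trans _ _ (C%:E * \int[lambda]_(x in G) \int[lambda]_(y in G)
    (frac_quotient u (T x) y)%:E)%E).
  have f2 (z : X) : (0 <= (frac_quotient u (T z.1) z.2)%:E)%E by rewrite lee_fin.
  apply: (le_integral_section lambda mG mG mq2 f2 C0 (h := fun x =>
    \int[lambda]_(y in G) (frac_quotient u (T x) (T y))%:E)%E).
  - by apply: (measurable_integral_section lambda mG mq1) => z; rewrite lee_fin.
  - by move=> x; apply: integral_ge0 => y _; rewrite lee_fin.
  - by move=> x _; exact: integral_frac_quotient_comp.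
rewrite lee_wpmul2l// (integral_swap lambda lambda mG mG mq2); last first.
  by move=> z; rewrite lee_fin.
have f3 (z : X) : (0 <= (frac_quotient u z.1 z.2)%:E)%E by rewrite lee_fin.
apply: (le_integral_section lambda mG mG mq3 f3 C0 (h := fun y =>
  \int[lambda]_(x in G) (frac_quotient u (T x) y)%:E)%E).
- apply: (measurable_integral_section lambda mG
    (f := fun z : X => (frac_quotient u (T z.2) z.1)%:E)).
    apply/measurable_EFinP; apply: measurable_frac_quotient => //.
    exact: measurableT_comp mT measurable_snd.
  by move=> z; rewrite lee_fin.
- by move=> y; apply: integral_ge0 => x _; rewrite lee_fin.
- move=> y _; have H := @integral_frac_quotient_comp T L G u y mT L0 TL cu mG TG.
  exact (eq_ind_r (fun f => (\int[lambda]_(x in G) f x <= _)%E) H (sym y)).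
Qed.

End change_of_variables.

(** * Averaging at the scale of the distance to the boundary *)

Section smoothing.
Context {R : realType} {n : nat}.
Implicit Types (u : 'rV[R]_n -> R).
Local Notation N := (@eucl_norm R n).
Local Notation lambda := (@lebesgue_rV R n).
Variables (s p : R) (G : set 'rV[R]_n).
Hypotheses (n_gt0 : (0 < n)%N) (s_gt0 : 0 < s) (p_gt1 : 1 < p).
Hypotheses (oG : open G) (bG : bounded_set G) (b0 : boundary G !=set0).
Local Notation d x := (set_dist [set x] (boundary G)).
Hypothesis d_gt0 : forall x : 'rV[R]_n, G x -> 0 < d x.
Local Notation a := (n%:R + s * p).

Let p_gt0 : 0 < p. Proof. exact: lt_trans p_gt1. Qed.

Definition unit_box : set 'rV[R]_n := closed_box 0 (1 / 2).

(** The displacement is a fraction of the distance to the boundary, small enough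
    (points of the box have norm at most [n / 2]) for the shift to preserve [G]
    and to be bi-Lipschitz. *)
Definition shift (z x : 'rV[R]_n) : 'rV[R]_n := x + (n%:R^-1 * d x) *: z.

Lemma lebesgue_unit_box : lambda unit_box = 1%E.
Proof. by rewrite lebesgue_closed_box ?divr_ge0// mulrC divfK// expr1n. Qed.

Lemma measurable_unit_box : measurable unit_box.
Proof. exact: measurable_closed_box. Qed.

Lemma unit_box_norm z : unit_box z -> N z <= n%:R / 2.
Proof.
move=> /closed_boxE Zz; rewrite -[2^-1]mul1r; apply: eucl_norm_le_coord => // i.
by have := Zz i; rewrite mxE sub0r normrN.
Qed.

Lemma shift_le z (r : R) : unit_box z -> N ((n%:R^-1 * r) *: z) <= `|r| / 2.
Proof.
move=> Zz; rewrite eucl_normZ normrM ger0_norm ?invr_ge0//.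
apply: le_trans (ler_wpM2l _ (unit_box_norm Zz)) _.
  by rewrite mulr_ge0 ?invr_ge0.
rewrite le_eqVlt; apply/orP; left; apply/eqP; field.
by rewrite pnatr_eq0 -lt0n.
Qed.

Lemma shift_dist z x : unit_box z -> N (x - shift z x) <= d x / 2.
Proof.
move=> Zz; rewrite /shift opprD addrA subrr add0r eucl_normN.
by apply: le_trans (shift_le _ Zz) _; rewrite ger0_norm ?dist_ge0.
Qed.

Lemma shift_in z x : unit_box z -> G x -> G (shift z x).
Proof.
move=> Zz Gx; apply: (ball_subset oG Gx); rewrite lt_max; apply/orP; left.
apply: le_lt_trans (shift_dist x Zz) _; have := d_gt0 Gx.
by move: (set_dist _ _) => r r0; lra.
Qed.

Lemma in_shift z x : unit_box z -> G (shift z x) -> G x.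
Proof.
move=> Zz GT; have [d0|d0] := leP (d x) 0.
  have {}d0 : d x = 0 by apply/eqP; rewrite eq_le d0 dist_ge0.
  by move: GT; rewrite /shift d0 mulr0 scale0r addr0.
apply: (ball_subset oG GT); rewrite lt_max; apply/orP; right.
rewrite eucl_normB; apply: le_lt_trans (shift_dist x Zz) _.
by move: (set_dist _ _) d0 => r r0; lra.
Qed.

Let shift_sub z x y :
  shift z x - shift z y = (x - y) + (n%:R^-1 * (d x - d y)) *: z.
Proof. by rewrite /shift mulrBr scalerBl opprD addrACA. Qed.

Let shift_err z x y : unit_box z ->
  N ((n%:R^-1 * (d x - d y)) *: z) <= N (x - y) / 2.
Proof.
move=> Zz; apply: le_trans (shift_le _ Zz) _; rewrite ler_wpM2r ?invr_ge0//.
exact: dist_lipschitz_norm.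
Qed.

Lemma shift_lipschitz z x y : unit_box z ->
  N (shift z x - shift z y) <= 3 / 2 * N (x - y).
Proof.
move=> Zz; rewrite shift_sub; apply: le_trans (eucl_normD _ _) _.
by have := shift_err x y Zz; lra.
Qed.

Lemma shift_lower z x y : unit_box z ->
  N (x - y) <= 2 * N (shift z x - shift z y).
Proof.
move=> Zz; have := shift_err x y Zz; set e := (_ *: z) => He.
have := eucl_normD (shift z x - shift z y) (- e).
by rewrite shift_sub -/e addrK eucl_normN; lra.
Qed.

Lemma dist_shift z x : unit_box z -> d (shift z x) <= 3 / 2 * d x.
Proof.
move=> Zz; apply: le_trans (dist_lipschitz _ x b0) _.
by rewrite eucl_normB; have := shift_dist x Zz; lra.
Qed.

Lemma measurable_shift X (dX : measurableType X) (f g : dX -> 'rV[R]_n) :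
  measurable_fun setT f -> measurable_fun setT g ->
  measurable_fun setT (fun w => shift (f w) (g w)).
Proof.
move=> mf mg; apply: measurable_fun_rV => i.
rewrite [X in measurable_fun _ X](_ : _ = (fun w =>
    g w ord0 i + (n%:R^-1 * d (g w)) * f w ord0 i)); last first.
  by apply/funext => w; rewrite !mxE.
apply: measurable_funD; first exact: measurableT_comp (measurable_rV_coord i) mg.
apply: measurable_funM; last exact: measurableT_comp (measurable_rV_coord i) mf.
apply: measurable_funM => //.
apply: (measurableT_comp (f := fun x : 'rV[R]_n => d x)) mg.
by apply: continuous_measurable_rV => x; exact: dist_continuous.
Qed.

Lemma shift_continuous2 : continuous (fun w : 'rV[R]_n * 'rV[R]_n => shift w.1 w.2).
Proof.
move=> w; apply: (cvgD (F := nbhs w)); first exact: cvg_snd.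
apply: (cvgZ (F := nbhs w)); last exact: cvg_fst.
apply: (cvgM (F := nbhs w)); first exact: cvg_cst.
apply: (@cvg_comp _ _ _ snd (fun x : 'rV[R]_n => d x) (nbhs w) (nbhs w.2)).
  exact: cvg_snd.
exact: dist_continuous.
Qed.

Lemma Cc_bounded u : Cc G u -> exists M : R, forall x, `|u x| <= M.
Proof.
move=> [cu comp _].
have [[x0 x0u]|/set0P/negP/negPn/eqP u0] :=
    pselect (closure [set x | u x != 0] !=set0); last first.
  exists 0 => x; have [->|ux] := eqVneq (u x) 0; first by rewrite normr0.
  suff : closure [set x | u x != 0] x by rewrite u0.
  exact: subset_closure.
have [x /set_mem ux xmax] : exists2 c, c \in closure [set x | u x != 0] &
    forall t, t \in closure [set x | u x != 0] -> `|u t| <= `|u c|.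
  apply: compact_EVT_max => //; first by exists x0.
  apply: continuous_subspaceT => z.
  by apply: (cvg_norm (F := nbhs z)); exact: cu.
exists `|u x| => z; have [->|uz] := eqVneq (u z) 0; first by rewrite normr0.
by apply: xmax; apply/mem_set/subset_closure.
Qed.

Section mollify.
Variable F : 'rV[R]_n -> R.
Hypotheses (F0 : forall x, 0 <= F x) (cF : Cc G F).

Definition mollify (x : 'rV[R]_n) : R := \int[lambda]_(z in unit_box) F (shift z x).

Let contF : continuous F. Proof. by case: cF. Qed.

Let mF : measurable_fun setT F.
Proof. exact: continuous_measurable_rV. Qed.

Let measurable_F_shift x : measurable_fun setT (fun z => F (shift z x)).
Proof. by apply: measurableT_comp mF _; exact: measurable_shift. Qed.

Let M := projT1 (cid (Cc_bounded cF)).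
Let FM x : `|F x| <= M. Proof. exact: (projT2 (cid (Cc_bounded cF)) x). Qed.

Let integrable_F_shift x :
  lambda.-integrable unit_box (EFin \o (fun z => F (shift z x))).
Proof.
apply: (bounded_integrable measurable_unit_box lebesgue_unit_box (M := M)) => //.
Qed.

Lemma mollify_ge0 x : 0 <= mollify x.
Proof. by apply: Rintegral_ge0. Qed.

Lemma mollify_jensen x y :
  ((`|mollify x - mollify y| `^ p)%:E <=
   \int[lambda]_(z in unit_box) (`|F (shift z x) - F (shift z y)| `^ p)%:E)%E.
Proof.
exact: (jensen_dist measurable_unit_box lebesgue_unit_box p_gt1 (M := M)).
Qed.

Lemma mollify_jensen_cst x y :
  ((`|F x - mollify y| `^ p)%:E <=
   \int[lambda]_(z in unit_box) (`|F x - F (shift z y)| `^ p)%:E)%E.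
Proof.
have := jensen_dist measurable_unit_box lebesgue_unit_box p_gt1
  (u := cst (F x)) (v := fun z => F (shift z y)) (measurable_cst _)
  (measurable_F_shift y) (fun=> FM x) (fun z => FM (shift z y)).
rewrite Rintegral_cst; last exact: measurable_unit_box.
by rewrite [X in fine X]lebesgue_unit_box mulr1.
Qed.

Lemma mollify_neq0 x : mollify x != 0 -> exists2 z, unit_box z & F (shift z x) != 0.
Proof.
apply: contraPP => /forall2NP H; apply/negP/negPn/eqP.
rewrite /mollify /Rintegral integral0_eq// => z Zz.
by have [//|/negP/negPn/eqP ->] := H z.
Qed.

Let compact_unit_box : compact unit_box.
Proof.
apply: (@rV_compact R n (fun i => `[(0 : 'rV[R]_n) ord0 i - 1 / 2,
  (0 : 'rV[R]_n) ord0 i + 1 / 2]%classic)) => i; exact: segment_compact.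
Qed.

Let comp_shift_continuous :
  continuous (fun w : 'rV[R]_n * 'rV[R]_n => F (shift w.1 w.2)).
Proof.
by move=> w; apply: continuous_comp; [exact: shift_continuous2|exact: contF].
Qed.

(** The integrand is jointly continuous, hence near [x] uniformly in the compact
    box of shifts. *)
Lemma mollify_continuous : continuous mollify.
Proof.
move=> x; apply/(@cvgrPdist_le _ _ _ (nbhs x) (nbhs_filter x)) => e e0.
have /(_ _ (nbhs x) (fun y z => `|F (shift z x) - F (shift z y)| <= e)) :=
  (compact_near_coveringP unit_box).1 compact_unit_box.
have H z : unit_box z -> \forall z' \near z & y \near nbhs x,
    `|F (shift z' x) - F (shift z' y)| <= e.
  move=> Zz; have /cvgrPdist_le /(_ (e / 2)) := comp_shift_continuous (x := (z, x)).
  rewrite divr_gt0// => /(_ isT)[[A B] /= [zA xB] AB].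
  exists (A, B) => // -[z' y] [/= Az' By].
  have /= H1 := AB (z', x) (conj Az' (nbhs_singleton xB)).
  have /= H2 := AB (z', y) (conj Az' By).
  rewrite -(subrKA (F (shift z x))) (le_trans (ler_normD _ _))//.
  by rewrite distrC in H1; rewrite [e]splitr lerD.
move=> /(_ (nbhs_filter x) H); apply: filterS => y xy.
rewrite /mollify -RintegralB//; last exact: measurable_unit_box.
have iB : lambda.-integrable unit_box
    (EFin \o (fun z => F (shift z x) - F (shift z y))).
  apply: (bounded_integrable measurable_unit_box lebesgue_unit_box (M := M + M)).
    exact: measurable_funB.
  by move=> z; rewrite (le_trans (ler_normB _ _))// lerD.
apply: le_trans (le_normr_Rintegral measurable_unit_box iB) _.
have -> : e = \int[lambda]_(z in unit_box) (cst e z).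
  rewrite Rintegral_cst; last exact: measurable_unit_box.
  by rewrite [X in fine X]lebesgue_unit_box mulr1.
apply: le_Rintegral; first exact: measurable_unit_box.
- apply: (bounded_integrable measurable_unit_box lebesgue_unit_box (M := M + M)).
    by apply: measurableT_comp => //; exact: measurable_funB.
  by move=> z; rewrite normr_id (le_trans (ler_normB _ _))// lerD.
- exact: (bounded_integrable measurable_unit_box lebesgue_unit_box (M := `|e|)).
- by move=> z Zz; exact: xy.
Qed.

(** A shift increases the distance to the boundary by a factor [3 / 2] at most, so
    the support of the average stays away from the boundary. *)
Lemma mollify_Cc : Cc G mollify.
Proof.
have [c c0 Fc] := Cc_dist_ge b0 d_gt0 cF.
apply: (Cc_of_dist_ge bG b0 mollify_continuous (c := 2 / 3 * c)).
  by rewrite mulr_gt0.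
move=> x /mollify_neq0[z Zz] /Fc[GT cT]; split; first exact: in_shift Zz GT.
by have := le_trans cT (dist_shift x Zz); lra.
Qed.

(** Jensen's inequality moves the average out of the energy, and each single
    shift is a bi-Lipschitz change of variables. *)
Lemma energy_mollify :
  (gagliardo_energy s p G mollify <=
   ((3 / 2) `^ a * ((2 * n%:R * 2) ^+ n) ^+ 2)%:E * gagliardo_energy s p G F)%E.
Proof.
set C := _ * _ ^+ 2.
have C0 : 0 < C by rewrite mulr_gt0 ?powR_gt0 ?exprn_gt0 ?mulr_gt0 ?ltr0n.
pose V := 'rV[R]_n.
have mG : measurable G by exact: open_measurable_rV.
pose k (x y z : V) := `|F (shift z x) - F (shift z y)| `^ p / N (x - y) `^ a.
have k0 x y z : (0 <= (k x y z)%:E)%E by rewrite lee_fin divr_ge0 ?powR_ge0.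
have mk e (X : measurableType e) (f g h : X -> V) :
    measurable_fun setT f -> measurable_fun setT g -> measurable_fun setT h ->
    measurable_fun setT (fun w => (k (f w) (g w) (h w))%:E).
  move=> mf mg mh; apply/measurable_EFinP; apply: measurable_powR_div.
    apply: measurableT_comp => //; apply: measurable_funB;
      apply: measurableT_comp mF _; exact: measurable_shift.
  by apply: measurableT_comp (measurable_eucl_norm) _; exact: measurable_rV_sub.
have mfst2 : measurable_fun setT (fun w : V * V * V => w.1.1).
  exact: measurableT_comp measurable_fst measurable_fst.
have msnd2 : measurable_fun setT (fun w : V * V * V => w.1.2).
  exact: measurableT_comp measurable_snd measurable_fst.
have mZ := measurable_unit_box.
have mK : measurable_fun setT
    (fun w : V * V => \int[lambda]_(z in unit_box) (k w.1 w.2 z)%:E)%E.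
  apply: (measurable_integral_section lambda mZ
    (f := fun w : V * V * V => (k w.1.1 w.1.2 w.2)%:E)) => //.
  exact: mk.
have mH : measurable_fun setT
    (fun w : V * V => \int[lambda]_(y in G) (k w.1 y w.2)%:E)%E.
  apply: (measurable_integral_section lambda mG
    (f := fun w : V * V * V => (k w.1.1 w.2 w.1.2)%:E)) => //.
  exact: mk.
have mm : measurable_fun setT mollify.
  by apply: continuous_measurable_rV; exact: mollify_continuous.
have K0 (w : V * V) : (0 <= \int[lambda]_(z in unit_box) (k w.1 w.2 z)%:E)%E.
  by apply: integral_ge0.
have H0 (w : V * V) : (0 <= \int[lambda]_(y in G) (k w.1 y w.2)%:E)%E.
  by apply: integral_ge0.
have step1 : (gagliardo_energy s p G mollify <= \int[lambda]_(x in G)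
    \int[lambda]_(y in G) \int[lambda]_(z in unit_box) (k x y z)%:E)%E.
  apply: (le_integral2 lambda lambda mG mG (measurable_frac_quotient2 s p mm)
    _ mK K0).
    by move=> w; rewrite lee_fin frac_quotient_ge0.
  move=> x y Gx Gy; rewrite /k /frac_quotient /=.
  under [leRHS]eq_integral do rewrite EFinM muleC.
  rewrite ge0_integralZl_EFin ?invr_ge0 ?powR_ge0//.
  - by rewrite mulrC EFinM lee_wpmul2l ?lee_fin ?invr_ge0 ?powR_ge0// mollify_jensen.
  - apply/measurable_EFinP/measurable_funTS.
    apply: measurableT_comp (measurable_powR p) _.
    by apply: measurableT_comp => //; exact: measurable_funB.
apply: le_trans step1 _.
have -> : (\int[lambda]_(x in G) \int[lambda]_(y in G)
    \int[lambda]_(z in unit_box) (k x y z)%:E =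
  \int[lambda]_(z in unit_box) \int[lambda]_(x in G) \int[lambda]_(y in G)
    (k x y z)%:E)%E.
  transitivity (\int[lambda]_(x in G) \int[lambda]_(z in unit_box)
    \int[lambda]_(y in G) (k x y z)%:E)%E.
    apply: eq_integral => x _.
    apply: (integral_swap lambda lambda mG mZ (f := fun w => (k x w.1 w.2)%:E)) => //.
    exact: mk.
  exact: (integral_swap lambda lambda mG mZ mH).
have [->|Efin] := eqVneq (gagliardo_energy s p G F) +oo%E.
  by rewrite gt0_muley ?lte_fin// leey.
have /fineK <- : gagliardo_energy s p G F \is a fin_num.
  by rewrite ge0_fin_numE ?ltey// gagliardo_energy_ge0.
have -> : (C%:E * (fine (gagliardo_energy s p G F))%:E =
    \int[lambda]_(z in unit_box) (C * fine (gagliardo_energy s p G F))%:E)%E.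
  by rewrite integral_cst// [X in _ = (_ * X)%E]lebesgue_unit_box mule1 EFinM.
apply: ge0_le_integral; first exact: mZ.
- by move=> z _; apply: integral_ge0 => x _; exact: integral_ge0.
- apply: measurable_funTS.
  apply: (measurable_integral_section lambda mG
    (f := fun w : V * V => \int[lambda]_(y in G) (k w.2 y w.1)%:E)%E).
    apply: (measurable_integral_section lambda mG
      (f := fun w : V * V * V => (k w.1.2 w.2 w.1.1)%:E)); first exact: mk.
    by move=> w; exact: k0.
  by move=> w; apply: integral_ge0 => y _; exact: k0.
- exact: measurable_cst.
- move=> z Zz; rewrite EFinM fineK; last first.
    by rewrite ge0_fin_numE ?ltey// gagliardo_energy_ge0.
  apply: energy_comp_le => //.
  - by apply: measurable_shift.
  - by move=> x y; exact: shift_lower.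
  - by move=> x y; exact: shift_lipschitz.
  - by move=> x; exact: shift_in.
Qed.

End mollify.

End smoothing.

(** * Sums of integrals over Whitney cubes *)

Section cubes.
Context {R : realType} {n : nat}.
Implicit Types (Q : dyadic n) (X : seq (dyadic n)).
Local Notation lambda := (@lebesgue_rV R n).
Local Notation side := (@side R n).
Local Notation cube := (@cube R n).

Definition open_cube Q : set 'rV[R]_n :=
  [set x | forall i, `]side Q * (Q.2 ord0 i)%:~R,
                       side Q * (Q.2 ord0 i + 1)%:~R[%classic (x ord0 i)].

Let cube_itv Q : cube Q = [set x | forall i,
  `[side Q * (Q.2 ord0 i)%:~R, side Q * (Q.2 ord0 i + 1)%:~R]%classic (x ord0 i)].
Proof.
apply/seteqP; split=> x H i; have := H i; rewrite /= in_itv//.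
Qed.

Lemma measurable_cube Q : measurable (cube Q).
Proof.
rewrite cube_itv; exact: (measurable_rV_box (fun i => measurable_itv
  `[side Q * (Q.2 ord0 i)%:~R, side Q * (Q.2 ord0 i + 1)%:~R])).
Qed.

Lemma measurable_open_cube Q : measurable (open_cube Q).
Proof.
exact: (measurable_rV_box (fun i => measurable_itv
  `]side Q * (Q.2 ord0 i)%:~R, side Q * (Q.2 ord0 i + 1)%:~R[)).
Qed.

Let itv_len Q (i : 'I_n) :
  (if (side Q * (Q.2 ord0 i)%:~R < side Q * (Q.2 ord0 i + 1)%:~R)%R
   then (side Q * (Q.2 ord0 i + 1)%:~R)%:E - (side Q * (Q.2 ord0 i)%:~R)%:E
   else 0)%E = (side Q)%:E.
Proof.
rewrite ltr_pM2l ?side_gt0// ltr_int ltrDl ltr01 -EFinB -mulrBr intrD.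
by rewrite addrAC subrr add0r mulr1.
Qed.

Lemma lebesgue_cube Q : lambda (cube Q) = (side Q ^+ n)%:E.
Proof.
rewrite cube_itv (lebesgue_rV_box (A := fun i => `[side Q * (Q.2 ord0 i)%:~R,
  side Q * (Q.2 ord0 i + 1)%:~R]%classic))//.
rewrite (eq_bigr (fun=> (side Q)%:E)) => [|i _].
  by rewrite prodEFin prodr_const card_ord.
by rewrite lebesgue_measure_itv/= lte_fin; exact: itv_len.
Qed.

Lemma lebesgue_open_cube Q : lambda (open_cube Q) = (side Q ^+ n)%:E.
Proof.
rewrite (lebesgue_rV_box (A := fun i => `]side Q * (Q.2 ord0 i)%:~R,
  side Q * (Q.2 ord0 i + 1)%:~R[%classic))//.
rewrite (eq_bigr (fun=> (side Q)%:E)) => [|i _].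
  by rewrite prodEFin prodr_const card_ord.
by rewrite lebesgue_measure_itv/= lte_fin; exact: itv_len.
Qed.

Lemma open_cube_sub Q : open_cube Q `<=` cube Q.
Proof.
move=> x Qx i; have := Qx i; rewrite /= in_itv/= => /andP[x1 x2].
by rewrite !ltW.
Qed.

Lemma open_cube_interior Q : open_cube Q `<=` interior (cube Q).
Proof.
move=> x Qx.
have near_i (i : 'I_n) : \forall y \near x, `]side Q * (Q.2 ord0 i)%:~R,
    side Q * (Q.2 ord0 i + 1)%:~R[%classic ((y : 'rV[R]_n) ord0 i).
  apply: (@coord_continuous R 1 n ord0 i x).
  by apply: open_nbhs_nbhs; split; [exact: itv_open|exact: Qx].
have := filter_forall (nbhs_filter x) near_i; apply: filterS => y Hy.
by apply: open_cube_sub => i; exact: Hy.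
Qed.

Lemma integral_cube_open Q (f : 'rV[R]_n -> \bar R) :
  measurable_fun setT f -> (forall x, 0 <= f x)%E ->
  (\int[lambda]_(x in cube Q) f x = \int[lambda]_(x in open_cube Q) f x)%E.
Proof.
move=> mf f0; have mD : measurable (cube Q `\` open_cube Q).
  by apply: measurableD; [exact: measurable_cube|exact: measurable_open_cube].
rewrite (@ge0_negligible_integral _ _ _ lambda _ (cube Q `\` open_cube Q))//.
- by rewrite setDD setIidr//; exact: open_cube_sub.
- exact: measurable_cube.
- exact: measurable_funTS.
- rewrite measureD; last 3 first.
  + exact: measurable_cube.
  + exact: measurable_open_cube.
  + by rewrite [X in (X < _)%E]lebesgue_cube ltry.
  rewrite setIidr; last exact: open_cube_sub.
  by rewrite [X in (X - _)%E]lebesgue_cube [X in (_ - X)%E]lebesgue_open_cube subee.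
Qed.

Context (G : set 'rV[R]_n) (W : set (dyadic n)).
Hypothesis wG : whitney_decomposition G W.
Hypothesis mG : measurable G.

Let trivIset_open_cube X : [set` X] `<=` W -> trivIset [set` X] open_cube.
Proof.
move=> XW P Q PX QX [x [Px Qx]]; apply: contrapT => PQ.
case: wG => _ /(_ P Q (XW _ PX) (XW _ QX) PQ) + _ => /seteqP[+ _].
by move=> /(_ x); apply; split; exact: open_cube_interior.
Qed.

(** The cubes overlap in null sets only, so integrals over them add up. *)
Lemma sum_integral_cube_le X (D : set 'rV[R]_n) (f : 'rV[R]_n -> \bar R) :
  uniq X -> [set` X] `<=` W -> measurable D ->
  (forall Q, Q \in X -> cube Q `<=` D) ->
  measurable_fun setT f -> (forall x, 0 <= f x)%E ->
  (\sum_(Q <- X) \int[lambda]_(x in cube Q) f x <= \int[lambda]_(x in D) f x)%E.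
Proof.
move=> uX XW mD XD mf f0.
rewrite (eq_bigr (fun Q => \int[lambda]_(x in open_cube Q) f x)%E); last first.
  by move=> Q _; exact: integral_cube_open.
rewrite -ge0_integral_bigsetU//.
- apply: ge0_subset_integral => //.
  + by apply: bigsetU_measurable => Q _; exact: measurable_open_cube.
  + exact: measurable_funTS.
  + rewrite big_seq; elim/big_ind : _ => //.
    * by move=> A B AD BD x [/AD|/BD].
    * by move=> Q QX x /open_cube_sub; exact: XD.
- exact: measurable_open_cube.
- exact: trivIset_open_cube.
- exact: measurable_funTS.
Qed.

Lemma sum_side_le X (D : set 'rV[R]_n) :
  uniq X -> [set` X] `<=` W -> measurable D ->
  (forall Q, Q \in X -> cube Q `<=` D) ->
  ((\sum_(Q <- X) side Q ^+ n)%:E <= lambda D)%E.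
Proof.
move=> uX XW mD XD.
have := sum_integral_cube_le uX XW mD XD (f := cst 1%E) (measurable_cst _) (fun=> lee01).
rewrite integral_cst// mul1e; apply: le_trans; rewrite -sumEFin lee_sum// => Q _.
rewrite integral_cst; last exact: measurable_cube.
by rewrite mul1e [X in (_ <= X)%E]lebesgue_cube.
Qed.

Lemma integral_le_sum_cube X (f : 'rV[R]_n -> \bar R) :
  (forall x, G x -> f x != 0%E -> exists2 Q, Q \in X & cube Q x) ->
  measurable_fun setT f -> (forall x, 0 <= f x)%E ->
  (\int[lambda]_(x in G) f x <= \sum_(Q <- X) \int[lambda]_(x in cube Q) f x)%E.
Proof.
move=> cover mf f0; rewrite integral_mkcond.
under [leRHS]eq_bigr do rewrite integral_mkcond.
have mr (D : set 'rV[R]_n) : measurable D -> measurable_fun setT (f \_ D).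
  by move=> mD; apply/(measurable_restrictT _ mD); exact: measurable_funTS.
have r0 (D : set 'rV[R]_n) x : (0 <= (f \_ D) x)%E.
  by apply: erestrict_ge0 => *; exact: f0.
rewrite -ge0_integral_sum//; last first.
  by move=> Q; apply: mr; exact: measurable_cube.
apply: ge0_le_integral => //.
- exact: mr.
- by apply: emeasurable_sum => Q; apply: mr; exact: measurable_cube.
move=> x _; rewrite patchE; case: ifPn => [/set_mem Gx|_]; last first.
  by apply: sume_ge0 => Q _; exact: r0.
have [->|fx] := eqVneq (f x) 0%E; first by apply: sume_ge0 => Q _; exact: r0.
have [Q QX Qx] := cover x Gx fx.
rewrite (perm_big _ (perm_to_rem QX)) big_cons patchE mem_set// leeDl//.
by apply: sume_ge0 => P _; exact: r0.
Qed.

Hypothesis bG : bounded_set G.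

Lemma lebesgue_bounded : (lambda G < +oo)%E.
Proof.
have [M [_ HM]] := bG; pose r := `|M| + 1.
have Mr : M < r by rewrite (le_lt_trans (ler_norm M))// ltrDl.
have r0 : 0 <= r by rewrite addr_ge0.
have sub : G `<=` closed_box 0 r.
  move=> x Gx; apply/closed_boxE => i; rewrite mxE sub0r normrN.
  apply: le_trans (HM r Mr x Gx); rewrite [leRHS]mx_normrE.
  exact: (le_bigmax _ (fun ij : 'I_1 * 'I_n => `|x ij.1 ij.2|) (ord0, i)).
apply: (@le_lt_trans _ _ (lambda (closed_box 0 r))).
  by apply: le_measure => //; rewrite inE //; exact: measurable_closed_box.
by rewrite lebesgue_closed_box// ltry.
Qed.

(** Cubes with disjoint interiors, of side at least [r] and inside a set of finite
    volume. A function with compact support in [G] only sees such cubes. *)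
Lemma finite_large_cubes (r : R) : 0 < r -> finite_set [set Q | W Q /\ r <= side Q].
Proof.
move=> r0; apply: contrapT => /infinite_set_fset H.
have [V VE] : exists V : R, lambda G = V%:E.
  by exists (fine (lambda G)); rewrite fineK// ge0_fin_numE// lebesgue_bounded.
have rn0 : 0 < r ^+ n by rewrite exprn_gt0.
have [B BW Bk] := H (Num.bound (V / r ^+ n)).
have := @sum_side_le (finmap.enum_fset B) G (finmap.fset_uniq B) _ mG _.
rewrite VE lee_fin => Hs.
have {}Hs : \sum_(Q <- finmap.enum_fset B) side Q ^+ n <= V.
  apply: Hs => [Q /BW[]//|Q /BW[WQ _]]; exact: (whitney_sub wG).
have : (size (finmap.enum_fset B))%:R * r ^+ n <= V.
  apply: le_trans Hs; apply: (@le_trans _ _ (\sum_(Q <- finmap.enum_fset B) r ^+ n)).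
    by rewrite big_const_seq count_predT iter_addr_0 mulr_natl.
  rewrite big_seq [leRHS]big_seq ler_sum// => Q /BW[_ rQ].
  by rewrite lerXn2r// nnegrE ltW// side_gt0.
have V0 : 0 <= V by rewrite -lee_fin -VE.
rewrite leNgt => /negP; apply; rewrite -ltr_pdivrMr//.
apply: lt_le_trans (archi_boundP _) _; first by rewrite divr_ge0// ltW.
by rewrite ler_nat.
Qed.

End cubes.

(** * Powers and dyadic truncation *)

Lemma powR_natD (R : realType) (n : nat) (t q : R) : 0 < t ->
  t `^ (n%:R + q) = t ^+ n * t `^ q.
Proof.
move=> t0; rewrite powRD ?powR_mulrn ?ltW//.
by apply/implyP => _; rewrite gt_eqF.
Qed.

Lemma powR_natB (R : realType) (n : nat) (t q : R) : 0 < t ->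
  t `^ (n%:R - q) = t ^+ n / t `^ q.
Proof. by move=> t0; rewrite powR_natD// powRN. Qed.

Section truncation.
Context {R : realType}.
Variable p : R.
Hypothesis p_gt1 : 1 < p.

Let p_gt0 : 0 < p. Proof. exact: lt_trans p_gt1. Qed.

Lemma le_powR (x y : R) : 0 <= x -> x <= y -> x `^ p <= y `^ p.
Proof.
move=> x0 xy; apply: ge0_ler_powR => //; rewrite ?nnegrE//; first exact: ltW.
exact: le_trans xy.
Qed.

(** The function [t ^ p = t * t ^ (p - 1)] is superadditive because [t ^ (p - 1)]
    is nondecreasing. *)
Lemma sum_powR_le (I : Type) (r : seq I) (t : I -> R) : (forall i, 0 <= t i) ->
  \sum_(i <- r) t i `^ p <= (\sum_(i <- r) t i) `^ p.
Proof.
move=> t0; elim: r => [|i r IH]; first by rewrite !big_nil powR_ge0.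
rewrite !big_cons; apply: le_trans (lerD (lexx _) IH) _.
set S := \sum_(j <- r) t j; have S0 : 0 <= S by apply: sumr_ge0.
rewrite -(mulr_powRB1 (t0 i) p_gt0) -(mulr_powRB1 S0 p_gt0).
rewrite -(mulr_powRB1 (addr_ge0 (t0 i) S0) p_gt0) mulrDl lerD// ler_wpM2l//.
- by apply: ge0_ler_powR; rewrite ?nnegrE ?subr_ge0 ?lerDl ?(ltW p_gt1) ?addr_ge0.
- by apply: ge0_ler_powR; rewrite ?nnegrE ?subr_ge0 ?lerDr ?(ltW p_gt1) ?addr_ge0.
Qed.

Lemma powRD_le (x y : R) : 0 <= x -> 0 <= y ->
  (x + y) `^ p <= 2 `^ p * (x `^ p + y `^ p).
Proof.
move=> x0 y0; wlog xy : x y x0 y0 / x <= y.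
  by move=> H; have /orP[|/H] := le_total x y; [exact: H|rewrite addrC [x `^ p + _]addrC; exact].
apply: (@le_trans _ _ ((2 * y) `^ p)).
  by apply: le_powR; rewrite ?addr_ge0// mulr2n mulrDl mul1r lerD2r.
by rewrite powRM// ler_wpM2l ?powR_ge0// lerDr powR_ge0.
Qed.

Variable rho : R.
Hypothesis rho_gt0 : 0 < rho.

Definition level (j : nat) : R := rho * 2 ^+ j.

Definition slice (j : nat) (t : R) : R :=
  Num.min t (level j.+1) - Num.min t (level j).

Lemma level_gt0 j : 0 < level j.
Proof. by rewrite mulr_gt0// exprn_gt0. Qed.

Lemma levelS j : level j.+1 = 2 * level j.
Proof. by rewrite /level exprS mulrCA. Qed.

Lemma slice_ge j t : level j.+1 <= t -> slice j t = level j.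
Proof.
move=> jt; have := level_gt0 j; rewrite /slice levelS in jt * => l0.
rewrite !min_r//; first by rewrite mulr2n mulrDl mul1r addrK.
by apply: le_trans jt; lra.
Qed.

Lemma slice0 j : slice j 0 = 0.
Proof. by rewrite /slice !min_l ?subrr// ltW// level_gt0. Qed.

Lemma slice_homo j (t t' : R) : t <= t' -> slice j t <= slice j t'.
Proof.
have := level_gt0 j; rewrite /slice levelS; move: (level j) => l l0 tt'.
by rewrite !minEle; do 4 case: ifPn; rewrite -?ltNge; lra.
Qed.

Lemma slice_dist j (t t' : R) : `|slice j t - slice j t'| <= `|t - t'|.
Proof.
wlog tt' : t t' / t' <= t.
  move=> H; have /orP[|/H//] := le_total t t'; move=> /H.
  by rewrite distrC [X in _ <= X]distrC.
rewrite !ger0_norm ?subr_ge0 ?slice_homo//.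
have := level_gt0 j; rewrite /slice levelS; move: (level j) => l l0.
by rewrite !minEle; do 4 case: ifPn; rewrite -?ltNge; lra.
Qed.

Lemma slice_continuous j : continuous (slice j).
Proof.
move=> t; apply/cvgrPdist_le => e e0.
have := @cvgr_dist_le _ _ _ (nbhs t) (nbhs_filter t) id t cvg_id e e0.
by apply: filterS => t'; exact: le_trans (slice_dist _ _ _).
Qed.

Lemma sum_slice (J : nat) (t : R) :
  \sum_(j < J) slice j t = Num.min t (level J) - Num.min t (level 0).
Proof.
rewrite -(big_mkord xpredT (fun j => slice j t)).
by rewrite (telescope_sumr (fun j => Num.min t (level j))).
Qed.

(** The slices are monotone and telescope to a contraction, and [p >= 1]. *)
Lemma sum_slice_powR (J : nat) (t t' : R) :
  \sum_(j < J) `|slice j t - slice j t'| `^ p <= `|t - t'| `^ p.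
Proof.
wlog tt' : t t' / t' <= t.
  move=> H; have /orP[|/H//] := le_total t t'; move=> /H; rewrite distrC.
  by under eq_bigr do rewrite distrC.
apply: le_trans (sum_powR_le _ _) _ => //; apply: le_powR.
  by apply: sumr_ge0.
rewrite (eq_bigr (fun j : 'I_J => slice j t - slice j t')); last first.
  by move=> j _; rewrite ger0_norm// subr_ge0 slice_homo.
rewrite sumrB !sum_slice ger0_norm ?subr_ge0//.
have : level 0 <= level J by rewrite /level ler_pM2l// ler_weXn2l// ler1n.
have := level_gt0 0; move: (level 0) (level J) => l l' l0 ll'.
by rewrite !minEle; do 4 case: ifPn; rewrite -?ltNge; lra.
Qed.

Lemma dyadic_level (J : nat) (t : R) : level 1 <= t -> t < level J.+1 ->
  exists2 j, (j < J)%N & level j.+1 <= t < level j.+2.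
Proof.
move=> t1; elim: J => [|J IH] tJ; first by have := lt_le_trans tJ t1; rewrite ltxx.
have [/IH[j jJ H]|JT] := ltP t (level J.+1).
  by exists j => //; exact: ltnW.
by exists J => //; rewrite JT.
Qed.

(** The single index [j] with [level j.+1 <= t < level j.+2 = 4 * level j]
    accounts for the whole of [t ^ p]. *)
Lemma powR_le_sum_level (J : nat) (t : R) : 0 <= t ->
  (0 < t -> level 1 <= t) -> t < level J.+1 ->
  t `^ p <= \sum_(j < J) (if level j.+1 <= t then (4 * level j) `^ p else 0).
Proof.
move=> t0 t1 tJ; have [t00|tp] := leP t 0.
  have -> : t = 0 by apply/eqP; rewrite eq_le t00.
  rewrite powR0 ?gt_eqF//; apply: sumr_ge0 => j _.
  by case: ifP => // _; rewrite powR_ge0.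
have [j jJ /andP[jt tj]] := dyadic_level (t1 tp) tJ.
rewrite (bigD1 (Ordinal jJ))//= jt; apply: (@le_trans _ _ ((4 * level j) `^ p)).
  by apply: le_powR => //; move: tj; rewrite !levelS; lra.
rewrite lerDl; apply: sumr_ge0 => i _; case: ifP => // _; exact: powR_ge0.
Qed.

End truncation.

Section levels.
Context {R : realType}.

(** Finitely many values lie in finitely many dyadic levels: this lemma gives the
    lowest level, the next one the highest. *)
Lemma uniform_lower_bound (T : eqType) (X : seq T) (t : T -> R) :
  exists2 r : R, 0 < r & forall Q, Q \in X -> 0 < t Q -> r <= t Q.
Proof.
elim: X => [|P X [r r0 IH]]; first by exists 1.
have [tP|tP] := ltP 0 (t P).
  exists (Num.min r (t P)) => [|Q]; first by rewrite lt_min r0.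
  rewrite inE => /orP[/eqP -> _|/IH{}IH /IH rQ]; first by rewrite ge_min lexx orbT.
  by rewrite ge_min rQ.
exists r => // Q; rewrite inE => /orP[/eqP ->|/IH//].
by rewrite ltNge tP.
Qed.

Lemma level_above (T : eqType) (X : seq T) (t : T -> R) (rho : R) : 0 < rho ->
  exists J, forall Q, Q \in X -> t Q < level rho J.+1.
Proof.
move=> rho0; have [M HM] : exists M, forall Q, Q \in X -> t Q <= M.
  elim: X => [|P X [M IH]]; first by exists 0.
  exists (Num.max M (t P)) => Q; rewrite inE le_max => /orP[/eqP ->|/IH ->//].
  by rewrite lexx orbT.
exists (Num.bound (`|M| / rho)) => Q /HM; move=> /le_lt_trans; apply.
apply: le_lt_trans (ler_norm M) _; rewrite /level -ltr_pdivrMl// mulrC.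
apply: lt_le_trans (archi_boundP _) _; first by rewrite divr_ge0// ltW.
by rewrite -natrX ler_nat (leq_trans (leqnSn _))// ltnW// ltn_expl.
Qed.

End levels.

(** * Capacities and energies of truncations *)

Section capacity_lemmas.
Context {R : realType} {n : nat}.
Implicit Types (u : 'rV[R]_n -> R).
Local Notation N := (@eucl_norm R n).
Local Notation lambda := (@lebesgue_rV R n).
Variables (s p : R) (G : set 'rV[R]_n).
Hypotheses (s_gt0 : 0 < s) (p_gt1 : 1 < p) (oG : open G).
Local Notation a := (n%:R + s * p).

Let p_gt0 : 0 < p. Proof. exact: lt_trans p_gt1. Qed.

Let mG : measurable G. Proof. exact: open_measurable_rV. Qed.

Lemma seminorm_powR u :
  (gagliardo_seminorm s p G u `^ p = gagliardo_energy s p G u)%E.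
Proof.
rewrite /gagliardo_seminorm -poweRrM mulVf ?gt_eqF// poweRe1//.
exact: gagliardo_energy_ge0.
Qed.

Lemma capacity_le_energy (K : set 'rV[R]_n) u : Cc G u ->
  (forall x, K x -> 1 <= u x) -> (capacity s p K G <= gagliardo_energy s p G u)%E.
Proof.
by move=> cu Ku; rewrite -seminorm_powR; apply: ereal_inf_lbound; exists u.
Qed.

Lemma le_capacity (K : set 'rV[R]_n) (m : \bar R) :
  (forall u, Cc G u -> (forall x, K x -> 1 <= u x) ->
    (m <= gagliardo_energy s p G u)%E) -> (m <= capacity s p K G)%E.
Proof.
move=> H; apply: le_ereal_inf_tmp => _ [u [cu Ku] <-].
by rewrite seminorm_powR; exact: H.
Qed.

Lemma capacity_ge0 (K : set 'rV[R]_n) : (0 <= capacity s p K G)%E.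
Proof. by apply: le_capacity => u _ _; exact: gagliardo_energy_ge0. Qed.

Lemma le_capacityS (K L : set 'rV[R]_n) : K `<=` L ->
  (capacity s p K G <= capacity s p L G)%E.
Proof.
move=> KL; apply: le_capacity => u cu Lu; apply: capacity_le_energy => // x Kx.
by apply: Lu; exact: KL.
Qed.

Lemma le_energy (u v : 'rV[R]_n -> R) :
  measurable_fun setT u -> measurable_fun setT v ->
  (forall x y, `|u x - u y| <= `|v x - v y|) ->
  (gagliardo_energy s p G u <= gagliardo_energy s p G v)%E.
Proof.
move=> mu mv uv.
apply: (le_integral2 lambda lambda mG mG (measurable_frac_quotient2 s p mu) _
  (measurable_frac_quotient2 s p mv)).
- by move=> z; rewrite lee_fin frac_quotient_ge0.
- by move=> z; rewrite lee_fin frac_quotient_ge0.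
- move=> x y _ _; rewrite lee_fin /frac_quotient ler_wpM2r ?invr_ge0 ?powR_ge0//.
  exact: le_powR.
Qed.

(** Normalizing a slice by its height makes it a competitor for capacities; the
    weights undo the normalization, and the slices then add up pointwise by
    [sum_slice_powR]. *)
Lemma sum_energy_slice_le (rho : R) (J : nat) (g : 'rV[R]_n -> R) : 0 < rho ->
  continuous g ->
  (\sum_(j < J) ((4 * level rho j) `^ p)%:E *
      gagliardo_energy s p G (fun x => (slice rho j (g x) / level rho j)%R) <=
   (4 `^ p)%:E * gagliardo_energy s p G g)%E.
Proof.
move=> rho0 cg; pose V := 'rV[R]_n.
have mg : measurable_fun setT g by exact: continuous_measurable_rV.
pose gj (j : 'I_J) (x : V) := slice rho j (g x) / level rho j.
have mgj j : measurable_fun setT (gj j).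
  apply: measurable_funM => //; apply: continuous_measurable_rV => x.
  by apply: continuous_comp; [exact: cg|exact: slice_continuous].
pose h (j : 'I_J) (z : V * V) : \bar R :=
  (((4 * level rho j) `^ p)%:E * (frac_quotient s p (gj j) z.1 z.2)%:E)%E.
have mh j : measurable_fun setT (h j).
  exact: (measurable_funeM _ (measurable_frac_quotient2 s p (mgj j))).
have h0 j z : (0 <= h j z)%E by rewrite mule_ge0 ?lee_fin ?powR_ge0 ?frac_quotient_ge0.
have q0 u z : (0 <= (frac_quotient s p u z.1 z.2)%:E)%E.
  by rewrite lee_fin frac_quotient_ge0.
rewrite (eq_bigr (fun j => \int[lambda]_(x in G) \int[lambda]_(y in G) h j (x, y))%E).
  rewrite (integral2_sum lambda lambda mG mG _ mh h0).
  rewrite -(integral2Zl lambda lambda mG mG (measurable_frac_quotient2 s p mg) (q0 g))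
    ?powR_ge0//.
  pose f1 (z : V * V) := (\sum_(j < J) h j z)%E.
  pose f2 (z : V * V) := ((4 `^ p)%:E * (frac_quotient s p g z.1 z.2)%:E)%E.
  apply: (@le_integral2 _ _ _ _ _ lambda lambda G G mG mG f1 _ _ f2).
  - by apply: emeasurable_sum => j; exact: mh.
  - by move=> z; apply: sume_ge0 => j _; exact: h0.
  - exact: (measurable_funeM _ (measurable_frac_quotient2 s p mg)).
  - by move=> z; rewrite mule_ge0 ?q0// lee_fin powR_ge0.
  - move=> x y _ _; rewrite /f1 /f2 /h; under eq_bigr do rewrite -EFinM.
    rewrite sumEFin -EFinM lee_fin /=.
    rewrite (eq_bigr (fun j : 'I_J => (4 `^ p / N (x - y) `^ a) *
        `|slice rho j (g x) - slice rho j (g y)| `^ p)); last first.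
      move=> j _; have l0 := level_gt0 rho0 j.
      have l1 : 0 <= (level rho j)^-1 by rewrite invr_ge0 ltW.
      have l4 : 0 <= 4 * level rho j by rewrite mulr_ge0// ltW.
      rewrite /frac_quotient /gj -mulrBl normrM (ger0_norm l1) mulrA.
      rewrite -powRM//; last exact: mulr_ge0.
      rewrite [X in X `^ p](_ : _ = 4 * `|slice rho j (g x) - slice rho j (g y)|).
        by rewrite powRM// mulrAC.
      by field; rewrite gt_eqF.
    rewrite -mulr_sumr /frac_quotient mulrA mulrAC ler_wpM2r ?invr_ge0 ?powR_ge0//.
    by rewrite ler_wpM2l ?powR_ge0//; exact: sum_slice_powR.
move=> j _; rewrite -(integral2Zl lambda lambda mG mG
  (measurable_frac_quotient2 s p (mgj j)) (q0 (gj j))) ?powR_ge0//.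
Qed.

End capacity_lemmas.

(** * From quasiadditivity and capacity bounds to the Hardy inequality *)

Section sufficiency.
Context {R : realType} {n : nat}.
Implicit Types (u : 'rV[R]_n -> R) (Q : dyadic n) (X : seq (dyadic n)).
Local Notation N := (@eucl_norm R n).
Local Notation lambda := (@lebesgue_rV R n).
Local Notation side := (@side R n).
Local Notation cube := (@cube R n).
Variables (s p : R) (G : set 'rV[R]_n) (W : set (dyadic n)).
Hypotheses (n_gt0 : (0 < n)%N) (s_gt0 : 0 < s) (p_gt1 : 1 < p).
Hypotheses (oG : open G) (bG : bounded_set G) (G0 : G !=set0).
Hypothesis wG : whitney_decomposition G W.
Local Notation a := (n%:R + s * p).
Local Notation d x := (set_dist [set x] (boundary G)).

Let p_gt0 : 0 < p. Proof. exact: lt_trans p_gt1. Qed.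
Let mG : measurable G. Proof. exact: open_measurable_rV. Qed.
Let b0 : boundary G !=set0. Proof. exact: whitney_boundary wG G0. Qed.
Let d_gt0 (x : 'rV[R]_n) : G x -> 0 < d x.
Proof. exact: (whitney_dist_gt0 n_gt0 wG G0). Qed.

Lemma comp_Cc (f : R -> R) u : continuous f -> f 0 = 0 -> Cc G u -> Cc G (f \o u).
Proof.
move=> cf f0 cu; have [c c0 H] := Cc_dist_ge b0 d_gt0 cu.
apply: (Cc_of_dist_ge bG b0 (c := c)) => //.
  by move=> x; apply: continuous_comp; [case: cu => + _ _; exact|exact: cf].
by move=> x fx; apply: H; apply: contraNneq fx => /= ->; rewrite f0.
Qed.

Local Notation w Q := (side Q `^ (n%:R - s * p)).

Let side0 Q : 0 < side Q. Proof. exact: side_gt0. Qed.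

Let weightE Q : w Q = side Q ^+ n / side Q `^ (s * p).
Proof. exact: powR_natB. Qed.

Section local_estimate.
Variable F : 'rV[R]_n -> R.
Hypotheses (F0 : forall x, 0 <= F x) (cF : Cc G F).

Let contF : continuous F. Proof. by case: cF. Qed.
Let mF : measurable_fun setT F. Proof. exact: continuous_measurable_rV. Qed.

Definition oscillation_const : R := (4 * n%:R) `^ a * (2 * n%:R * n%:R) ^+ n.

Lemma oscillation_const_ge0 : 0 <= oscillation_const.
Proof. by rewrite mulr_ge0 ?powR_ge0// exprn_ge0// !mulr_ge0. Qed.

(** All points [y] that enter the average [mollify G F x0] are at distance at
    most [4 n side Q] from [x], so Jensen's inequality bounds the oscillation by
    a part of the energy integral. *)
Lemma oscillation_le Q x x0 : W Q -> cube Q x -> cube Q x0 ->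
  ((`|F x - mollify G F x0| `^ p)%:E <=
   (oscillation_const * side Q `^ (s * p))%:E *
     \int[lambda]_(y in G) (frac_quotient s p F x y)%:E)%E.
Proof.
move=> WQ Qx Qx0; have Gx0 := whitney_sub wG WQ Qx0.
have l0 := side0 Q; have l0' := ltW l0.
have d1 := whitney_dist_ge n_gt0 wG G0 WQ Qx0.
have d2 := whitney_dist_le n_gt0 wG G0 WQ Qx0.
have n0 : 0 < n%:R :> R by rewrite ltr0n.
have mT : measurable_fun setT (fun z => shift G z x0) by exact: measurable_shift.
apply: le_trans (mollify_jensen_cst p_gt1 b0 cF x x0) _.
have mq : measurable_fun setT (fun z => (frac_quotient s p F x (shift G z x0))%:E).
  by apply/measurable_EFinP; apply: measurable_frac_quotient.
pose Kc : R := (4 * n%:R * side Q) `^ a.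
have Kc0 : 0 <= Kc by exact: powR_ge0.
apply: (@le_trans _ _ (\int[lambda]_(z in unit_box)
    (Kc%:E * (frac_quotient s p F x (shift G z x0))%:E))%E).
  apply: ge0_le_integral; first exact: measurable_unit_box.
  - by move=> z _; rewrite lee_fin powR_ge0.
  - apply: measurable_funTS; apply/measurable_EFinP.
    apply: measurableT_comp (measurable_powR p) _; apply: measurableT_comp => //.
    by apply: measurable_funB => //; exact: measurableT_comp mF mT.
  - by apply: measurable_funTS; exact: (measurable_funeM _ mq).
  move=> z Zz; rewrite -EFinM lee_fin; set y := shift G z x0.
  have [->|xy] := eqVneq x y.
    by rewrite subrr normr0 powR0 ?gt_eqF// mulr_ge0// frac_quotient_ge0.
  have Nxy : 0 < N (x - y) by rewrite eucl_norm_gt0 subr_eq0.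
  rewrite /frac_quotient mulrCA -[leLHS]mulr1 ler_wpM2l ?powR_ge0//.
  rewrite ler_pdivlMr ?powR_gt0// mul1r; apply: ge0_ler_powR.
  - by rewrite addr_ge0// mulr_ge0// ltW.
  - by rewrite nnegrE ltW.
  - by rewrite nnegrE !mulr_ge0.
  apply: le_trans (eucl_distD x0 _ _) _.
  have := cube_eucl Qx Qx0; have := shift_dist n_gt0 b0 x0 Zz; rewrite -/y.
  move: (set_dist _ _) d1 d2 => r; rewrite -!mulrA.
  have : 0 <= n%:R * side Q by rewrite mulr_ge0.
  by move: (n%:R * side Q) => m; lra.
rewrite (ge0_integralZl_EFin lambda measurable_unit_box _ (measurable_funTS mq) Kc0);
  last by move=> z _; rewrite lee_fin frac_quotient_ge0.
have TL (y z : 'rV[R]_n) :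
    N (y - z) <= n%:R / side Q * N (shift G y x0 - shift G z x0).
  rewrite /shift opprD addrACA subrr add0r -scalerBr eucl_normZ.
  have dx0 : 0 < d x0 by exact: d_gt0.
  rewrite ger0_norm ?mulr_ge0 ?invr_ge0 ?(ltW dx0)// !mulrA.
  rewrite -[leLHS]mul1r ler_wpM2r ?eucl_norm_ge0//.
  have -> : n%:R / side Q / n%:R * d x0 = d x0 / side Q.
    by field; rewrite !gt_eqF.
  by rewrite ler_pdivlMr// mul1r.
have L0 : 0 <= n%:R / side Q by rewrite divr_ge0.
have := integral_frac_quotient_comp s oG p_gt0 x mT L0 TL contF measurable_unit_box
  (fun z Zz => shift_in n_gt0 oG b0 d_gt0 Zz Gx0).
move=> /(lee_wpmul2l (_ : (0 <= Kc%:E)%E)) => /(_ _)/le_trans; apply.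
  by rewrite lee_fin.
rewrite muleA -EFinM lee_wpmul2r//.
  by apply: integral_ge0 => y _; rewrite lee_fin frac_quotient_ge0.
rewrite lee_fin /Kc powRM ?mulr_ge0// (powR_natD _ _ l0) /oscillation_const.
rewrite le_eqVlt; apply/orP; left; apply/eqP.
rewrite [2 * _ * (_ / _)]mulrA exprMn exprVn.
by field; rewrite expf_neq0// gt_eqF.
Qed.

(** On a cube the distance is at least the side, and [F x] is compared with the
    average at one fixed point [x0] of the cube. *)
Lemma whitney_cube_estimate Q x0 : W Q -> cube Q x0 ->
  (\int[lambda]_(x in cube Q) (F x `^ p / d x `^ (s * p))%:E <=
   (2 `^ p)%:E * (oscillation_const%:E *
       \int[lambda]_(x in cube Q) \int[lambda]_(y in G) (frac_quotient s p F x y)%:E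
     + (w Q * mollify G F x0 `^ p)%:E))%E.
Proof.
move=> WQ Qx0; set g := mollify G F x0.
have g0 : 0 <= g by exact: mollify_ge0.
have l0 := side0 Q; have l0' := ltW l0.
have sp0 : 0 <= s * p by rewrite mulr_ge0// ltW.
have O0 := oscillation_const_ge0.
have mq := measurable_frac_quotient2 s p mF.
have q0 (z : 'rV[R]_n * 'rV[R]_n) : (0 <= (frac_quotient s p F z.1 z.2)%:E)%E.
  by rewrite lee_fin frac_quotient_ge0.
have mI : measurable_fun setT
    (fun x => \int[lambda]_(y in G) (frac_quotient s p F x y)%:E)%E.
  exact: (measurable_integral_section lambda mG mq q0).
have I0 x : (0 <= \int[lambda]_(y in G) (frac_quotient s p F x y)%:E)%E.
  by apply: integral_ge0 => y _; exact: (q0 (x, y)).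
have mQ := measurable_cube (R := R) Q.
have c0 : 0 <= (side Q `^ (s * p))^-1 * g `^ p by rewrite mulr_ge0 ?invr_ge0 ?powR_ge0.
apply: (@le_trans _ _ (\int[lambda]_(x in cube Q) ((2 `^ p)%:E *
   (oscillation_const%:E * \int[lambda]_(y in G) (frac_quotient s p F x y)%:E +
    ((side Q `^ (s * p))^-1 * g `^ p)%:E)))%E).
  apply: ge0_le_integral; first exact: mQ.
  - by move=> x _; rewrite lee_fin divr_ge0 ?powR_ge0.
  - by apply: measurable_funTS; exact: measurable_powR_dist.
  - apply: measurable_funTS; apply: measurable_funeM; apply: emeasurable_funD => //.
    exact: measurable_funeM.
  move=> x Qx; have d1 := whitney_dist_ge n_gt0 wG G0 WQ Qx.
  have dx0 : 0 < d x by exact: lt_le_trans d1.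
  have H : F x `^ p / d x `^ (s * p) <= 2 `^ p *
      ((side Q `^ (s * p))^-1 * `|F x - g| `^ p + (side Q `^ (s * p))^-1 * g `^ p).
    apply: (@le_trans _ _ (F x `^ p / side Q `^ (s * p))).
      rewrite ler_wpM2l ?powR_ge0// lef_pV2 ?posrE ?powR_gt0//.
      by apply: ge0_ler_powR => //; rewrite nnegrE// ltW.
    rewrite -mulrDr mulrCA mulrC ler_wpM2l ?invr_ge0 ?powR_ge0//.
    apply: le_trans (powRD_le p_gt1 _ g0) => //.
    apply: le_powR => //; rewrite -lerBlDr; exact: ler_norm.
  apply: (@le_trans _ _ (2 `^ p * ((side Q `^ (s * p))^-1 * `|F x - g| `^ p +
      (side Q `^ (s * p))^-1 * g `^ p))%:E); first by rewrite lee_fin.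
  rewrite EFinM lee_wpmul2l ?lee_fin ?powR_ge0// EFinD leeD2r//.
  have H2 := oscillation_le WQ Qx Qx0.
  have /(lee_wpmul2l)/(_ _ _ H2) H3 : (0 <= ((side Q `^ (s * p))^-1)%:E)%E.
    by rewrite lee_fin invr_ge0 powR_ge0.
  rewrite EFinM; apply: le_trans H3 _.
  rewrite muleA -EFinM mulrC mulfK; last by rewrite gt_eqF ?powR_gt0.
  exact: lexx.
rewrite ge0_integralZl_EFin ?powR_ge0//; last 2 first.
- by move=> x _; rewrite adde_ge0 ?mule_ge0 ?lee_fin.
- apply: measurable_funTS; apply: emeasurable_funD => //; exact: measurable_funeM.
rewrite lee_wpmul2l ?lee_fin ?powR_ge0// ge0_integralD//; last 2 first.
- by move=> x _; rewrite mule_ge0 ?lee_fin.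
- by apply: measurable_funTS; exact: measurable_funeM.
rewrite ge0_integralZl_EFin//; last by exact: measurable_funTS.
rewrite integral_cst// [X in (_ + _ * X <= _)%E]lebesgue_cube -EFinM.
by rewrite weightE mulrC mulrA.
Qed.

End local_estimate.

Variables (N0 c0 : R).
Hypotheses (N0_gt0 : 0 < N0) (c0_gt0 : 0 < c0).
Hypothesis quasi : forall E : set (dyadic n), finite_set E -> E `<=` W ->
  let K := \bigcup_(Q in E) cube Q in
  (\esum_(Q in W) capacity s p (K `&` cube Q) G <= N0%:E * capacity s p K G)%E.
Hypothesis cap_lower : forall Q, W Q ->
  ((side Q `^ (n%:R - s * p))%:E <= c0%:E * capacity s p (cube Q) G)%E.

(** Both hypotheses together: the lower bound turns weights into capacities of the
    single cubes, which quasiadditivity bounds by the capacity of their union. *)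
Lemma sum_weight_le_energy X u : uniq X -> [set` X] `<=` W -> Cc G u ->
  (forall Q, Q \in X -> forall x, cube Q x -> 1 <= u x) ->
  ((\sum_(Q <- X) w Q)%:E <= (c0 * N0)%:E * gagliardo_energy s p G u)%E.
Proof.
move=> uX XW cu Xu; pose K := \bigcup_(Q in [set` X]) cube Q.
have KQ Q : Q \in X -> K `&` cube Q = cube Q.
  by move=> QX; apply/setIidPr => x Qx; exists Q.
rewrite -sumEFin.
apply: (@le_trans _ _ (\sum_(Q <- X) (c0%:E * capacity s p (K `&` cube Q) G)))%E.
  rewrite big_seq [leRHS]big_seq; apply: lee_sum => Q QX.
  by rewrite KQ//; apply: cap_lower; exact: XW.
rewrite -ge0_sume_distrr; last by move=> Q _; exact: capacity_ge0.
rewrite EFinM -muleA lee_wpmul2l//; first by rewrite lee_fin ltW.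
apply: (@le_trans _ _ (\esum_(Q in W) capacity s p (K `&` cube Q) G)%E).
  apply: esum_ge; exists [set` X]; first by split => //; exact: finite_seq.
  by rewrite fsbig_seq.
apply: le_trans (quasi (finite_seq X) XW) _.
rewrite lee_wpmul2l//; first by rewrite lee_fin ltW.
by apply: capacity_le_energy => // x [Q /= QX Qx]; exact: Xu QX _ Qx.
Qed.

(** Maz'ya's truncation: each Whitney cube is tested against the truncation of
    [g] at the dyadic level just below the minimum of [g] on the cube. *)
Lemma sum_weight_powR_le_energy X (g : 'rV[R]_n -> R) (t : dyadic n -> R) :
  uniq X -> [set` X] `<=` W -> Cc G g ->
  (forall Q, Q \in X -> 0 <= t Q /\ forall x, cube Q x -> t Q <= g x) ->
  ((\sum_(Q <- X) w Q * t Q `^ p)%:E <=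
   (c0 * N0 * 4 `^ p)%:E * gagliardo_energy s p G g)%E.
Proof.
move=> uX XW cg tg; have [r r0 Hr] := uniform_lower_bound X t.
pose rho := r / 2; have rho0 : 0 < rho by rewrite divr_gt0.
have [J HJ] := level_above X t rho0.
have lev1 : level rho 1 = r by rewrite /level expr1 divfK.
pose Xj j := [seq Q <- X | level rho j.+1 <= t Q].
pose gj j (x : 'rV[R]_n) := slice rho j (g x) / level rho j.
have sum_le : \sum_(Q <- X) w Q * t Q `^ p <=
    \sum_(j < J) (4 * level rho j) `^ p * \sum_(Q <- Xj j) w Q.
  apply: (@le_trans _ _ (\sum_(Q <- X) \sum_(j < J)
      (if level rho j.+1 <= t Q then (4 * level rho j) `^ p * w Q else 0))).
    rewrite big_seq [leRHS]big_seq; apply: ler_sum => Q QX.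
    have [tQ _] := tg Q QX.
    have t1 : 0 < t Q -> level rho 1 <= t Q by rewrite lev1; exact: Hr.
    have := powR_le_sum_level p_gt1 tQ t1 (HJ Q QX).
    move=> /(ler_wpM2l (powR_ge0 (side Q) (n%:R - s * p)))/le_trans; apply.
    rewrite mulr_sumr.
    by apply: ler_sum => j _; case: ifP; rewrite ?mulr0// mulrC.
  rewrite exchange_big/=; apply: ler_sum => j _.
  by rewrite -big_mkcond/= /Xj big_filter mulr_sumr.
apply: (@le_trans _ _ (\sum_(j < J) ((4 * level rho j) `^ p)%:E *
   ((c0 * N0)%:E * gagliardo_energy s p G (gj j)))%E).
  apply: le_trans (_ : (_ <= (\sum_(j < J) (4 * level rho j) `^ p *
    \sum_(Q <- Xj j) w Q)%:E)%E) _; first by rewrite lee_fin.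
  rewrite -sumEFin; apply: lee_sum => j _; rewrite EFinM lee_wpmul2l ?lee_fin ?powR_ge0//.
  apply: sum_weight_le_energy.
  - exact: filter_uniq.
  - by move=> Q /=; rewrite mem_filter => /andP[_ QX]; exact: XW.
  - apply: (@comp_Cc (fun t => slice rho j t / level rho j)) => //.
      by move=> y; apply: cvgM; [exact: slice_continuous|exact: cvg_cst].
    by rewrite slice0 ?mul0r.
  - move=> Q; rewrite mem_filter => /andP[jQ QX] x Qx; have [_ gQ] := tg Q QX.
    rewrite /gj slice_ge//; last exact: le_trans jQ (gQ x Qx).
    by rewrite divff// gt_eqF// level_gt0.
rewrite (eq_bigr (fun j : 'I_J => (c0 * N0)%:E * (((4 * level rho j) `^ p)%:E *
    gagliardo_energy s p G (gj j)))%E); last by move=> j _; rewrite muleCA.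
rewrite -ge0_sume_distrr; last first.
  by move=> j _; rewrite mule_ge0 ?lee_fin ?powR_ge0// gagliardo_energy_ge0.
rewrite [X in (_ <= X * _)%E]EFinM -muleA.
rewrite lee_wpmul2l ?lee_fin ?mulr_ge0 ?(ltW c0_gt0) ?(ltW N0_gt0)//.
by apply: sum_energy_slice_le => //; case: cg.
Qed.

Lemma compact_cube Q : compact (cube Q).
Proof.
rewrite (_ : cube Q = [set x | forall i, `[side Q * (Q.2 ord0 i)%:~R,
    side Q * (Q.2 ord0 i + 1)%:~R]%classic (x ord0 i)]).
  apply: (@rV_compact R n (fun i => `[side Q * (Q.2 ord0 i)%:~R,
    side Q * (Q.2 ord0 i + 1)%:~R]%classic)) => i; exact: segment_compact.
by apply/seteqP; split=> x H i; have := H i; rewrite /= in_itv.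
Qed.

Lemma cube_min (g : 'rV[R]_n -> R) Q : continuous g ->
  exists x, cube Q x /\ forall y, cube Q y -> g x <= g y.
Proof.
move=> cg; have [|x /set_mem Qx xmin] := EVT_min_rV (cube_neq0 Q) (@compact_cube Q) (f := g).
  exact: continuous_subspaceT.
by exists x; split=> // y Qy; apply: xmin; exact: mem_set.
Qed.

Let energy_const : R :=
  2 `^ p * (oscillation_const + c0 * N0 * 4 `^ p * ((3 / 2) `^ a * ((2 * n%:R * 2) ^+ n) ^+ 2)).

(** The support of [F] meets only finitely many cubes. On each of them the local
    estimate is used at a minimum point of the average [g], so that [g] is at
    least that value on the whole cube, as the truncation argument requires. *)
Let hardy_nonneg (F : 'rV[R]_n -> R) : (forall x, 0 <= F x) -> Cc G F ->
  (\int[lambda]_(x in G) (F x `^ p / d x `^ (s * p))%:E <=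
   energy_const%:E * gagliardo_energy s p G F)%E.
Proof.
move=> F0 cF; pose g := mollify G F.
have mF : measurable_fun setT F by apply: continuous_measurable_rV; case: cF.
have cg : Cc G g by exact: mollify_Cc.
have [c c_gt0 Fc] := Cc_dist_ge b0 d_gt0 cF.
have n0 : 0 < n%:R :> R by rewrite ltr0n.
have c5 : 0 < c / (5 * n%:R) by rewrite divr_gt0// mulr_gt0.
have /finite_seqP[X0 X0E] := finite_large_cubes wG mG bG c5.
pose X := undup X0; have uX : uniq X by exact: undup_uniq.
have memX Q : Q \in X <-> W Q /\ c / (5 * n%:R) <= side Q.
  by rewrite mem_undup; have /seteqP[H1 H2] := X0E; split=> [/H2|/H1].
have XW : [set` X] `<=` W by move=> Q /memX[].
have /choice[xQ HxQ] : forall Q, exists x, cube Q x /\ forall y, cube Q y -> g x <= g y.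
  by move=> Q; apply: cube_min; exact: mollify_continuous.
have mf : measurable_fun setT (fun x => (F x `^ p / d x `^ (s * p))%:E).
  exact: measurable_powR_dist.
have f0 x : (0 <= (F x `^ p / d x `^ (s * p))%:E)%E.
  by rewrite lee_fin divr_ge0 ?powR_ge0.
have mq := measurable_frac_quotient2 s p mF.
have q0 (z : 'rV[R]_n * 'rV[R]_n) : (0 <= (frac_quotient s p F z.1 z.2)%:E)%E.
  by rewrite lee_fin frac_quotient_ge0.
have mI : measurable_fun setT
    (fun x => \int[lambda]_(y in G) (frac_quotient s p F x y)%:E)%E.
  exact: (measurable_integral_section lambda mG mq q0).
have I0 x : (0 <= \int[lambda]_(y in G) (frac_quotient s p F x y)%:E)%E.
  by apply: integral_ge0 => y _; exact: (q0 (x, y)).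
have J0 Q : (0 <= \int[lambda]_(x in cube Q)
    \int[lambda]_(y in G) (frac_quotient s p F x y)%:E)%E.
  by apply: integral_ge0 => x _; exact: I0.
have O0 := oscillation_const_ge0.
have t0 Q : 0 <= w Q * g (xQ Q) `^ p by rewrite mulr_ge0 ?powR_ge0.
apply: le_trans (integral_le_sum_cube mG (X := X) _ mf f0) _.
  move=> x Gx fx; have [Q WQ Qx] := whitney_cover wG Gx.
  have Fx : F x != 0 by apply: contraNneq fx => ->; rewrite powR0 ?mul0r// gt_eqF.
  exists Q => //; apply/memX; split => //; rewrite ler_pdivrMr ?mulr_gt0// mulrC.
  by have [_ /le_trans] := Fc x Fx; apply; exact: (whitney_dist_le n_gt0 wG G0).
apply: (@le_trans _ _ (\sum_(Q <- X) ((2 `^ p)%:E * (oscillation_const%:E *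
    \int[lambda]_(x in cube Q) \int[lambda]_(y in G) (frac_quotient s p F x y)%:E +
    (w Q * g (xQ Q) `^ p)%:E)))%E).
  rewrite big_seq [leRHS]big_seq; apply: lee_sum => Q /memX[WQ _].
  by apply: whitney_cube_estimate => //; have [] := HxQ Q.
rewrite -ge0_sume_distrr; last by move=> Q _; rewrite adde_ge0 ?mule_ge0 ?lee_fin.
rewrite /energy_const [X in (_ <= X * _)%E]EFinM -muleA.
rewrite lee_wpmul2l ?lee_fin ?powR_ge0//.
rewrite big_split/= -ge0_sume_distrr// [X in (_ <= X * _)%E]EFinD ge0_muleDl; last 2 first.
- by rewrite lee_fin.
- by rewrite lee_fin !mulr_ge0 ?powR_ge0 ?exprn_ge0 ?(ltW c0_gt0) ?(ltW N0_gt0) ?mulr_ge0.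
apply: leeD.
  rewrite lee_wpmul2l ?lee_fin//; apply: (sum_integral_cube_le wG) => // Q /memX[WQ _].
  exact: (whitney_sub wG).
rewrite sumEFin [X in (_ <= X * _)%E]EFinM -muleA.
apply: le_trans (sum_weight_powR_le_energy uX XW cg (t := g \o xQ) _) _.
  move=> Q _; split; first exact: mollify_ge0.
  by have [] := HxQ Q.
rewrite lee_wpmul2l ?lee_fin ?mulr_ge0 ?powR_ge0 ?(ltW c0_gt0) ?(ltW N0_gt0)//.
exact: energy_mollify.
Qed.

Lemma hardy_of_quasiadditive : admits_hardy s p G.
Proof.
exists (energy_const + 1); have e0 : 0 <= energy_const.
  rewrite mulr_ge0 ?powR_ge0// addr_ge0 ?oscillation_const_ge0//.
  by rewrite !mulr_ge0 ?powR_ge0 ?exprn_ge0 ?(ltW c0_gt0) ?(ltW N0_gt0) ?mulr_ge0.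
split=> [|f cf]; first by rewrite ltr_wpDl.
pose F (x : 'rV[R]_n) : R := `|f x|.
have cF : Cc G F.
  apply: (@comp_Cc (fun t : R => `|t|)) => //; last exact: normr0.
  by move=> t; apply: cvg_norm; exact: cvg_id.
have E1 : (gagliardo_energy s p G F <= gagliardo_energy s p G f)%E.
  apply: (le_energy _ p_gt1 oG).
  - by apply: continuous_measurable_rV; case: cF.
  - by apply: continuous_measurable_rV; case: cf.
  - by move=> x y; exact: ler_dist_dist.
have F0 x : 0 <= F x by exact: normr_ge0.
apply: le_trans (hardy_nonneg F0 cF) _.
apply: (@le_trans _ _ (energy_const%:E * gagliardo_energy s p G f)%E).
  exact: (lee_wpmul2l (_ : (0 <= energy_const%:E)%E) E1).
by rewrite lee_wpmul2r ?gagliardo_energy_ge0// lee_fin lerDl.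
Qed.

End sufficiency.

(** * Integrals over dyadic shells *)

Section shells.
Context {R : realType} {n : nat}.
Local Notation N := (@eucl_norm R n).
Local Notation lambda := (@lebesgue_rV R n).

Lemma nneseries_geometric_le (c q : R) : 0 <= c -> 0 <= q < 1 ->
  (\sum_(j <oo) (c * q ^+ j)%:E <= (c / (1 - q))%:E)%E.
Proof.
move=> c0 /andP[q0 q1]; apply: lime_le.
  by apply: is_cvg_nneseries => j _ _; rewrite lee_fin mulr_ge0// exprn_ge0.
near=> k; rewrite sumEFin lee_fin -mulr_sumr ler_wpM2l//.
have q1' : 0 < 1 - q by rewrite subr_gt0.
rewrite -[leLHS]mulr1 -[leRHS]mul1r ler_pdivlMr ?mulr1//.
have := subrX1 q k; have : 0 <= q ^+ k by rewrite exprn_ge0.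
by rewrite big_mkord; move: (q ^+ k) (\sum_(i < k) _) => u v; lra.
Unshelve. all: by end_near. Qed.

Let shell (x : 'rV[R]_n) (c r : nat -> R) (j : nat) (y : 'rV[R]_n) : \bar R :=
  (c j * \1_(closed_box x (r j)) y)%:E.

Let measurable_shell x c r j : measurable_fun setT (shell x c r j).
Proof.
apply/measurable_EFinP; apply: measurable_funM => //; apply: measurable_indic.
exact: measurable_closed_box.
Qed.

Let integral_shell x c r j : 0 <= c j -> 0 <= r j ->
  (\int[lambda]_y shell x c r j y = (c j * (2 * r j) ^+ n)%:E)%E.
Proof.
move=> c0 r0; rewrite /shell; under eq_integral do rewrite EFinM.
rewrite ge0_integralZl_EFin//.
- rewrite integral_indic ?setIT//; last exact: measurable_closed_box.
  by rewrite [X in (_ * X)%E]lebesgue_closed_box// EFinM.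
- apply/measurable_EFinP; apply: measurable_indic.
  exact: measurable_closed_box.
Qed.

Let le_shell x c r j y (k : R) : k <= c j -> N (x - y) <= r j ->
  (k%:E <= shell x c r j y)%E.
Proof.
move=> kc xr; rewrite lee_fin indicE mem_set ?mulr1//; apply/closed_boxE => i.
by have := coord_le_eucl_norm (x - y) i; rewrite !mxE => /le_trans; apply.
Qed.

(** Each shell lies in a box, whose indicator function it is cheaper to integrate;
    the two families are meant for small and for large distances. *)
Lemma integral_shells_le (x : 'rV[R]_n) (k : 'rV[R]_n -> R) (c r c' r' : nat -> R) :
  measurable_fun setT k -> (forall y, 0 <= k y) ->
  (forall j, [/\ 0 <= c j, 0 <= r j, 0 <= c' j & 0 <= r' j]) ->
  (forall y, 0 < k y -> exists j,
     (k y <= c j /\ N (x - y) <= r j) \/ (k y <= c' j /\ N (x - y) <= r' j)) ->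
  (\int[lambda]_y (k y)%:E <= \sum_(j <oo) (c j * (2 * r j) ^+ n)%:E +
     \sum_(j <oo) (c' j * (2 * r' j) ^+ n)%:E)%E.
Proof.
move=> mk k0 cr0 H.
have s0 j y : (0 <= shell x c r j y)%E.
  by have [? _ _ _] := cr0 j; rewrite lee_fin mulr_ge0.
have s0' j y : (0 <= shell x c' r' j y)%E.
  by have [_ _ ? _] := cr0 j; rewrite lee_fin mulr_ge0.
pose f j y := (shell x c r j y + shell x c' r' j y)%E.
have f0 j y : (0 <= f j y)%E by rewrite adde_ge0.
have mf j : measurable_fun setT (f j) by exact: emeasurable_funD.
rewrite -nneseriesD; last 2 first.
- by move=> j _; have [? ? _ _] := cr0 j; rewrite lee_fin mulr_ge0// exprn_ge0// mulr_ge0.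
- by move=> j _; have [_ _ ? ?] := cr0 j; rewrite lee_fin mulr_ge0// exprn_ge0// mulr_ge0.
rewrite (eq_eseriesr (g := fun j => \int[lambda]_y f j y)%E); last first.
  move=> j _; have [? ? ? ?] := cr0 j.
  by rewrite ge0_integralD// !integral_shell.
rewrite -integral_nneseries//; apply: ge0_le_integral => //.
- by move=> y _; rewrite lee_fin.
- exact/measurable_EFinP.
- by apply: ge0_emeasurable_sum => // j y _ _; exact: f0.
move=> y _; have [ky|ky] := ltP 0 (k y); last first.
  by apply: (@le_trans _ _ 0%E); [rewrite lee_fin|apply: nneseries_ge0 => j _ _; exact: f0].
have [j kj] := H y ky.
apply: (@le_trans _ _ (f j y)).
  case: kj => -[k1 k2]; apply: le_trans (le_shell k1 k2) _.
  - by rewrite /f leeDl.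
  - by rewrite /f leeDr.
apply: le_trans (nneseries_lim_ge j.+1 _); last by move=> i _ _; exact: f0.
rewrite big_nat_recr//= leeDr//; apply: sume_ge0 => i _; exact: f0.
Qed.

Lemma dyadic_scale (t : R) : 1 <= t -> exists j, 2 ^+ j <= t <= 2 ^+ j.+1.
Proof.
move=> t1; have h0 : 0 < 2^-1 :> R by rewrite invr_gt0.
have [J HJ] := level_above [:: t] id h0.
have lev j : level 2^-1 j.+1 = 2 ^+ j :> R.
  by rewrite /level exprS mulrA mulVf// mul1r.
have [||j _] := @dyadic_level R 2^-1 J t.
- by rewrite lev expr0.
- by apply: HJ; rewrite mem_head.
- by rewrite !lev => /andP[t2 /ltW t3]; exists j; rewrite t2.
Qed.

End shells.

(** * Upper bound for the capacity of a Whitney cube *)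

Section test_function.
Context {R : realType} {n : nat}.
Implicit Types (Q : dyadic n).
Local Notation N := (@eucl_norm R n).
Local Notation lambda := (@lebesgue_rV R n).
Local Notation side := (@side R n).
Local Notation cube := (@cube R n).
Variables (s p : R) (G : set 'rV[R]_n) (W : set (dyadic n)).
Hypotheses (n_gt0 : (0 < n)%N) (s_gt0 : 0 < s) (s_lt1 : s < 1) (p_gt1 : 1 < p).
Hypotheses (oG : open G) (bG : bounded_set G) (G0 : G !=set0).
Hypothesis wG : whitney_decomposition G W.
Local Notation a := (n%:R + s * p).
Local Notation d x := (set_dist [set x] (boundary G)).

Let p_gt0 : 0 < p. Proof. exact: lt_trans p_gt1. Qed.
Let sp_gt0 : 0 < s * p. Proof. exact: mulr_gt0. Qed.
Let sp_ltp : s * p < p. Proof. by rewrite gtr_pMl. Qed.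
Let a_gt0 : 0 < a. Proof. by rewrite ltr_wpDl. Qed.
Let mG : measurable G. Proof. exact: open_measurable_rV. Qed.
Let b0 : boundary G !=set0. Proof. exact: whitney_boundary wG G0. Qed.

Definition bump Q (x : 'rV[R]_n) : R :=
  Num.max 0 (1 - 2 * set_dist [set x] (cube Q) / side Q).

Local Notation e Q x := (set_dist [set x] (cube Q)).

Let side0 Q : 0 < side Q. Proof. exact: side_gt0. Qed.
Let e0 Q (x : 'rV[R]_n) : 0 <= e Q x.
Proof. by apply: dist_ge0; exact: cube_neq0. Qed.

Lemma bump1 Q x : cube Q x -> bump Q x = 1.
Proof. by move=> Qx; rewrite /bump dist_eq0// mulr0 mul0r subr0 max_r. Qed.

Lemma bump_ge0 Q x : 0 <= bump Q x.
Proof. by rewrite le_max lexx. Qed.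

Lemma bump_le1 Q x : bump Q x <= 1.
Proof. by rewrite ge_max ler01/= gerBl mulr_ge0 ?invr_ge0 ?(ltW (side0 Q))// mulr_ge0. Qed.

Lemma bump_lipschitz Q x y : `|bump Q x - bump Q y| <= 2 / side Q * N (x - y).
Proof.
have H (t u : R) : `|Num.max 0 t - Num.max 0 u| <= `|t - u|.
  have h1 := ler_norm (t - u); have h2 := ler_norm (u - t); rewrite (distrC u) in h2.
  rewrite ler_norml !maxEle; do 2 case: ifPn; rewrite -?ltNge => *;
    by apply/andP; split; lra.
apply: le_trans (H _ _) _; rewrite opprB addrC addrA subrK.
rewrite -!mulrA -mulrBr -mulrBl normrM (ger0_norm (ler0n _ _)) ler_wpM2l//.
rewrite normrM (ger0_norm (_ : 0 <= (side Q)^-1)) ?invr_ge0 ?(ltW (side0 Q))//.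
rewrite mulrC ler_wpM2l ?invr_ge0 ?(ltW (side0 Q))//.
by rewrite eucl_normB; exact: dist_lipschitz_norm (cube_neq0 Q).
Qed.

Lemma bump_continuous Q : continuous (bump Q).
Proof. apply: lipschitz_continuous => x y; exact: bump_lipschitz. Qed.

Lemma bump_neq0 Q x : bump Q x != 0 ->
  exists2 q, cube Q q & N (x - q) < side Q / 2.
Proof.
move=> bx; apply: dist_lt; first exact: cube_neq0.
have : 0 < bump Q x by rewrite lt_neqAle eq_sym bx bump_ge0.
rewrite /bump lt_max ltxx/= subr_gt0 ltr_pdivrMr// mul1r.
by move: (set_dist _ _) => t; lra.
Qed.

Lemma bump_Cc Q : W Q -> Cc G (bump Q).
Proof.
move=> WQ; apply: (Cc_of_dist_ge bG b0 (@bump_continuous Q) (c := side Q / 2)).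
  by rewrite divr_gt0.
move=> x /bump_neq0[q Qq xq]; have dq := whitney_dist_ge n_gt0 wG G0 WQ Qq.
have Gq := whitney_sub wG WQ Qq; have := side0 Q; split.
  apply: (ball_subset oG Gq); rewrite eucl_normB lt_max; apply/orP; left.
  by move: (set_dist _ _) dq => t; lra.
have := dist_lipschitz q x b0; rewrite eucl_normB.
by move: (d q) (d x) dq => t t'; lra.
Qed.

Lemma bump_dist Q x y :
  `|bump Q x - bump Q y| <= Num.min 1 (2 / side Q * N (x - y)).
Proof.
rewrite le_min bump_lipschitz andbT ler_distl.
have := bump_ge0 Q x; have := bump_ge0 Q y; have := bump_le1 Q x.
by have := bump_le1 Q y; move=> *; apply/andP; split; lra.
Qed.

Let tail_const : R := 2 `^ p * 2 `^ a * 2 ^+ n / (1 - 2 `^ (s * p - p))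
  + 4 ^+ n / (1 - 2 `^ (- (s * p))).

Let powR_expn (t : R) (j : nat) : ((2 : R) ^+ j) `^ t = (2 `^ t) ^+ j.
Proof. by rewrite -powR_mulrn// -powRrM mulrC powRrM powR_mulrn// powR_ge0. Qed.

Let ratio_lt1 (t : R) : t < 0 -> 0 <= (2 : R) `^ t < 1.
Proof.
move=> t0; rewrite powR_ge0/= /powR gt_eqF// expR_lt1 nmulr_rlt0//.
by rewrite ln_gt0// ltr1n.
Qed.

(** The kernel is summable against dyadic shells: near the diagonal because
    [s < 1], at infinity because [s * p > 0]. *)
Lemma integral_kernel_le (l : R) (x : 'rV[R]_n) : 0 < l ->
  (\int[lambda]_y (Num.min 1 (2 / l * N (x - y)) `^ p / N (x - y) `^ a)%:E <=
   (tail_const / l `^ (s * p))%:E)%E.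
Proof.
move=> l0.
pose v j : R := 2 ^+ j.
have v0 j : 0 < v j by rewrite exprn_gt0.
(* for [l / (2 * v j) <= N (x - y) <= l / v j] the numerator is largest at the
   outer radius and the denominator smallest at the inner one *)
pose c j : R := (2 / v j) `^ p / (l / (2 * v j)) `^ a.
pose r j : R := l / v j.
pose c' j : R := ((l * v j) `^ a)^-1.
pose r' j : R := 2 * (l * v j).
pose k (y : 'rV[R]_n) := Num.min 1 (2 / l * N (x - y)) `^ p / N (x - y) `^ a.
have mk : measurable_fun setT k.
  have mN : measurable_fun setT (fun y : 'rV[R]_n => N (x - y)).
    by apply: measurableT_comp measurable_eucl_norm _; exact: measurable_rV_sub.
  apply: measurable_powR_div => //; apply: measurable_minr => //.
  exact: measurable_funM.
have k0 (y : 'rV[R]_n) : 0 <= k y by rewrite divr_ge0 ?powR_ge0.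
have cr0 j : [/\ 0 <= c j, 0 <= r j, 0 <= c' j & 0 <= r' j].
  have := ltW l0; have := ltW (v0 j) => ? ?.
  by split; rewrite ?invr_ge0 ?powR_ge0 ?divr_ge0 ?powR_ge0 ?mulr_ge0.
apply: le_trans (integral_shells_le (x := x) mk k0 cr0 _) _.
  move=> y ky; pose t := N (x - y); have t0 : 0 < t.
    rewrite eucl_norm_gt0 subr_eq0; apply: contraTneq ky => xy.
    by rewrite /k xy subrr eucl_norm0 mulr0 min_r// (powR0 (lt0r_neq0 p_gt0)) mul0r ltxx.
  have [tl|lt] := leP t l.
    have [j /andP[j1 j2]] : exists j, 2 ^+ j <= l / t <= 2 ^+ j.+1.
      by apply: dyadic_scale; rewrite ler_pdivlMr// mul1r.
    have vn := v0 j; rewrite -/(v j) exprS -/(v j) in j1 j2.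
    have j3 : t <= l / v j by rewrite ler_pdivlMr// mulrC -ler_pdivlMr.
    have j4 : l / (2 * v j) <= t.
      by rewrite ler_pdivrMr ?mulr_gt0// mulrC -ler_pdivrMr.
    have l4 : 0 < l / (2 * v j) by rewrite divr_gt0// mulr_gt0.
    exists j; left; split; last exact: j3.
    apply: ler_pM; rewrite ?powR_ge0 ?invr_ge0 ?powR_ge0//.
      apply: le_powR => //; first by rewrite le_min ler01/= !mulr_ge0 ?invr_ge0 ?ltW.
      rewrite ge_min; apply/orP; right; rewrite -/t -mulrA ler_pM2l//.
      by rewrite ler_pdivrMl.
    rewrite lef_pV2 ?posrE ?powR_gt0//; apply: ge0_ler_powR => //.
    - exact: ltW.
    - by rewrite nnegrE ltW.
    - by rewrite nnegrE ltW.
  have [j /andP[j1 j2]] : exists j, 2 ^+ j <= t / l <= 2 ^+ j.+1.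
    by apply: dyadic_scale; rewrite ler_pdivlMr// mul1r ltW.
  have vn := v0 j; rewrite -/(v j) exprS -/(v j) in j1 j2.
  have j3 : l * v j <= t by rewrite mulrC -ler_pdivlMr.
  have lv : 0 < l * v j by rewrite mulr_gt0.
  exists j; right; split; last first.
    by rewrite -/t /r' [l * _]mulrC mulrA -ler_pdivrMr.
  rewrite /k -/t /c' -[leRHS]mul1r; apply: ler_pM; rewrite ?powR_ge0 ?invr_ge0 ?powR_ge0//.
    have m0 : 0 <= Num.min 1 (2 / l * t).
      by rewrite le_min ler01/= !mulr_ge0 ?invr_ge0 ?ltW.
    have := le_powR p_gt1 m0 (_ : _ <= 1); rewrite powR1; apply.
    by rewrite ge_min lexx.
  rewrite lef_pV2 ?posrE ?powR_gt0//; apply: ge0_ler_powR => //.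
  - exact: ltW.
  - by rewrite nnegrE ltW.
  - by rewrite nnegrE ltW.
have lsp : l `^ (s * p) != 0 by rewrite gt_eqF// powR_gt0.
have ln0 : l ^+ n != 0 by rewrite expf_neq0// gt_eqF.
have E1 j : c j * (2 * r j) ^+ n =
    2 `^ p * 2 `^ a * 2 ^+ n / l `^ (s * p) * (2 `^ (s * p - p)) ^+ j.
  have vn := v0 j; have vsp : v j `^ (s * p) != 0 by rewrite gt_eqF// powR_gt0.
  have vp : v j `^ p != 0 by rewrite gt_eqF// powR_gt0.
  have vn0 : v j ^+ n != 0 by rewrite expf_neq0// gt_eqF.
  have -> : (2 `^ (s * p - p)) ^+ j = v j `^ (s * p) / v j `^ p.
    rewrite -powR_expn -/(v j) powRD ?powRN//.
    by apply/implyP => _; rewrite gt_eqF.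
  have powR_div (t t' q : R) : 0 < t -> 0 < t' -> (t / t') `^ q = t `^ q / t' `^ q.
    move=> t0 t0'; rewrite powRM ?invr_ge0 ?ltW//; congr (_ * _).
    by rewrite -powR_inv1 ?ltW// -powRrM mulN1r powRN.
  rewrite /c /r !powR_div ?mulr_gt0// powRM ?ltW//.
  rewrite !exprMn exprVn (powR_natD _ _ l0) (powR_natD _ _ vn).
  have a2 : (2 : R) `^ a != 0 by rewrite gt_eqF// powR_gt0.
  by field; rewrite a2 lsp ln0 vsp vp vn0.
have E2 j : c' j * (2 * r' j) ^+ n = 4 ^+ n / l `^ (s * p) * (2 `^ (- (s * p))) ^+ j.
  have vn := v0 j; have lv : 0 < l * v j by rewrite mulr_gt0.
  have lvn : (l * v j) ^+ n != 0 by rewrite expf_neq0// gt_eqF.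
  have lvsp : (l * v j) `^ (s * p) != 0 by rewrite gt_eqF// powR_gt0.
  rewrite /c' /r' (powR_natD _ _ lv) (_ : 2 * (2 * (l * v j)) = 4 * (l * v j)); last by ring.
  rewrite -powR_expn -/(v j) powRN -[RHS]mulrA -invfM -powRM ?ltW//.
  rewrite [(4 * _) ^+ n]exprMn; move: ((l * v j) ^+ n) lvn => w w0.
  by field; rewrite w0 lvsp.
under eq_eseriesr do rewrite E1.
under [X in (_ + X <= _)%E]eq_eseriesr do rewrite E2.
rewrite /tail_const mulrDl EFinD; apply: leeD.
  apply: le_trans (nneseries_geometric_le _ _) _.
  - by rewrite divr_ge0 ?mulr_ge0 ?powR_ge0.
  - by apply: ratio_lt1; rewrite subr_lt0.
  - by rewrite mulrAC.
apply: le_trans (nneseries_geometric_le _ _) _.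
- by rewrite divr_ge0 ?powR_ge0// exprn_ge0.
- by apply: ratio_lt1; rewrite oppr_lt0.
- by rewrite mulrAC.
Qed.

Let kernel (l : R) (z : 'rV[R]_n * 'rV[R]_n) : R :=
  Num.min 1 (2 / l * N (z.1 - z.2)) `^ p / N (z.1 - z.2) `^ a.

Let measurable_kernel l : measurable_fun setT (kernel l).
Proof.
have mN : measurable_fun setT (fun z : 'rV[R]_n * 'rV[R]_n => N (z.1 - z.2)).
  by apply: measurableT_comp measurable_eucl_norm _; exact: measurable_rV_sub.
apply: measurable_powR_div => //; apply: measurable_minr => //.
exact: measurable_funM.
Qed.

Let kernel_ge0 l z : 0 <= kernel l z.
Proof. by rewrite divr_ge0 ?powR_ge0. Qed.

Let integral_kernel_box (B : set 'rV[R]_n) (l m : R) : measurable B -> 0 < l ->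
  (lambda B <= m%:E)%E ->
  (\int[lambda]_(x in G) \int[lambda]_(y in G) (\1_B x * kernel l (x, y))%:E <=
   (tail_const / l `^ (s * p) * m)%:E)%E.
Proof.
move=> mB l0 Bm; set K := _ / _.
have mk : measurable_fun setT (fun z => (\1_B z.1 * kernel l z)%:E).
  apply/measurable_EFinP; apply: measurable_funM; last exact: measurable_kernel.
  by apply: measurableT_comp (measurable_indic _) measurable_fst.
have k0 z : (0 <= (\1_B z.1 * kernel l z)%:E)%E by rewrite lee_fin mulr_ge0.
have K0 : (0 <= K%:E)%E.
  apply: le_trans (integral_kernel_le 0 l0); apply: integral_ge0 => y _.
  by rewrite lee_fin divr_ge0 ?powR_ge0.
apply: (@le_trans _ _ (\int[lambda]_(x in G) (K%:E * (\1_B x)%:E))%E).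
  apply: ge0_le_integral => //.
  - by move=> x _; apply: integral_ge0 => y _; exact: (k0 (x, y)).
  - apply: measurable_funTS.
    exact: (measurable_integral_section lambda mG mk k0).
  - apply: measurable_funTS; apply: measurable_funeM; apply/measurable_EFinP.
    exact: measurable_indic.
  move=> x _; rewrite indicE; have [xB|xB] := boolP (x \in B).
    under eq_integral do rewrite mul1r.
    rewrite mule1; apply: le_trans (integral_kernel_le x l0).
    apply: ge0_subset_integral => //.
    - apply/measurable_EFinP.
      exact: (measurableT_comp (measurable_kernel l) (pair1_measurable x)).
    - by move=> y _; rewrite lee_fin; exact: (kernel_ge0 l (x, y)).
  by rewrite mule0 integral0_eq// => y _; rewrite mul0r.
rewrite ge0_integralZl//; last first.
- by apply: measurable_funTS; apply/measurable_EFinP; exact: measurable_indic.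
rewrite [X in (_ <= X)%E]EFinM; apply: lee_wpmul2l; first exact: K0.
rewrite integral_indic//; apply: le_trans Bm.
by apply: le_measure; rewrite ?inE//; exact: measurableI.
Qed.

(** The difference of the bump vanishes unless one of the two points lies in a box
    around the cube; by symmetry the first point may be taken there, and the
    kernel is then integrated in the second one. *)
Lemma energy_bump_le Q : (gagliardo_energy s p G (bump Q) <=
  (2 * 4 ^+ n * tail_const * side Q `^ (n%:R - s * p))%:E)%E.
Proof.
have l0 := side0 Q; pose l := side Q; have [q0 Qq0] := cube_neq0 (R := R) Q.
pose B := closed_box q0 (2 * l).
have mB : measurable B by exact: measurable_closed_box.
have l2 : 0 <= 2 * l by rewrite mulr_ge0// ltW.
have Bm : (lambda B <= ((2 * (2 * l)) ^+ n)%:E)%E.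
  exact: (eq_ind_r (fun v => (v <= _)%E) (lexx _) (lebesgue_closed_box q0 l2)).
have E := integral_kernel_box mB l0 Bm.
have supp x : bump Q x != 0 -> B x.
  move=> /bump_neq0[q Qq xq]; apply/closed_boxE => i.
  have := cube_coord i Qq0 Qq; have := coord_le_eucl_norm (x - q) i.
  rewrite !mxE -[q0 ord0 i - x ord0 i](subrKA (q ord0 i)) distrC => h1 h2.
  apply: le_trans (ler_normD _ _) _; move: xq; rewrite -/l in h2 *.
  by have : 0 < l by []; lra.
pose h (b : bool) (z : 'rV[R]_n * 'rV[R]_n) : \bar R :=
  (\1_B (if b then z.1 else z.2) * kernel l z)%:E.
have mh b : measurable_fun setT (h b).
  apply/measurable_EFinP; apply: measurable_funM; last exact: measurable_kernel.
  by case: b; apply: measurableT_comp (measurable_indic _) _.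
have h0 b z : (0 <= h b z)%E by rewrite lee_fin mulr_ge0.
have mb : measurable_fun setT (bump Q).
  by apply: continuous_measurable_rV; exact: bump_continuous.
pose hs z := (\sum_(b <- [:: true; false]) h b z)%E.
apply: (@le_trans _ _ (\int[lambda]_(x in G) \int[lambda]_(y in G) hs (x, y))%E).
  apply: (@le_integral2 _ _ _ _ _ lambda lambda G G mG mG _
    (measurable_frac_quotient2 s p mb) _ hs).
  - by move=> z; rewrite lee_fin frac_quotient_ge0.
  - by apply: emeasurable_sum => b; exact: mh.
  - by move=> z; apply: sume_ge0 => b _; exact: h0.
  move=> x y _ _; rewrite /hs big_cons big_seq1 /h -EFinD lee_fin /= -mulrDl.
  have qk : frac_quotient s p (bump Q) x y <= kernel l (x, y).
    rewrite /frac_quotient /kernel /= ler_wpM2r ?invr_ge0 ?powR_ge0//.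
    by apply: le_powR => //; exact: bump_dist.
  have [bx|/supp Bx] := eqVneq (bump Q x) 0; last first.
    by apply: le_trans qk _; rewrite ler_peMl// indicE mem_set// lerDl.
  have [bY|/supp By] := eqVneq (bump Q y) 0; last first.
    by apply: le_trans qk _; rewrite ler_peMl// [\1_B y]indicE mem_set// lerDr.
  rewrite {1}/frac_quotient bx bY subrr normr0 (powR0 (lt0r_neq0 p_gt0)) mul0r.
  by rewrite mulr_ge0// addr_ge0.
rewrite -(integral2_sum lambda lambda mG mG _ mh h0) big_cons big_seq1.
have sym : (\int[lambda]_(x in G) \int[lambda]_(y in G) h false (x, y) =
    \int[lambda]_(x in G) \int[lambda]_(y in G) h true (x, y))%E.
  rewrite (integral_swap lambda lambda mG mG (mh false) (h0 false)).
  apply: eq_integral => y _; apply: eq_integral => x _.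
  by rewrite /h /kernel /= eucl_normB.
rewrite sym {sym}; apply: le_trans (leeD E E) _; move=> {E}.
rewrite -EFinD lee_fin le_eqVlt; apply/orP; left; apply/eqP.
rewrite (powR_natB _ _ l0).
rewrite mulrA (_ : 2 * 2 = 4 :> R); last by ring.
by rewrite exprMn /l; field; rewrite gt_eqF// powR_gt0.
Qed.

Lemma capacity_cube_le : exists2 C1, 0 <= C1 &
  forall Q, W Q -> (capacity s p (cube Q) G <= (C1 * side Q `^ (n%:R - s * p))%:E)%E.
Proof.
exists `|2 * 4 ^+ n * tail_const| => // Q WQ.
apply: (@le_trans _ _ (gagliardo_energy s p G (bump Q))).
  apply: capacity_le_energy => //; first exact: bump_Cc.
  by move=> x Qx; rewrite bump1.
apply: le_trans (energy_bump_le Q) _.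
by rewrite lee_fin ler_wpM2r ?powR_ge0// ler_norm.
Qed.

End test_function.

(** * From the Hardy inequality to quasiadditivity and capacity bounds *)

Section necessity.
Context {R : realType} {n : nat}.
Implicit Types (u : 'rV[R]_n -> R) (P Q : dyadic n) (X Y : seq (dyadic n)).
Local Notation lambda := (@lebesgue_rV R n).
Local Notation side := (@side R n).
Local Notation cube := (@cube R n).
Variables (s p : R) (G : set 'rV[R]_n) (W : set (dyadic n)).
Hypotheses (n_gt0 : (0 < n)%N) (s_gt0 : 0 < s) (s_lt1 : s < 1) (p_gt1 : 1 < p).
Hypotheses (oG : open G) (bG : bounded_set G) (G0 : G !=set0).
Hypothesis wG : whitney_decomposition G W.
Variable C : R.
Hypothesis C_gt0 : 0 < C.
Hypothesis hardy : forall f, Cc G f ->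
  (\int[lambda]_(x in G)
     (`|f x| `^ p / set_dist [set x] (boundary G) `^ (s * p))%:E
   <= C%:E * gagliardo_energy s p G f)%E.

Local Notation d x := (set_dist [set x] (boundary G)).
Local Notation w Q := (side Q `^ (n%:R - s * p)).

Let p_gt0 : 0 < p. Proof. exact: lt_trans p_gt1. Qed.
Let sp_gt0 : 0 < s * p. Proof. exact: mulr_gt0. Qed.
Let mG : measurable G. Proof. exact: open_measurable_rV. Qed.
Let b0 : boundary G !=set0. Proof. exact: whitney_boundary wG G0. Qed.
Let d_gt0 (x : 'rV[R]_n) : G x -> 0 < d x.
Proof. exact: (whitney_dist_gt0 n_gt0 wG G0). Qed.
Let side0 Q : 0 < side Q. Proof. exact: side_gt0. Qed.
Let n5_gt0 : 0 < 5 * n%:R :> R. Proof. by rewrite mulr_gt0// ltr0n. Qed.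

Let weightE Q : w Q = side Q ^+ n / side Q `^ (s * p).
Proof. exact: powR_natB. Qed.

Let hardy_density u x : \bar R := (`|u x| `^ p / d x `^ (s * p))%:E.

Let measurable_hardy_density u : Cc G u -> measurable_fun setT (hardy_density u).
Proof.
case=> cu _ _; apply: measurable_powR_dist => //; apply: measurableT_comp => //.
exact: continuous_measurable_rV.
Qed.

Let hardy_density_ge0 u x : (0 <= hardy_density u x)%E.
Proof. by rewrite lee_fin divr_ge0 ?powR_ge0. Qed.

(** The weight is the volume of the cube over [side Q ^ (s * p)], and on the cube the
    distance to the boundary is at most [5 * n * side Q]. *)
Lemma weight_le_integral u Q : Cc G u -> W Q -> (forall x, cube Q x -> 1 <= u x) ->
  ((w Q)%:E <= ((5 * n%:R) `^ (s * p))%:E *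
     \int[lambda]_(x in cube Q) hardy_density u x)%E.
Proof.
move=> cu WQ u1; set A := (5 * n%:R) `^ (s * p); have A0 : 0 < A by rewrite powR_gt0.
have mQ := measurable_cube (R := R) Q.
pose k : R := (A * side Q `^ (s * p))^-1.
have k0 : 0 <= k by rewrite invr_ge0 mulr_ge0 ?powR_ge0.
have H : (k%:E * lambda (cube Q) <= \int[lambda]_(x in cube Q) hardy_density u x)%E.
  rewrite -(integral_cst lambda mQ k%:E); apply: ge0_le_integral; first exact: mQ.
  - by move=> x _; rewrite lee_fin.
  - exact: measurable_cst.
  - exact: measurable_funTS (measurable_hardy_density cu).
  move=> x Qx; rewrite lee_fin -[leLHS]mul1r.
  have u1x := u1 x Qx; have Gx := whitney_sub wG WQ Qx.
  apply: ler_pM => //.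
    have := le_powR p_gt1 ler01 (le_trans u1x (ler_norm (u x))).
    by rewrite powR1.
  rewrite /k /A -powRM; [|exact: ltW..].
  rewrite lef_pV2 ?posrE ?powR_gt0 ?(mulr_gt0 n5_gt0) ?d_gt0//.
  apply: ge0_ler_powR; [exact: ltW| | |exact: (whitney_dist_le n_gt0 wG G0)].
  - by rewrite nnegrE ltW// d_gt0.
  - by rewrite nnegrE ltW// (mulr_gt0 n5_gt0).
apply: le_trans (lee_wpmul2l (_ : (0 <= A%:E)%E) H); last by rewrite lee_fin ltW.
rewrite [X in (k%:E * X)%E](lebesgue_cube Q) -!EFinM lee_fin weightE /k.
rewrite le_eqVlt; apply/orP; left; apply/eqP.
by field; rewrite !gt_eqF// powR_gt0.
Qed.

(** Every competitor [u] for the capacity of a union of Whitney cubes is at least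
    [1] on them, where [d] is of the order of the side: the Hardy integral of [u]
    then dominates the sum of the weights. *)
Lemma sum_weight_le_capacity X : uniq X -> [set` X] `<=` W ->
  ((\sum_(Q <- X) w Q)%:E <= ((5 * n%:R) `^ (s * p) * C)%:E *
     capacity s p (\bigcup_(Q in [set` X]) cube Q) G)%E.
Proof.
move=> uX XW; set A := (5 * n%:R) `^ (s * p).
have A0 : 0 < A by rewrite powR_gt0.
have AC : 0 < A * C by rewrite mulr_gt0.
rewrite -lee_pdivrMl//; apply: le_capacity => // u cu u1.
rewrite lee_pdivrMl// EFinM -muleA.
apply: (@le_trans _ _ (A%:E * \int[lambda]_(x in G) hardy_density u x)%E); last first.
  by apply: lee_wpmul2l; [rewrite lee_fin ltW|exact: hardy].
apply: (@le_trans _ _ (A%:E *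
    \sum_(Q <- X) \int[lambda]_(x in cube Q) hardy_density u x)%E); last first.
  apply: lee_wpmul2l; first by rewrite lee_fin ltW.
  apply: (sum_integral_cube_le wG uX XW mG) => [Q QX||x].
  - exact: (whitney_sub wG (XW Q QX)).
  - exact: measurable_hardy_density.
  - exact: hardy_density_ge0.
rewrite ge0_sume_distrr; last by move=> Q _; apply: integral_ge0 => x _; exact: hardy_density_ge0.
rewrite -sumEFin big_seq [leRHS]big_seq; apply: lee_sum => Q QX.
apply: weight_le_integral => //; first exact: XW.
by move=> x Qx; apply: u1; exists Q.
Qed.

Lemma capacity_lower_of_hardy : exists c : R, 0 < c /\ forall Q, W Q ->
  ((w Q)%:E <= c%:E * capacity s p (cube Q) G)%E.
Proof.
exists ((5 * n%:R) `^ (s * p) * C); split; first by rewrite mulr_gt0// powR_gt0.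
move=> Q WQ; have H := @sum_weight_le_capacity [:: Q] isT.
rewrite big_seq1 (_ : [set` [:: Q]] = [set Q]) ?bigcup_set1 in H; last first.
  by apply/seteqP; split => P /=; rewrite mem_seq1 => /eqP.
by apply: H => _ ->.
Qed.

Definition touching_const : R := (5 * n%:R) `^ (s * p) * (2 * (5 * n%:R + 1)) ^+ n.

(** Whitney cubes that meet [P] have comparable sides, at most [5 n side P] and
    at least [side P / (5 n)], and disjoint interiors in a cube of side comparable
    to that of [P]: counting volumes bounds the sum of their weights. *)
Lemma sum_touching_le P Y : W P -> uniq Y -> [set` Y] `<=` W ->
  (forall Q, Q \in Y -> cube P `&` cube Q !=set0) ->
  \sum_(Q <- Y) w Q <= touching_const * w P.
Proof.
move=> WP uY YW PY; have [x0 Px0] := cube_neq0 (R := R) P.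
have lP := side0 P; set A := (5 * n%:R) `^ (s * p).
have A0 : 0 < A by rewrite powR_gt0.
pose r : R := (5 * n%:R + 1) * side P.
have r0 : 0 <= r by rewrite mulr_ge0 ?addr_ge0 ?ltW.
have vol : ((\sum_(Q <- Y) side Q ^+ n)%:E <= ((2 * r) ^+ n)%:E :> \bar R)%E.
  apply: le_trans (sum_side_le wG uY YW (measurable_closed_box x0 r) _) _.
    move=> Q QY x Qx; apply/closed_boxE => i; have WQ := YW Q QY.
    have [y [Py Qy]] := PY Q QY.
    have lQ : side Q <= 5 * n%:R * side P.
      by apply: (whitney_side_le n_gt0 wG G0 WQ WP); exists y.
    rewrite -[x0 ord0 i - _](subrKA (y ord0 i)).
    apply: le_trans (ler_normD _ _) _; rewrite /r mulrDl mul1r addrC lerD//.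
    - exact: le_trans (cube_coord i Qy Qx) lQ.
    - exact: (cube_coord i Px0 Py).
  exact: (eq_ind_r (fun v => (v <= _)%E) (lexx _) (lebesgue_closed_box x0 r0)).
rewrite lee_fin in vol.
apply: (@le_trans _ _ (A / side P `^ (s * p) * \sum_(Q <- Y) side Q ^+ n)).
  rewrite mulr_sumr big_seq [leRHS]big_seq; apply: ler_sum => Q QY.
  rewrite weightE mulrC ler_wpM2r ?exprn_ge0 ?(ltW (side0 Q))//.
  have lP5 := whitney_side_le n_gt0 wG G0 WP (YW Q QY) (PY Q QY).
  rewrite ler_pdivlMr ?powR_gt0// ler_pdivrMl ?powR_gt0//.
  rewrite /A -powRM ?(ltW (side0 Q)) ?(ltW n5_gt0)//.
  apply: ge0_ler_powR; rewrite ?nnegrE ?(ltW sp_gt0) ?(ltW lP)//.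
    by rewrite mulr_ge0// ltW.
  by rewrite mulrC.
apply: (@le_trans _ _ (A / side P `^ (s * p) * (2 * r) ^+ n)).
  by rewrite ler_wpM2l// divr_ge0 ?powR_ge0.
rewrite le_eqVlt; apply/orP; left; apply/eqP.
rewrite weightE /touching_const -/A /r mulrA [(_ * side P) ^+ n]exprMn.
by rewrite [LHS]mulrACA [_^-1 * _]mulrC.
Qed.

Lemma capacity_set0 : capacity s p set0 G = 0%E.
Proof.
apply/eqP; rewrite eq_le capacity_ge0// andbT.
have c0 : Cc G (fun=> 0 : R).
  apply: (Cc_of_dist_ge bG b0 (c := 1)) => //; last by move=> x; rewrite eqxx.
  exact: cst_continuous.
apply: le_trans (capacity_le_energy s p_gt1 c0 _) _ => //.
rewrite /gagliardo_energy integral0_eq// => x _; rewrite integral0_eq// => y _.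
by rewrite subrr normr0 powR0 ?gt_eqF// mul0r.
Qed.

(** A cube that meets [K] touches a cube of the family, and its capacity is at most
    of the order of its weight; the weights of the cubes that touch a given one
    add up to at most a multiple of the weight of that one. *)
Lemma quasiadditive_of_hardy : weakly_quasiadditive s p G W.
Proof.
have [C1 C10 capC1] := capacity_cube_le n_gt0 s_gt0 s_lt1 p_gt1 oG bG G0 wG.
have T0 : 0 <= touching_const.
  by rewrite mulr_ge0 ?powR_ge0// exprn_ge0// mulr_ge0// addr_ge0// ltW.
pose D : R := (5 * n%:R) `^ (s * p) * C.
have D0 : 0 < D by rewrite mulr_gt0// powR_gt0.
exists ((C1 * touching_const + 1) * D); split.
  by rewrite mulr_gt0// ltr_wpDl// mulr_ge0.
move=> E finE EW /=; set K := \bigcup_(Q in E) cube Q.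
have [X uX EX] : exists2 X, uniq X & E = [set` X].
  have [X ->] := (finite_seqP E).1 finE; exists (undup X); first exact: undup_uniq.
  by apply/seteqP; split => Q /=; rewrite mem_undup.
have XW : [set` X] `<=` W by rewrite -EX.
pose touch P Q := `[< cube P `&` cube Q !=set0 >].
apply: ge_ereal_sup => _ [B [finB BW] <-].
have [Y uY BY] : exists2 Y, uniq Y & B = [set` Y].
  have [Y ->] := (finite_seqP B).1 finB; exists (undup Y); first exact: undup_uniq.
  by apply/seteqP; split => Q /=; rewrite mem_undup.
have YW : [set` Y] `<=` W by rewrite -BY.
rewrite BY -fsbig_seq//.
have w0 Q : 0 <= w Q by exact: powR_ge0.
have capK Q : Q \in Y ->
    (capacity s p (K `&` cube Q) G <= (C1 * \sum_(P <- X | touch P Q) w Q)%:E)%E.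
  move=> QY; have [KQ|/set0P[x [[P EP Px] Qx]]] := eqVneq (K `&` cube Q) set0.
    by rewrite KQ capacity_set0 lee_fin mulr_ge0// sumr_ge0.
  apply: le_trans (le_capacityS s G p_gt1 (@subIsetr _ K (cube Q))) _.
  apply: le_trans (capC1 Q (YW Q QY)) _; rewrite lee_fin ler_wpM2l//.
  have PX : P \in X by rewrite EX in EP.
  have tPQ : touch P Q by apply/asboolP; exists x.
  rewrite -big_filter (bigD1_seq P)/= ?filter_uniq//; last by rewrite mem_filter tPQ.
  by rewrite lerDl sumr_ge0.
apply: (@le_trans _ _ (\sum_(Q <- Y) (C1 * \sum_(P <- X | touch P Q) w Q)%:E)%E).
  by rewrite big_seq [leRHS]big_seq; exact: lee_sum.
rewrite sumEFin -mulr_sumr (exchange_big_dep predT)//=.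
apply: (@le_trans _ _ ((C1 * touching_const * \sum_(P <- X) w P)%:E)).
  rewrite lee_fin -mulrA ler_wpM2l// mulr_sumr big_seq [leRHS]big_seq.
  apply: ler_sum => P PX; rewrite -big_filter; apply: sum_touching_le.
  - exact: XW.
  - exact: filter_uniq.
  - by move=> Q /=; rewrite mem_filter => /andP[_ QY]; exact: YW.
  - by move=> Q; rewrite mem_filter => /andP[/asboolP].
rewrite EFinM [X in (_ <= X * _)%E]EFinM -muleA.
have cK := sum_weight_le_capacity uX XW; rewrite -EX -/K -/D in cK.
have DK : (0 <= D%:E * capacity s p K G)%E.
  by rewrite mule_ge0 ?capacity_ge0// lee_fin ltW.
apply: (@le_trans _ _ ((C1 * touching_const)%:E * (D%:E * capacity s p K G))%E).
  by apply: lee_wpmul2l => //; rewrite lee_fin mulr_ge0.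
by apply: lee_wpmul2r => //; rewrite lee_fin lerDl.
Qed.

End necessity.

(** * The equivalence *)

Theorem theorem4p3 (R : realType) (n : nat) (s p : R)
    (G : set 'rV[R]_n) (W : set (dyadic n)) :
  0 < s < 1 -> 1 < p -> s * p < n%:R ->
  G !=set0 -> bounded_set G -> open G ->
  whitney_decomposition G W ->
  admits_hardy s p G <->
  (weakly_quasiadditive s p G W /\
   exists c : R, 0 < c /\ forall Q, W Q ->
     ((side Q `^ (n%:R - s * p))%:E <= c%:E * capacity s p (cube Q) G)%E).
Proof.
move=> /andP[s0 s1] p1 spn G0 bG oG wG.
have n0 : (0 < n)%N.
  by rewrite -(ltr0n R) (lt_trans _ spn)// mulr_gt0// (lt_trans _ p1).
split=> [[C [C0 hardy]]|[[N0 [N00 quasi]] [c0 [c00 lower]]]].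
  split; first exact: (quasiadditive_of_hardy n0 s0 s1 p1 oG bG G0 wG C0 hardy).
  exact: (capacity_lower_of_hardy n0 s0 p1 oG G0 wG C0 hardy).
exact: (hardy_of_quasiadditive n0 s0 p1 oG bG G0 wG N00 c00 quasi lower).
Qed.
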